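(* Let $z,z'$ be complex parameters satisfying the standing assumption of the context, $t=zz'$, and $0<\xi<1$. Let $$K=\begin{bmatrix}K_{++}&K_{+-}\\ K_{-+}&K_{--}\end{bmatrix}$$ be the operator in $\ell^2(\mathbb Z_+)\oplus\ell^2(\mathbb Z_+)$ whose blocks are given by the matrices ($k,l\in\mathbb Z_+$) $$K_{++}(k,l)=\frac{P_+(k)Q_+(l)-Q_+(k)P_+(l)}{k-l},\qquad K_{+-}(k,l)=\frac{P_+(k)P_-(l)+Q_+(k)Q_-(l)}{k+l+1},$$ $$K_{-+}(k,l)=-\frac{P_-(k)P_+(l)+Q_-(k)Q_+(l)}{k+l+1},\qquad K_{--}(k,l)=\frac{P_-(k)Q_-(l)-Q_-(k)P_-(l)}{k-l},$$ where the values of $K_{++}(k,l)$ and $K_{--}(k,l)$ at $k=l$ are understood according to the L'Hospital rule, i.e. $K_{\pm\pm}(k,k)=P_\pm'(k)Q_\pm(k)-Q_\pm'(k)P_\pm(k)$. Let $L$ be the operator in $\ell^2(\mathbb Z_+)\oplus\ell^2(\mathbb Z_+)$ given by $$L=\begin{bmatrix}0&\Psi_+^{1/2}W\Psi_-^{1/2}\\ -\Psi_-^{1/2}W\Psi_+^{1/2}&0\end{bmatrix}.$$ Then $K=L(1+L)^{-1}$.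
   Context: $\mathbb Z_+=\{0,1,2,\dots\}$; $(a)_k=a(a+1)\cdots(a+k-1)$, $(a)_0=1$. Standing assumption on $z,z'$: $(z)_k(z')_k$ and $(-z)_k(-z')_k$ are real and strictly positive for all $k=1,2,\dots$. Equivalently, either $z'=\bar z$ and $z\in\mathbb C\setminus\mathbb Z$, or $z,z'\in\mathbb R$ and there is $m\in\mathbb Z$ with $m<z,z'<m+1$. In particular $t=zz'>0$. $F(a,b;c;w)$ is the Gauss hypergeometric function ${}_2F_1$, analytically continued in $w$ to $\mathbb C\setminus[1,\infty)$. Define the meromorphic functions $$\psi_\pm(u)=t^{1/2}\,\xi^{u+1/2}\,(1-\xi)^{\pm(z+z')}\,\frac{\Gamma(u+1\pm z)\Gamma(u+1\pm z')}{\Gamma(1\pm z)\Gamma(1\pm z')\Gamma(u+1)\Gamma(u+1)},$$ so that for $k\in\mathbb Z_+$ $$\psi_\pm(k)=t^{1/2}\xi^{k+1/2}(1-\xi)^{\pm(z+z')}\frac{(1\pm z)_k(1\pm z')_k}{k!\,k!}>0 .$$ Define $$R_\pm(u)=\psi_\pm(u)\,F\!\left(\mp z,\mp z';u+1;\tfrac{\xi}{\xi-1}\right),$$ $$S_\pm(u)=\frac{t^{1/2}\xi^{1/2}\psi_\pm(u)}{1-\xi}\,\frac{F\!\left(1\mp z,1\mp z';u+2;\tfrac{\xi}{\xi-1}\right)}{u+1},$$ $$P_\pm(u)=\psi_\pm(u)^{-1/2}R_\pm(u),\qquad Q_\pm(u)=\psi_\pm(u)^{-1/2}S_\pm(u),$$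 with positive square roots; $P_\pm,Q_\pm$ are considered at points $k\in\mathbb Z_+$ and in small real neighbourhoods of these points, where $\psi_\pm>0$. $\Psi_\pm$ are the diagonal matrices of format $\mathbb Z_+\times\mathbb Z_+$ with $k$-th diagonal entry $\psi_\pm(k)$, $\Psi_\pm^{1/2}$ are the diagonal matrices of positive square roots, and $W(k,l)=\frac1{k+l+1}$, $k,l\in\mathbb Z_+$. *)

(* Defs.v *)
From Stdlib Require Export Reals Factorial ClassicalEpsilon.
From Coquelicot Require Export Coquelicot.

Open Scope R_scope.

Definition Cexp (w : C) : C :=
  (exp (Re w) * cos (Im w), exp (Re w) * sin (Im w)).

(** [x ^ s] for [x > 0] and complex [s], with the real logarithm of [x]. *)
Definition Cpower (x : R) (s : C) : C := Cexp (s * ln x)%C.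

Fixpoint poch (a : C) (k : nat) : C :=
  match k with
  | O => 1%C
  | S j => (poch a j * (a + INR j))%C
  end.

(** Limit of a complex sequence, computed on the real and imaginary parts
    (meaningful when both converge to finite limits). *)
Definition Clim_seq (u : nat -> C) : C :=
  (real (Lim_seq (fun n => Re (u n))), real (Lim_seq (fun n => Im (u n)))).

(** Euler's limit formula
    [Gamma s = lim n! n^s / (s (s+1) ... (s+n))],
    valid at every complex [s] which is not a pole. *)
Definition Gamma (s : C) : C :=
  Clim_seq (fun n => INR (fact n) * Cpower (INR n) s / poch s (S n))%C.

(** [f] is given near [w0] by a convergent power series. *)
Definition analytic_at (f : C -> C) (w0 : C) : Prop :=
  exists (a : nat -> C) (r : R), 0 < r /\
    forall w : C, Cmod (w - w0) < r ->
      @is_pseries C_AbsRing C_NormedModule a (w - w0)%C (f w).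

(** Coefficients of the Gauss series; [c] must avoid [0, -1, -2, ...]. *)
Definition gauss_coef (a b c : C) (n : nat) : C :=
  (poch a n * poch b n / (poch c n * INR (fact n)))%C.

(** [y] is the value at [w] of the analytic continuation of the Gauss series
    inside the plane cut along [[1, +oo)].  The cut plane is star-shaped about
    the origin, and so is the intersection of two regions star-shaped about the
    origin.  Hence all the functions [f] below take the same value at [w],
    namely that of the continuation to the whole cut plane (which is itself an
    admissible [U]). *)
Definition hyp2F1_value (a b c w y : C) : Prop :=
  exists (U : C -> Prop) (f : C -> C),
    (forall v : C, U v -> exists r : R, 0 < r /\
       forall v' : C, Cmod (v' - v) < r -> U v') /\
    (forall (v : C) (s : R), U v -> 0 <= s <= 1 -> U (s * v)%C) /\
    (forall x : R, 1 <= x -> ~ U x) /\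
    (forall v : C, U v -> analytic_at f v) /\
    (exists r : R, 0 < r /\ forall v : C, Cmod v < r ->
       @is_pseries C_AbsRing C_NormedModule (gauss_coef a b c) v (f v)) /\
    U w /\ f w = y.

Definition hyp2F1 (a b c w : C) : C :=
  epsilon (inhabits (RtoC 0)) (hyp2F1_value a b c w).

Definition DeriveC (f : R -> C) (x : R) : C :=
  (Derive (fun u => Re (f u)) x, Derive (fun u => Im (f u)) x).

Definition Cpositive (c : C) : Prop := Im c = 0 /\ 0 < Re c.

Definition admissible (z z' : C) : Prop :=
  forall k : nat, (1 <= k)%nat ->
    Cpositive (poch z k * poch z' k) /\ Cpositive (poch (- z) k * poch (- z') k).

(** Positive square root of a complex number known to be real and positive. *)
Definition Csqrt_pos (c : C) : C := RtoC (sqrt (Re c)).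

(** The signs labelling the two copies of [Z_+]. *)
Inductive sign : Set := plus | minus.

Definition sg (s : sign) (x : C) : C :=
  match s with plus => x | minus => (- x)%C end.

Definition psi (z z' : C) (xi : R) (s : sign) (u : C) : C :=
  (Csqrt_pos (z * z') * Cpower xi (u + / 2) * Cpower (1 - xi) (sg s (z + z'))
   * (Gamma (u + 1 + sg s z) * Gamma (u + 1 + sg s z')
      / (Gamma (1 + sg s z) * Gamma (1 + sg s z') * Gamma (u + 1) * Gamma (u + 1))))%C.

Definition Rfun (z z' : C) (xi : R) (s : sign) (u : C) : C :=
  (psi z z' xi s u
   * hyp2F1 (- sg s z) (- sg s z') (u + 1) (RtoC (xi / (xi - 1))))%C.

Definition Sfun (z z' : C) (xi : R) (s : sign) (u : C) : C :=
  (Csqrt_pos (z * z') * sqrt xi * psi z z' xi s u / (1 - xi)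
   * (hyp2F1 (1 - sg s z) (1 - sg s z') (u + 2) (RtoC (xi / (xi - 1))) / (u + 1)))%C.

(** [Pfun] and [Qfun] are only meaningful for real [u] close to [Z_+], where
    [psi] is real and positive. *)
Definition Pfun (z z' : C) (xi : R) (s : sign) (u : R) : C :=
  (Rfun z z' xi s u / Csqrt_pos (psi z z' xi s u))%C.

Definition Qfun (z z' : C) (xi : R) (s : sign) (u : R) : C :=
  (Sfun z z' xi s u / Csqrt_pos (psi z z' xi s u))%C.

(** [A s k s' l] is the entry [(k, l)] of the block [A_{s s'}]. *)
Definition block_matrix := sign -> nat -> sign -> nat -> C.

Definition diag_block (z z' : C) (xi : R) (s : sign) (k l : nat) : C :=
  let P := Pfun z z' xi s in
  let Q := Qfun z z' xi s in
  let x := INR k in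
  let y := INR l in
  if Nat.eqb k l then (DeriveC P x * Q x - DeriveC Q x * P x)%C
  else ((P x * Q y - Q x * P y) / (x - y))%C.

Definition offdiag_block (z z' : C) (xi : R) (s s' : sign) (k l : nat) : C :=
  let P := Pfun z z' xi in
  let Q := Qfun z z' xi in
  let x := INR k in
  let y := INR l in
  ((P s x * P s' y + Q s x * Q s' y) / (x + y + 1))%C.

Definition K_matrix (z z' : C) (xi : R) : block_matrix := fun s k s' l =>
  match s, s' with
  | plus, plus => diag_block z z' xi plus k l
  | plus, minus => offdiag_block z z' xi plus minus k l
  | minus, plus => (- offdiag_block z z' xi minus plus k l)%C
  | minus, minus => diag_block z z' xi minus k l
  end.

Definition W (k l : nat) : C := (/ (INR k + INR l + 1))%C.

(** Entry [(k, l)] of [Psi_s^(1/2) W Psi_s'^(1/2)]. *)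
Definition PsiWPsi (z z' : C) (xi : R) (s s' : sign) (k l : nat) : C :=
  (Csqrt_pos (psi z z' xi s (INR k)) * W k l * Csqrt_pos (psi z z' xi s' (INR l)))%C.

Definition L_matrix (z z' : C) (xi : R) : block_matrix := fun s k s' l =>
  match s, s' with
  | plus, plus => 0%C
  | plus, minus => PsiWPsi z z' xi plus minus k l
  | minus, plus => (- PsiWPsi z z' xi minus plus k l)%C
  | minus, minus => 0%C
  end.

(** Pairs of sequences; [v plus] and [v minus] are the two components. *)
Definition vec := sign -> nat -> C.

Definition vplus (v w : vec) : vec := fun s k => (v s k + w s k)%C.
Definition vscal (c : C) (v : vec) : vec := fun s k => (c * v s k)%C.

Definition in_l2 (v : vec) : Prop :=
  forall s : sign, ex_series (fun k => Cmod (v s k) ^ 2).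

Definition l2_norm (v : vec) : R :=
  sqrt (Series (fun k => Cmod (v plus k) ^ 2) + Series (fun k => Cmod (v minus k) ^ 2)).

(** A map on [vec] stands for an operator in [l^2 (+) l^2] through its
    restriction to square-summable vectors; other values are irrelevant. *)
Definition bounded_operator (T : vec -> vec) : Prop :=
  (forall v, in_l2 v -> in_l2 (T v)) /\
  (forall v w, in_l2 v -> in_l2 w -> T (vplus v w) = vplus (T v) (T w)) /\
  (forall c v, in_l2 v -> T (vscal c v) = vscal c (T v)) /\
  (exists M : R, forall v, in_l2 v -> l2_norm (T v) <= M * l2_norm v).

Definition basis_vec (s : sign) (k : nat) : vec := fun s' k' =>
  match s, s' with
  | plus, plus | minus, minus => if Nat.eqb k k' then 1%C else 0%C
  | _, _ => 0%C
  end.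

(** [T] is the bounded operator with matrix [A].  It is determined by [A],
    since finite combinations of basis vectors are dense in [l^2 (+) l^2]. *)
Definition is_operator_of (A : block_matrix) (T : vec -> vec) : Prop :=
  bounded_operator T /\
  forall s k s' l, T (basis_vec s' l) s k = A s k s' l.

Definition id_plus (T : vec -> vec) : vec -> vec := fun v => vplus v (T v).

Definition is_inverse (T N : vec -> vec) : Prop :=
  bounded_operator N /\
  forall v, in_l2 v -> N (T v) = v /\ T (N v) = v.

(* Main.v *)
Require Import Defs.
From Stdlib Require Import Lra Lia Psatz FunctionalExtensionality.

(** Write [P = psi^(1/2) p] and [Q = psi^(1/2) q].  As functions of [u], [p_s] and [q_s] have
    simple poles at [-1, -2, ...], and their partial fraction expansions are
    [p_s(u) = 1 - sum_m psi_(-s)(m) q_(-s)(m) / (u + m + 1)] and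
    [q_s(u) = sum_m psi_(-s)(m) p_(-s)(m) / (u + m + 1)].  After Pfaff's transformation of both
    sides these become, coefficient by coefficient in [xi], partial fraction identities for
    quotients of Pochhammer symbols.  They say that [(1 + L) (P_+, Q_-) = (psi_+^(1/2), 0)] and
    [(1 + L) (- Q_+, P_-) = (0, psi_-^(1/2))].

    [L] is antisymmetric, so [1 + L] is invertible, and its commutator with the diagonal operator
    [(k + 1/2) (+) (- (k + 1/2))] has rank two, with columns built from [psi_+^(1/2)] and
    [psi_-^(1/2)].  Hence the commutator of [L (1 + L)^(-1)] is explicit in terms of the two
    solutions above, which gives every entry off the diagonal; the diagonal follows from
    [K = L - L K], and agrees with the L'Hospital value by differentiating the expansions. *)

(** Both special functions are given implicitly: [hyp2F1] by a choice among values of continuations,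
    [Gamma] as a limit. For xi >= 1/2 the argument xi / (xi - 1) lies outside the open unit disc,
    beyond the reach of the Gauss series. Pfaff's transformation moves it to xi, but must first be
    shown to yield an admissible continuation and the only possible value; a half-plane containing
    the negative axis is enough for this.

    Since [psi] carries the factor xi^k, the matrix of L is dominated by M r^i r^j. Such double
    series can be rearranged with explicit errors, and L sends bounded vectors to geometrically
    decaying ones, so most of the operator theory is done entry by entry.

    The entries at k = l require [psi] to be differentiable near each integer, but not the value of
    its derivative. Differentiability comes from the logarithm of Euler's product, whose factors
    have slopes O(1 / m^2). The standing assumption enters through the positivity of (m + z) (m +
    z') and (m - z) (m - z') at the integers m >= 0, which also makes z + z' real. *)

Lemma Cmod_im_le (c : C) : Rabs (Im c) <= Cmod c.
Proof. destruct c as [x y]. apply Rle_trans with (2 := Rmax_Cmod (x, y)). apply Rmax_r. Qed.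

Lemma Cmod_le_Re_Im (c : C) : Cmod c <= Rabs (Re c) + Rabs (Im c).
Proof.
  destruct c as [x y]. unfold Cmod, Re, Im; simpl fst; simpl snd.
  apply Rsqr_incr_0_var; [|generalize (Rabs_pos x) (Rabs_pos y); lra].
  rewrite Rsqr_sqrt by nra. unfold Rsqr.
  generalize (Rabs_pos x) (Rabs_pos y) (pow2_abs x) (pow2_abs y). nra.
Qed.

Lemma Cmod_minus_le (a b : C) : Cmod (a - b) <= Cmod a + Cmod b.
Proof. unfold Cminus. rewrite <- (Cmod_opp b). apply Cmod_triangle. Qed.

Lemma Cmod_minus_sym (a b : C) : Cmod (a - b) = Cmod (b - a).
Proof. rewrite <- Cmod_opp. f_equal. ring. Qed.

Lemma Cmod_rev_triangle (a b : C) : Cmod a - Cmod b <= Cmod (a + b).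
Proof.
  replace a with ((a + b) - b)%C at 1 by ring.
  generalize (Cmod_minus_le (a + b) b). lra.
Qed.

Lemma C_ext (a b : C) : Re a = Re b -> Im a = Im b -> a = b.
Proof. destruct a, b; unfold Re, Im; simpl; congruence. Qed.

Lemma Cmod_RtoC_pos (x : R) : 0 <= x -> Cmod (RtoC x) = x.
Proof. intros. rewrite Cmod_R. apply Rabs_pos_eq; auto. Qed.

(** * Limits of complex sequences *)

Definition Clim (u : nat -> C) (l : C) : Prop :=
  is_lim_seq (fun n => Re (u n)) (Re l) /\ is_lim_seq (fun n => Im (u n)) (Im l).

Lemma Clim_Cmod (u : nat -> C) (l : C) :
  Clim u l <-> is_lim_seq (fun n => Cmod (u n - l)) 0.
Proof.
  split.
  - intros [H1 H2].
    apply is_lim_seq_le_le with (u := fun _ => 0)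
      (w := fun n => Rabs (Re (u n) - Re l) + Rabs (Im (u n) - Im l)).
    + intros n; split; [apply Cmod_ge_0|].
      eapply Rle_trans; [apply Cmod_le_Re_Im|]. destruct (u n), l; simpl. right; reflexivity.
    + apply is_lim_seq_const.
    + replace (Finite 0) with (Finite (Rabs (Re l - Re l) + Rabs (Im l - Im l)))
        by (f_equal; rewrite !Rminus_diag, Rabs_R0; ring).
      apply is_lim_seq_plus'.
      * apply (is_lim_seq_abs (fun n => Re (u n) - Re l) (Re l - Re l)).
        apply is_lim_seq_minus'; [exact H1|apply is_lim_seq_const].
      * apply (is_lim_seq_abs (fun n => Im (u n) - Im l) (Im l - Im l)).
        apply is_lim_seq_minus'; [exact H2|apply is_lim_seq_const].
  - intros H; split.
    + apply is_lim_seq_ext with (fun n => (Re (u n) - Re l) + Re l); [intros; ring|].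
      replace (Finite (Re l)) with (Finite (0 + Re l)) by (f_equal; ring).
      apply is_lim_seq_plus'; [|apply is_lim_seq_const].
      apply is_lim_seq_abs_0.
      apply is_lim_seq_le_le with (u := fun _ => 0) (w := fun n => Cmod (u n - l));
        [|apply is_lim_seq_const|exact H].
      intros n; split; [apply Rabs_pos|].
      eapply Rle_trans; [|apply re_le_Cmod]. destruct (u n), l; simpl; right; reflexivity.
    + apply is_lim_seq_ext with (fun n => (Im (u n) - Im l) + Im l); [intros; ring|].
      replace (Finite (Im l)) with (Finite (0 + Im l)) by (f_equal; ring).
      apply is_lim_seq_plus'; [|apply is_lim_seq_const].
      apply is_lim_seq_abs_0.
      apply is_lim_seq_le_le with (u := fun _ => 0) (w := fun n => Cmod (u n - l));
        [|apply is_lim_seq_const|exact H].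
      intros n; split; [apply Rabs_pos|].
      eapply Rle_trans; [|apply Cmod_im_le]. destruct (u n), l; simpl; right; reflexivity.
Qed.

Lemma Clim_squeeze (u : nat -> C) (l : C) (e : nat -> R) :
  (forall n, Cmod (u n - l) <= e n) -> is_lim_seq e 0 -> Clim u l.
Proof.
  intros H He. apply Clim_Cmod.
  apply is_lim_seq_le_le with (u := fun _ => 0) (w := e); auto.
  - intros n; split; [apply Cmod_ge_0|apply H].
  - apply is_lim_seq_const.
Qed.

Lemma Clim_ext (u v : nat -> C) (l : C) :
  (forall n, u n = v n) -> Clim u l -> Clim v l.
Proof.
  intros H [H1 H2]; split; eapply is_lim_seq_ext; try eassumption; intros n; simpl; now rewrite H.
Qed.

Lemma Clim_ext_loc (u v : nat -> C) (l : C) :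
  (exists N, forall n, (N <= n)%nat -> u n = v n) -> Clim u l -> Clim v l.
Proof.
  intros [N H] [H1 H2]; split; eapply is_lim_seq_ext_loc; try eassumption;
    exists N; intros n Hn; simpl; now rewrite H.
Qed.

Lemma Clim_unique (u : nat -> C) (l l' : C) : Clim u l -> Clim u l' -> l = l'.
Proof.
  intros [H1 H2] [H3 H4]. apply C_ext.
  - apply is_lim_seq_unique in H1. apply is_lim_seq_unique in H3. congruence.
  - apply is_lim_seq_unique in H2. apply is_lim_seq_unique in H4. congruence.
Qed.

Lemma Clim_const (l : C) : Clim (fun _ => l) l.
Proof. split; apply is_lim_seq_const. Qed.

Lemma Clim_plus (u v : nat -> C) (l m : C) :
  Clim u l -> Clim v m -> Clim (fun n => u n + v n)%C (l + m).
Proof. intros [H1 H2] [H3 H4]; split; simpl; apply is_lim_seq_plus'; auto. Qed.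

Lemma Clim_mult (u v : nat -> C) (l m : C) :
  Clim u l -> Clim v m -> Clim (fun n => u n * v n)%C (l * m).
Proof.
  intros [H1 H2] [H3 H4]; split; simpl.
  - apply is_lim_seq_minus'; apply is_lim_seq_mult'; auto.
  - apply is_lim_seq_plus'; apply is_lim_seq_mult'; auto.
Qed.

Lemma Clim_inv (u : nat -> C) (l : C) : l <> 0%C -> Clim u l -> Clim (fun n => / u n)%C (/ l).
Proof.
  intros Hl [H1 H2].
  assert (Hd : Re l ^ 2 + Im l ^ 2 <> 0).
  { intros E. apply Hl. apply Cmod_eq_0. rewrite <- (sqrt_pow2 (Cmod l)) by apply Cmod_ge_0.
    rewrite Cmod2_alt, E. apply sqrt_0. }
  assert (HD : is_lim_seq (fun n => Re (u n) ^ 2 + Im (u n) ^ 2) (Re l ^ 2 + Im l ^ 2)).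
  { apply is_lim_seq_plus'; simpl; repeat (apply is_lim_seq_mult'; auto); apply is_lim_seq_const. }
  split.
  - apply (is_lim_seq_div' _ _ _ _ H1 HD Hd).
  - apply (is_lim_seq_div' (fun n => - Im (u n)) _ (- Im l) _); auto.
    apply (is_lim_seq_opp (fun n => Im (u n)) (Im l)); auto.
Qed.

Lemma Clim_opp (u : nat -> C) (l : C) : Clim u l -> Clim (fun n => - u n)%C (- l).
Proof.
  intros [H1 H2]; split; simpl.
  - apply (is_lim_seq_opp (fun n => Re (u n)) (Re l)); auto.
  - apply (is_lim_seq_opp (fun n => Im (u n)) (Im l)); auto.
Qed.

Lemma Clim_scal (c : C) (u : nat -> C) (l : C) : Clim u l -> Clim (fun n => c * u n)%C (c * l).
Proof. intros H. apply Clim_mult; [apply Clim_const|exact H]. Qed.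

Lemma Clim_RtoC (u : nat -> R) (l : R) : is_lim_seq u l -> Clim (fun n => RtoC (u n)) (RtoC l).
Proof. intros H; split; simpl; [exact H|apply is_lim_seq_const]. Qed.

Lemma Clim_seq_correct (u : nat -> C) (l : C) : Clim u l -> Clim_seq u = l.
Proof.
  intros [H1 H2]. unfold Clim_seq. rewrite (is_lim_seq_unique _ _ H1), (is_lim_seq_unique _ _ H2).
  destruct l; reflexivity.
Qed.

Lemma Clim_Cmod_lim (u : nat -> C) (l : C) :
  Clim u l -> is_lim_seq (fun n => Cmod (u n)) (Cmod l).
Proof.
  intros H. apply Clim_Cmod in H.
  apply is_lim_seq_le_le with (u := fun n => Cmod l - Cmod (u n - l))
    (w := fun n => Cmod l + Cmod (u n - l)).
  - intros n; split.
    + generalize (Cmod_minus_le (u n) (u n - l)).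
      replace (u n - (u n - l))%C with l by ring. lra.
    + generalize (Cmod_triangle l (u n - l)).
      replace (l + (u n - l))%C with (u n) by ring. lra.
  - replace (Finite (Cmod l)) with (Finite (Cmod l - 0)) by (f_equal; ring).
    apply is_lim_seq_minus'; [apply is_lim_seq_const|exact H].
  - replace (Finite (Cmod l)) with (Finite (Cmod l + 0)) by (f_equal; ring).
    apply is_lim_seq_plus'; [apply is_lim_seq_const|exact H].
Qed.

Lemma Clim_Cmod_le (u : nat -> C) (l : C) (M : R) :
  Clim u l -> (forall n, Cmod (u n) <= M) -> Cmod l <= M.
Proof.
  intros H HM. apply Clim_Cmod_lim in H.
  apply (is_lim_seq_le (fun n => Cmod (u n)) (fun _ => M) (Cmod l) M); auto.
  apply is_lim_seq_const.
Qed.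

Lemma Clim_shift (u : nat -> C) (l : C) (N : nat) :
  Clim u l <-> Clim (fun n => u (n + N)%nat) l.
Proof.
  unfold Clim. rewrite (is_lim_seq_incr_n (fun n => Re (u n)) N).
  rewrite (is_lim_seq_incr_n (fun n => Im (u n)) N). reflexivity.
Qed.

(** * Finite sums *)

Fixpoint csum (a : nat -> C) (n : nat) : C :=
  match n with O => 0%C | S m => (csum a m + a m)%C end.

Lemma csum_ext (a b : nat -> C) (n : nat) :
  (forall i, (i < n)%nat -> a i = b i) -> csum a n = csum b n.
Proof.
  induction n; intros H; simpl; auto. rewrite IHn, H; auto.
Qed.

Lemma csum_plus (a b : nat -> C) (n : nat) :
  csum (fun i => a i + b i)%C n = (csum a n + csum b n)%C.
Proof. induction n; simpl; [|rewrite IHn]; ring. Qed.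

Lemma csum_scal (c : C) (a : nat -> C) (n : nat) :
  csum (fun i => c * a i)%C n = (c * csum a n)%C.
Proof. induction n; simpl; [|rewrite IHn]; ring. Qed.

Lemma csum_Sl (a : nat -> C) (n : nat) : csum a (S n) = (a O + csum (fun i => a (S i)) n)%C.
Proof. induction n; [simpl; ring|]. simpl in *. rewrite IHn. ring. Qed.

Lemma csum_zero (n : nat) : csum (fun _ => 0%C) n = 0%C.
Proof. induction n; simpl; [|rewrite IHn]; ring. Qed.

Lemma csum_swap (c : nat -> nat -> C) (n m : nat) :
  csum (fun i => csum (c i) m) n = csum (fun j => csum (fun i => c i j) n) m.
Proof.
  induction n; simpl; [now rewrite csum_zero|]. rewrite IHn, <- csum_plus. reflexivity.
Qed.

Lemma csum_triangle (c : nat -> nat -> C) (n : nat) :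
  csum (fun k => csum (fun i => c i (k - i)%nat) (S k)) n
  = csum (fun i => csum (c i) (n - i)) n.
Proof.
  induction n; [reflexivity|].
  change (csum (fun k => csum (fun i => c i (k - i)%nat) (S k)) n
    + csum (fun i => c i (n - i)%nat) (S n)
    = csum (fun i => csum (c i) (S n - i)) (S n))%C.
  rewrite IHn.
  transitivity (csum (fun i => csum (c i) (n - i) + c i (n - i)%nat)%C (S n)).
  - rewrite csum_plus.
    change (csum (fun i => csum (c i) (n - i)) (S n))
      with (csum (fun i => csum (c i) (n - i)) n + csum (c n) (n - n))%C.
    rewrite Nat.sub_diag. change (csum (c n) 0) with (RtoC 0). ring.
  - apply csum_ext. intros i Hi. replace (S n - i)%nat with (S (n - i)) by lia. reflexivity.
Qed.

Lemma csum_Cmod_le (a : nat -> C) (n : nat) (M : R) :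
  (forall i, (i < n)%nat -> Cmod (a i) <= M) -> Cmod (csum a n) <= INR n * M.
Proof.
  induction n; intros H.
  - simpl. rewrite Cmod_0. lra.
  - rewrite S_INR. simpl csum. eapply Rle_trans; [apply Cmod_triangle|].
    generalize (H n ltac:(lia)) (IHn ltac:(auto with arith)). lra.
Qed.

Lemma csum_Cmod_geom (a : nat -> C) (n : nat) (M r : R) :
  0 <= r < 1 -> 0 <= M -> (forall i, (i < n)%nat -> Cmod (a i) <= M * r ^ i) ->
  Cmod (csum a n) <= M * (1 - r ^ n) / (1 - r).
Proof.
  intros Hr HM. induction n; intros H.
  - simpl. rewrite Cmod_0. right; field; lra.
  - simpl csum. eapply Rle_trans; [apply Cmod_triangle|].
    generalize (H n ltac:(lia)) (IHn ltac:(auto with arith)). intros H1 H2.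
    apply Rle_trans with (M * (1 - r ^ n) / (1 - r) + M * r ^ n); [lra|].
    right. simpl. field. lra.
Qed.

(** * Series with geometric domination *)

Definition Csums (a : nat -> C) (l : C) : Prop := Clim (csum a) l.

Definition CSer (a : nat -> C) : C := Clim_seq (csum a).

(** The working criterion for convergence: explicit M and r give explicit tail bounds, which is what
    the rearrangements of double series need. *)
Definition geom (a : nat -> C) (M r : R) : Prop :=
  0 <= M /\ 0 <= r < 1 /\ forall n, Cmod (a n) <= M * r ^ n.

Lemma is_lim_seq_geom_scal (M r : R) : 0 <= r < 1 -> is_lim_seq (fun n => M * r ^ n) 0.
Proof.
  intros Hr. rewrite <- (Rmult_0_r M).
  apply is_lim_seq_mult'; [apply is_lim_seq_const|].
  apply is_lim_seq_geom. rewrite Rabs_pos_eq; lra.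
Qed.

Lemma csum_tail (a : nat -> C) (n m : nat) :
  csum a (n + m) = (csum a n + csum (fun i => a (n + i)%nat) m)%C.
Proof.
  induction m; [rewrite Nat.add_0_r; simpl; ring|].
  rewrite Nat.add_succ_r. simpl. rewrite IHm. ring.
Qed.

Lemma csum_tail_geom (a : nat -> C) (M r : R) (n m : nat) :
  geom a M r -> Cmod (csum a (n + m) - csum a n) <= M / (1 - r) * r ^ n.
Proof.
  intros (HM & Hr & H). rewrite csum_tail.
  replace (csum a n + csum (fun i => a (n + i)%nat) m - csum a n)%C
    with (csum (fun i => a (n + i)%nat) m) by ring.
  eapply Rle_trans.
  - apply csum_Cmod_geom with (M := M * r ^ n) (r := r); auto.
    + apply Rmult_le_pos; auto. apply pow_le; lra.
    + intros i _. eapply Rle_trans; [apply H|]. rewrite pow_add. lra.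
  - replace (M / (1 - r) * r ^ n) with (M * r ^ n * 1 / (1 - r)) by (field; lra).
    apply Rmult_le_compat_r; [left; apply Rinv_0_lt_compat; lra|].
    apply Rmult_le_compat_l; [apply Rmult_le_pos; auto; apply pow_le; lra|].
    generalize (pow_le r m ltac:(lra)); lra.
Qed.

(** Real and imaginary parts are 1-Lipschitz for the modulus, so they inherit the Cauchy property
    and real completeness applies to each. *)
Lemma Clim_complete (u : nat -> C) (e : nat -> R) :
  (forall n m, Cmod (u (n + m)%nat - u n) <= e n) -> is_lim_seq e 0 ->
  exists l, Clim u l.
Proof.
  intros H He.
  assert (Hc : forall f : C -> R, (forall a b : C, Rabs (f a - f b) <= Cmod (a - b)) ->
    exists l : R, is_lim_seq (fun n => f (u n)) l).
  { intros f Hf. apply ex_lim_seq_cauchy_corr. intros eps.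
    apply is_lim_seq_spec in He. destruct (He (pos_div_2 eps)) as [N HN].
    simpl in HN. exists N. intros n m Hn Hm.
    assert (K : forall k, (N <= k)%nat -> Rabs (f (u k) - f (u N)) < eps / 2).
    { intros k Hk. eapply Rle_lt_trans; [apply Hf|].
      replace k with (N + (k - N))%nat by lia. eapply Rle_lt_trans; [apply H|].
      generalize (HN N ltac:(lia)). rewrite Rminus_0_r.
      apply Rle_lt_trans, Rle_abs. }
    replace (f (u n) - f (u m)) with ((f (u n) - f (u N)) - (f (u m) - f (u N))) by ring.
    eapply Rle_lt_trans; [apply Rabs_triang|]. rewrite Rabs_Ropp.
    generalize (K n Hn) (K m Hm). lra. }
  destruct (Hc Re) as [x Hx].
  { intros a b. eapply Rle_trans; [|apply re_le_Cmod]. destruct a, b; right; reflexivity. }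
  destruct (Hc Im) as [y Hy].
  { intros a b. eapply Rle_trans; [|apply Cmod_im_le]. destruct a, b; right; reflexivity. }
  exists (x, y). split; assumption.
Qed.

Lemma CSer_unique (a : nat -> C) (l : C) : Csums a l -> CSer a = l.
Proof. apply Clim_seq_correct. Qed.

Lemma CSer_correct (a : nat -> C) (M r : R) : geom a M r -> Csums a (CSer a).
Proof.
  intros H. destruct (Clim_complete (csum a) (fun n => M / (1 - r) * r ^ n)) as [l Hl].
  - intros n m. now apply csum_tail_geom.
  - apply is_lim_seq_geom_scal. apply H.
  - unfold Csums. rewrite (CSer_unique _ _ Hl). exact Hl.
Qed.

Lemma CSer_tail (a : nat -> C) (M r : R) (n : nat) :
  geom a M r -> Cmod (CSer a - csum a n) <= M / (1 - r) * r ^ n.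
Proof.
  intros H.
  apply Clim_Cmod_le with (fun m => csum a (n + m) + - csum a n)%C.
  - apply Clim_plus; [|apply Clim_const].
    apply Clim_ext with (fun m => csum a (m + n)); [intros; f_equal; lia|].
    apply (proj1 (Clim_shift (csum a) (CSer a) n)). eapply CSer_correct; eauto.
  - intros m. now apply csum_tail_geom.
Qed.

Lemma CSer_bound (a : nat -> C) (M r : R) : geom a M r -> Cmod (CSer a) <= M / (1 - r).
Proof.
  intros H. generalize (CSer_tail a M r 0 H). simpl.
  replace (CSer a - 0)%C with (CSer a) by ring. lra.
Qed.

Lemma CSer_ext (a b : nat -> C) : (forall n, a n = b n) -> CSer a = CSer b.
Proof. intros H. f_equal. now apply functional_extensionality. Qed.

Lemma Csums_plus (a b : nat -> C) (l m : C) :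
  Csums a l -> Csums b m -> Csums (fun n => a n + b n)%C (l + m).
Proof.
  intros H1 H2. apply Clim_ext with (fun n => csum a n + csum b n)%C.
  - intros; now rewrite csum_plus.
  - now apply Clim_plus.
Qed.

Lemma Csums_scal (c : C) (a : nat -> C) (l : C) :
  Csums a l -> Csums (fun n => c * a n)%C (c * l).
Proof.
  intros H. apply Clim_ext with (fun n => c * csum a n)%C.
  - intros; now rewrite csum_scal.
  - now apply Clim_scal.
Qed.

Lemma Csums_ext (a b : nat -> C) (l : C) :
  (forall n, a n = b n) -> Csums a l -> Csums b l.
Proof. intros H. apply Clim_ext. intros; apply csum_ext; auto. Qed.

Lemma Csums_unique (a : nat -> C) (l m : C) : Csums a l -> Csums a m -> l = m.
Proof. apply Clim_unique. Qed.

Lemma CSer_plus (a b : nat -> C) (M r M' r' : R) :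
  geom a M r -> geom b M' r' -> CSer (fun n => a n + b n)%C = (CSer a + CSer b)%C.
Proof.
  intros. apply CSer_unique, Csums_plus; eapply CSer_correct; eauto.
Qed.

Lemma CSer_scal (c : C) (a : nat -> C) (M r : R) :
  geom a M r -> CSer (fun n => c * a n)%C = (c * CSer a)%C.
Proof. intros. apply CSer_unique, Csums_scal. eapply CSer_correct; eauto. Qed.

Lemma Csums_S (a : nat -> C) (l : C) :
  Csums (fun n => a (S n)) l -> Csums a (a O + l)%C.
Proof.
  intros H. apply (Clim_shift _ _ 1).
  apply Clim_ext with (fun n => a O + csum (fun i => a (S i)) n)%C.
  - intros n. rewrite Nat.add_1_r, csum_Sl. reflexivity.
  - apply Clim_plus; [apply Clim_const|exact H].
Qed.

Lemma CSer_S (a : nat -> C) (M r : R) :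
  geom a M r -> CSer a = (a O + CSer (fun n => a (S n)))%C.
Proof.
  intros (HM & Hr & H). apply CSer_unique, Csums_S, CSer_correct with (M * r) r.
  split; [|split]; auto; [apply Rmult_le_pos; lra|].
  intros n. generalize (H (S n)). simpl. lra.
Qed.

Lemma geom_plus (a b : nat -> C) (M M' r : R) :
  geom a M r -> geom b M' r -> geom (fun n => a n + b n)%C (M + M') r.
Proof.
  intros (HM & Hr & H) (HM' & _ & H'). split; [lra|]. split; auto.
  intros n. eapply Rle_trans; [apply Cmod_triangle|]. generalize (H n) (H' n). lra.
Qed.

Lemma geom_scal (c : C) (a : nat -> C) (M r : R) :
  geom a M r -> geom (fun n => c * a n)%C (Cmod c * M) r.
Proof.
  intros (HM & Hr & H). split; [apply Rmult_le_pos; auto; apply Cmod_ge_0|]. split; auto.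
  intros n. rewrite Cmod_mult, Rmult_assoc. apply Rmult_le_compat_l; [apply Cmod_ge_0|auto].
Qed.

Lemma geom_bounded_mult (b a : nat -> C) (B M r : R) :
  (forall n, Cmod (b n) <= B) -> geom a M r -> geom (fun n => b n * a n)%C (B * M) r.
Proof.
  intros Hb (HM & Hr & H).
  assert (0 <= B) by (eapply Rle_trans; [apply Cmod_ge_0|apply (Hb O)]).
  split; [apply Rmult_le_pos; auto|]. split; auto.
  intros n. rewrite Cmod_mult, Rmult_assoc.
  apply Rmult_le_compat; auto; apply Cmod_ge_0.
Qed.

(** * Double series *)

Definition geom2 (c : nat -> nat -> C) (M r : R) : Prop :=
  0 <= M /\ 0 <= r < 1 /\ forall i j, Cmod (c i j) <= M * r ^ i * r ^ j.

Lemma geom2_row (c : nat -> nat -> C) (M r : R) (i : nat) :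
  geom2 c M r -> geom (c i) (M * r ^ i) r.
Proof.
  intros (HM & Hr & H). split; [apply Rmult_le_pos; auto; apply pow_le; lra|]. split; auto.
Qed.

Lemma geom2_flip (c : nat -> nat -> C) (M r : R) :
  geom2 c M r -> geom2 (fun i j => c j i) M r.
Proof.
  intros (HM & Hr & H). split; auto. split; auto. intros i j.
  eapply Rle_trans; [apply H|]. right; ring.
Qed.

Lemma geom2_sum (c : nat -> nat -> C) (M r : R) :
  geom2 c M r -> geom (fun i => CSer (c i)) (M / (1 - r)) r.
Proof.
  intros H. destruct (H) as (HM & Hr & _). split; [|split]; auto.
  - apply Rmult_le_pos; auto. left; apply Rinv_0_lt_compat; lra.
  - intros i. eapply Rle_trans; [apply CSer_bound, (geom2_row c M r i H)|].
    right; field; lra.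
Qed.

Lemma csum_minus (a b : nat -> C) (n : nat) :
  (csum a n - csum b n = csum (fun i => a i - b i) n)%C.
Proof. induction n; simpl; [|rewrite <- IHn]; ring. Qed.

(** Cutting row i at n loses a tail of size M / (1 - r) r^i r^n, and these errors sum geometrically
    in i. *)
Lemma geom2_square (c : nat -> nat -> C) (M r : R) (n : nat) :
  geom2 c M r ->
  Cmod (csum (fun i => CSer (c i)) n - csum (fun i => csum (c i) n) n)
  <= M / (1 - r) / (1 - r) * r ^ n.
Proof.
  intros H. destruct (H) as (HM & Hr & _). rewrite csum_minus.
  assert (Hp : 0 < / (1 - r)) by (apply Rinv_0_lt_compat; lra).
  assert (Hn : 0 <= r ^ n) by (apply pow_le; lra).
  assert (Hd : 0 <= M / (1 - r) * r ^ n).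
  { apply Rmult_le_pos; auto. apply Rmult_le_pos; lra. }
  eapply Rle_trans.
  - apply csum_Cmod_geom with (M := M / (1 - r) * r ^ n) (r := r); auto.
    intros i _. eapply Rle_trans; [apply CSer_tail, (geom2_row c M r i H)|].
    right; field; lra.
  - replace (M / (1 - r) / (1 - r) * r ^ n) with (M / (1 - r) * r ^ n * 1 / (1 - r))
      by (field; lra).
    apply Rmult_le_compat_r; [lra|]. apply Rmult_le_compat_l; auto. lra.
Qed.

(** Both iterated sums have the same limit as the sums over n by n squares, for which the
    interchange is finite. *)
Lemma CSer_swap (c : nat -> nat -> C) (M r : R) :
  geom2 c M r -> CSer (fun i => CSer (c i)) = CSer (fun j => CSer (fun i => c i j)).
Proof.
  intros H. apply CSer_unique.
  set (q := fun n => csum (fun i => csum (c i) n) n).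
  assert (Hr : 0 <= r < 1) by apply H.
  assert (H1 : Clim (fun n => csum (fun j => CSer (fun i => c i j)) n - q n)%C 0).
  { apply Clim_squeeze with (fun n => M / (1 - r) / (1 - r) * r ^ n);
      [|apply is_lim_seq_geom_scal; auto].
    intros n. replace (csum (fun j => CSer (fun i => c i j)) n - q n - 0)%C with
      (csum (fun j => CSer (fun i => c i j)) n - csum (fun j => csum (fun i => c i j) n) n)%C
      by (unfold q; rewrite (csum_swap c n n); ring).
    apply (geom2_square (fun i j => c j i)). now apply geom2_flip. }
  assert (H2 : Clim (fun n => csum (fun i => CSer (c i)) n - q n)%C 0).
  { apply Clim_squeeze with (fun n => M / (1 - r) / (1 - r) * r ^ n);
      [|apply is_lim_seq_geom_scal; auto].
    intros n. unfold Cminus at 1. rewrite Copp_0, Cplus_0_r. now apply geom2_square. }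
  assert (H3 := CSer_correct _ _ _ (geom2_sum _ _ _ (geom2_flip _ _ _ H))).
  unfold Csums in *.
  replace (CSer (fun j => CSer (fun i => c i j))) with
    (CSer (fun j => CSer (fun i => c i j)) + (- 0 + 0))%C by ring.
  eapply Clim_ext; [|apply Clim_plus; [exact H3|apply Clim_plus; [apply Clim_opp, H1|exact H2]]].
  intros n. simpl. ring.
Qed.

Lemma is_lim_seq_n_geom (r : R) : 0 <= r < 1 -> is_lim_seq (fun n => INR n * r ^ n) 0.
Proof.
  intros Hr. destruct (Req_dec r 0) as [->|Hr0].
  { apply is_lim_seq_ext_loc with (fun _ => 0); [|apply is_lim_seq_const].
    exists 1%nat. intros n Hn. rewrite pow_i by lia. ring. }
  apply ex_series_lim_0.
  apply ex_series_ext with (fun n => Rabs (INR n * r ^ n)).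
  { intros n. apply Rabs_pos_eq. apply Rmult_le_pos; [apply pos_INR|apply pow_le; lra]. }
  (* The ratio test needs nonzero terms and the term of index 0 vanishes, hence the shift by one. *)
  apply ex_series_incr_1.
  apply ex_series_DAlembert with r; [lra| |].
  - intros n. apply Rmult_integral_contrapositive. split.
    + apply not_0_INR. lia.
    + now apply pow_nonzero.
  - apply is_lim_seq_ext with (fun n => r + r * / INR (S n)).
    + intros n. rewrite (S_INR (S n)). simpl (r ^ S (S n)).
      assert (0 < INR (S n)) by apply (lt_INR 0), Nat.lt_0_succ.
      assert (r ^ n <> 0) by now apply pow_nonzero.
      replace ((INR (S n) + 1) * (r * (r * r ^ n)) / (INR (S n) * r ^ S n))
        with (r + r * / INR (S n)) by (simpl (r ^ S n); field; repeat split; lra).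
      rewrite Rabs_pos_eq; auto.
      assert (0 < / INR (S n)) by (apply Rinv_0_lt_compat; auto). nra.
    + replace (Finite r) with (Finite (r + r * 0)) by (f_equal; ring).
      apply is_lim_seq_plus'; [apply is_lim_seq_const|].
      apply is_lim_seq_mult'; [apply is_lim_seq_const|].
      apply (is_lim_seq_incr_1 (fun n => / INR n)).
      replace (Finite 0) with (Rbar_inv p_infty) by reflexivity.
      apply is_lim_seq_inv; [apply is_lim_seq_INR|discriminate].
Qed.

(** The first n antidiagonals cover row i up to index n - i. The missing tail is at most M / (1 - r)
    r^i r^(n - i), so the n rows together lose at most a constant times n r^n. *)
Lemma CSer_diag (c : nat -> nat -> C) (M r : R) :
  geom2 c M r ->
  Csums (fun n => csum (fun i => c i (n - i)%nat) (S n)) (CSer (fun i => CSer (c i))).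
Proof.
  intros H. destruct (H) as (HM & Hr & _).
  assert (H3 := CSer_correct _ _ _ (geom2_sum _ _ _ H)).
  unfold Csums in *.
  assert (H1 : Clim (fun n => csum (fun i => CSer (c i)) n
      - csum (fun k => csum (fun i => c i (k - i)%nat) (S k)) n)%C 0).
  { apply Clim_squeeze with (fun n => M / (1 - r) * (INR n * r ^ n)).
    - intros n. unfold Cminus at 1. rewrite Copp_0, Cplus_0_r.
      rewrite csum_triangle, csum_minus.
      replace (M / (1 - r) * (INR n * r ^ n)) with (INR n * (M / (1 - r) * r ^ n)) by ring.
      apply csum_Cmod_le. intros i Hi.
      eapply Rle_trans; [apply CSer_tail, (geom2_row c M r i H)|].
      right. replace (r ^ n) with (r ^ i * r ^ (n - i)) by
        (rewrite <- pow_add; f_equal; lia). field. lra.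
    - rewrite <- (Rmult_0_r (M / (1 - r))).
      apply is_lim_seq_mult'; [apply is_lim_seq_const|now apply is_lim_seq_n_geom]. }
  replace (CSer (fun i => CSer (c i))) with (CSer (fun i => CSer (c i)) + - 0)%C by ring.
  eapply Clim_ext; [|apply Clim_plus; [exact H3|apply Clim_opp, H1]].
  intros n. simpl. ring.
Qed.

Lemma geom2_mult (a b : nat -> C) (M M' r : R) :
  geom a M r -> geom b M' r -> geom2 (fun i j => a i * b j)%C (M * M') r.
Proof.
  intros (HM & Hr & H) (HM' & _ & H'). split; [now apply Rmult_le_pos|]. split; auto.
  intros i j. rewrite Cmod_mult.
  replace (M * M' * r ^ i * r ^ j) with ((M * r ^ i) * (M' * r ^ j)) by ring.
  apply Rmult_le_compat; auto; apply Cmod_ge_0.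
Qed.

Lemma CSer_mult (a b : nat -> C) (M M' r : R) :
  geom a M r -> geom b M' r ->
  Csums (fun n => csum (fun i => a i * b (n - i)%nat)%C (S n)) (CSer a * CSer b).
Proof.
  intros Ha Hb.
  replace (CSer a * CSer b)%C with (CSer (fun i => CSer (fun j => a i * b j)%C)).
  - apply (CSer_diag (fun i j => a i * b j)%C (M * M') r). now apply geom2_mult.
  - rewrite Cmult_comm, <- (CSer_scal _ _ _ _ Ha). apply CSer_ext. intros i.
    rewrite (CSer_scal _ _ _ _ Hb). ring.
Qed.

Lemma RtoC_INR_S (n : nat) : RtoC (INR (S n)) = (RtoC (INR n) + 1)%C.
Proof. rewrite S_INR, RtoC_plus. reflexivity. Qed.

Lemma RtoC_INR_S_neq_0 (n : nat) : RtoC (INR (S n)) <> 0%C.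
Proof. intros H. apply RtoC_inj in H. generalize (pos_INR n). rewrite S_INR in H. lra. Qed.

Lemma RtoC_INR_fact_neq_0 (n : nat) : RtoC (INR (fact n)) <> 0%C.
Proof. intros H. apply RtoC_inj in H. now apply (INR_fact_neq_0 n). Qed.

Lemma RtoC_fact_S (n : nat) :
  RtoC (INR (fact (S n))) = (RtoC (INR (fact n)) * (RtoC (INR n) + 1))%C.
Proof. rewrite fact_simpl, mult_INR, RtoC_mult, RtoC_INR_S. ring. Qed.

(** * Pochhammer symbols *)

Lemma poch_Sl (a : C) (n : nat) : poch a (S n) = (a * poch (a + 1) n)%C.
Proof.
  induction n; [simpl; rewrite Cplus_0_r; ring|].
  change (poch a (S (S n))) with (poch a (S n) * (a + INR (S n)))%C.
  rewrite IHn, RtoC_INR_S. simpl. ring.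
Qed.

Lemma poch_add (a : C) (n m : nat) :
  poch a (n + m) = (poch a n * poch (a + INR n) m)%C.
Proof.
  induction m; [rewrite Nat.add_0_r; simpl; ring|].
  rewrite Nat.add_succ_r. simpl. rewrite IHm, plus_INR, RtoC_plus. ring.
Qed.

(** Read in reverse order, the factors x + j are the negatives of the factors of the symbol with
    base 1 - x - k. *)
Lemma poch_reflect (x : C) (k : nat) :
  poch x k = ((- (1)) ^ k * poch (1 - x - INR k) k)%C.
Proof.
  induction k; [simpl; ring|].
  rewrite (poch_Sl (1 - x - INR (S k))). rewrite RtoC_INR_S.
  replace (1 - x - (INR k + 1) + 1)%C with (1 - x - INR k)%C by ring.
  simpl poch at 1. rewrite IHk, Cpow_S. ring.
Qed.

Lemma poch_neq_0 (a : C) (n : nat) :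
  (forall k, (a + INR k)%C <> 0%C) -> poch a n <> 0%C.
Proof.
  intros H. induction n; simpl; [apply C1_nz|]. now apply Cmult_neq_0.
Qed.

Lemma poch_1 (n : nat) : poch 1 n = INR (fact n).
Proof.
  induction n; [reflexivity|]. rewrite RtoC_fact_S. simpl. rewrite IHn. ring.
Qed.

Lemma RtoC_pos_plus_INR_neq_0 (c : R) (k : nat) : 0 < c -> (RtoC c + INR k)%C <> 0%C.
Proof.
  intros Hc H. rewrite <- RtoC_plus in H. apply RtoC_inj in H. generalize (pos_INR k); lra.
Qed.

Lemma poch_pos_neq_0 (c : R) (n : nat) : 0 < c -> poch c n <> 0%C.
Proof. intros Hc. apply poch_neq_0. intros k. now apply RtoC_pos_plus_INR_neq_0. Qed.

(** The coefficient of [x ^ n] in [(1 - x) ^ (- a)]. *)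
Definition rf (a : C) (n : nat) : C := (poch a n / INR (fact n))%C.

Lemma rf_0 (a : C) : rf a 0 = 1%C.
Proof. unfold rf. simpl. field. Qed.

Lemma rf_S (a : C) (n : nat) : ((INR n + 1) * rf a (S n))%C = ((a + INR n) * rf a n)%C.
Proof.
  unfold rf. rewrite RtoC_fact_S. simpl poch.
  generalize (RtoC_INR_fact_neq_0 n) (RtoC_INR_S_neq_0 n). rewrite RtoC_INR_S.
  intros. field. auto.
Qed.

Lemma rf_pascal (a : C) (n : nat) : rf (a + 1) (S n) = (rf a (S n) + rf (a + 1) n)%C.
Proof.
  unfold rf. rewrite (poch_Sl a). simpl poch. rewrite RtoC_fact_S.
  generalize (RtoC_INR_fact_neq_0 n) (RtoC_INR_S_neq_0 n). rewrite RtoC_INR_S.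
  intros. field. auto.
Qed.

Definition conv (s t : nat -> C) (n : nat) : C := csum (fun i => s i * t (n - i)%nat)%C (S n).

(** If [s] and [t] are coefficients of solutions of [(1 - kappa x) y' = alpha y], resp.
    [beta y], then the Cauchy product solves the equation with [alpha + beta]. *)
Lemma conv_rec (s t : nat -> C) (al be ka : C) (n : nat) :
  (forall k, (INR k + 1) * s (S k) = (al + ka * INR k) * s k)%C ->
  (forall k, (INR k + 1) * t (S k) = (be + ka * INR k) * t k)%C ->
  ((INR n + 1) * conv s t (S n) = (al + be + ka * INR n) * conv s t n)%C.
Proof.
  intros Hs Ht. unfold conv.
  rewrite <- !csum_scal.
  transitivity (csum (fun i => INR i * s i * t (S n - i)%nat) (S (S n))
    + csum (fun i => s i * (INR (S n - i) * t (S n - i)%nat)) (S (S n)))%C.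
  { rewrite <- csum_plus. apply csum_ext. intros i Hi.
    rewrite minus_INR, RtoC_minus, RtoC_INR_S by lia. ring. }
  rewrite csum_Sl.
  change (csum (fun i => s i * (INR (S n - i) * t (S n - i)%nat))%C (S (S n)))
    with (csum (fun i => s i * (INR (S n - i) * t (S n - i)%nat)) (S n)
      + s (S n) * (INR (S n - S n) * t (S n - S n)%nat))%C.
  rewrite Nat.sub_diag. change (INR 0) with 0.
  replace (csum (fun i => (al + be + ka * INR n) * (s i * t (n - i)%nat)) (S n))%C with
    (csum (fun i => (al + ka * INR i) * s i * t (n - i)%nat) (S n)
     + csum (fun i => s i * ((be + ka * INR (n - i)) * t (n - i)%nat)) (S n))%C.
  2:{ rewrite <- csum_plus. apply csum_ext. intros i Hi.
      rewrite minus_INR, RtoC_minus by lia. ring. }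
  rewrite (csum_ext (fun i => INR (S i) * s (S i) * t (S n - S i)%nat)%C
    (fun i => (al + ka * INR i) * s i * t (n - i)%nat)%C).
  2:{ intros i Hi. rewrite RtoC_INR_S, Hs. reflexivity. }
  rewrite (csum_ext (fun i => s i * (INR (S n - i) * t (S n - i)%nat))%C
    (fun i => s i * ((be + ka * INR (n - i)) * t (n - i)%nat))%C).
  2:{ intros i Hi. replace (S n - i)%nat with (S (n - i)) by lia.
      rewrite RtoC_INR_S, Ht. reflexivity. }
  ring.
Qed.

Lemma INR_S_cancel (n : nat) (x y : C) : ((INR n + 1) * x = (INR n + 1) * y)%C -> x = y.
Proof.
  intros H. generalize (RtoC_INR_S_neq_0 n). rewrite RtoC_INR_S. intros Hn.
  replace x with (/ (INR n + 1) * ((INR n + 1) * x))%C by (field; auto).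
  rewrite H. field; auto.
Qed.

(** Chu-Vandermonde, by uniqueness for a first-order recurrence: [rf a] satisfies the one of
    [conv_rec] with kappa = 1, and Cauchy products add the parameters. *)
Lemma rf_vandermonde (a b : C) (n : nat) : conv (rf a) (rf b) n = rf (a + b) n.
Proof.
  induction n.
  - unfold conv. simpl. rewrite !rf_0. ring.
  - apply (INR_S_cancel n). rewrite rf_S, <- IHn.
    rewrite (conv_rec _ _ a b 1); [ring| |]; intros k; rewrite rf_S; ring.
Qed.

Lemma exp_coef_S (x : C) (k : nat) :
  ((INR k + 1) * (x ^ S k / INR (fact (S k))) = (x + 0 * INR k) * (x ^ k / INR (fact k)))%C.
Proof.
  rewrite RtoC_fact_S, Cpow_S.
  generalize (RtoC_INR_fact_neq_0 k) (RtoC_INR_S_neq_0 k). rewrite RtoC_INR_S.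
  intros. field. auto.
Qed.

(** The case kappa = 0 of [conv_rec], that is exp x exp y = exp (x + y) on coefficients; it serves
    to derive the binomial theorem. *)
Lemma exp_coef_conv (x y : C) (n : nat) :
  conv (fun k => x ^ k / INR (fact k))%C (fun k => y ^ k / INR (fact k))%C n
  = ((x + y) ^ n / INR (fact n))%C.
Proof.
  induction n.
  - unfold conv. simpl. field.
  - apply (INR_S_cancel n). rewrite exp_coef_S, <- IHn.
    rewrite (conv_rec _ _ x y 0); [ring| |]; intros k; apply exp_coef_S.
Qed.

Lemma rf_binomial (k i : nat) :
  rf (INR (S i)) k = (INR (fact (k + i)) / (INR (fact k) * INR (fact i)))%C.
Proof.
  unfold rf. rewrite <- !poch_1, (Nat.add_comm k i), poch_add, (poch_1 k), (poch_1 i).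
  rewrite RtoC_INR_S, (Cplus_comm (INR i)).
  field; split; apply RtoC_INR_fact_neq_0.
Qed.

(** The binomial coefficient is written as a value of [rf] so that the bound [Cmod_rf_INR_le]
    applies to it in [series_recenter]. *)
Lemma Cpow_plus_binomial (x y : C) (n : nat) :
  ((x + y) ^ n)%C = csum (fun k => rf (INR (S (n - k))) k * x ^ k * y ^ (n - k))%C (S n).
Proof.
  replace ((x + y) ^ n)%C with (INR (fact n) * ((x + y) ^ n / INR (fact n)))%C
    by (field; apply RtoC_INR_fact_neq_0).
  rewrite <- exp_coef_conv. unfold conv. rewrite <- csum_scal.
  apply csum_ext. intros k Hk. rewrite rf_binomial.
  replace (k + (n - k))%nat with n by lia.
  field; split; apply RtoC_INR_fact_neq_0.
Qed.

Lemma rf_reflect (x : C) (k : nat) : rf x k = ((- (1)) ^ k * rf (1 - x - INR k) k)%C.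
Proof. unfold rf. rewrite (poch_reflect x). unfold Cdiv. ring. Qed.

(** Reflecting [rf (c + INR n) (N - n)] replaces its base by 1 - c - N, which no longer depends on
    n. The sum becomes a Vandermonde convolution with base 1 - b - N, and this is the reflection of
    b. *)
Lemma rf_pfaff (b c : C) (N : nat) :
  csum (fun n => (- (1)) ^ n * rf (c - b) n * rf (c + INR n) (N - n))%C (S N) = rf b N.
Proof.
  transitivity ((- (1)) ^ N * conv (rf (c - b)) (rf (1 - c - INR N)) N)%C.
  - unfold conv. rewrite <- csum_scal. apply csum_ext. intros n Hn.
    rewrite (rf_reflect (c + INR n)).
    replace (1 - (c + INR n) - INR (N - n))%C with (1 - c - INR N)%C
      by (rewrite minus_INR, RtoC_minus by lia; ring).
    replace ((- (1)) ^ N)%C with ((- (1)) ^ n * (- (1)) ^ (N - n))%C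
      by (rewrite <- Cpow_add_r; f_equal; lia). ring.
  - rewrite rf_vandermonde, (rf_reflect b). f_equal. f_equal. ring.
Qed.

(** * Growth of coefficients *)

(** Finitely many exceptional ratios only change the constant: the induction on N drops the first
    term of the sequence. *)
Lemma ratio_growth (u : nat -> C) (q : R) (N : nat) :
  0 < q -> (forall n, (N <= n)%nat -> Cmod (u (S n)) <= q * Cmod (u n)) ->
  exists M, 0 <= M /\ forall n, Cmod (u n) <= M * q ^ n.
Proof.
  intros Hq. revert u. induction N; intros u H.
  - exists (Cmod (u O)). split; [apply Cmod_ge_0|].
    induction n; [simpl; lra|]. eapply Rle_trans; [apply H; lia|].
    simpl. generalize (Rmult_le_compat_l q _ _ (Rlt_le _ _ Hq) IHn). lra.
  - destruct (IHN (fun n => u (S n))) as (M & HM & HMn).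
    { intros n Hn. apply H. lia. }
    exists (Cmod (u O) + M / q).
    assert (Hm : 0 <= M / q) by (apply Rmult_le_pos; auto; left; now apply Rinv_0_lt_compat).
    generalize (Cmod_ge_0 (u O)); intros H0.
    split; [lra|].
    intros [|n]; [simpl; lra|].
    eapply Rle_trans; [apply HMn|]. simpl.
    assert (0 <= q ^ n) by (apply pow_le; lra).
    replace (M * q ^ n) with (M / q * (q * q ^ n)) by (field; lra).
    apply Rmult_le_compat_r; [apply Rmult_le_pos; lra|lra].
Qed.

(** Equivalent to a radius of convergence at least 1; the form with constants feeds directly into
    [geom]. *)
Definition subexp (u : nat -> C) : Prop :=
  forall q, 1 < q -> exists M, 0 <= M /\ forall n, Cmod (u n) <= M * q ^ n.

(** Each factor is estimated with sqrt q, which is still larger than 1. *)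
Lemma subexp_mult (u v : nat -> C) :
  subexp u -> subexp v -> subexp (fun n => u n * v n)%C.
Proof.
  intros Hu Hv q Hq.
  assert (Hs : 1 < sqrt q) by (rewrite <- sqrt_1; apply sqrt_lt_1; lra).
  destruct (Hu _ Hs) as (M & HM & H), (Hv _ Hs) as (M' & HM' & H').
  exists (M * M'). split; [now apply Rmult_le_pos|].
  intros n. rewrite Cmod_mult.
  replace (q ^ n) with (sqrt q ^ n * sqrt q ^ n)
    by (rewrite <- Rpow_mult_distr, sqrt_def; [reflexivity|lra]).
  replace (M * M' * (sqrt q ^ n * sqrt q ^ n)) with ((M * sqrt q ^ n) * (M' * sqrt q ^ n)) by ring.
  apply Rmult_le_compat; auto; apply Cmod_ge_0.
Qed.

Lemma subexp_ext (u v : nat -> C) : (forall n, u n = v n) -> subexp u -> subexp v.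
Proof.
  intros E H q Hq. destruct (H q Hq) as (M & HM & HMn). exists M. split; auto.
  intros n. rewrite <- E. auto.
Qed.

Lemma subexp_geom (u : nat -> C) (x : C) :
  subexp u -> Cmod x < 1 ->
  exists M, geom (fun n => u n * x ^ n)%C M (2 * Cmod x / (1 + Cmod x)).
Proof.
  intros Hu Hx. assert (H0 := Cmod_ge_0 x).
  (* The rate q = 2 / (1 + |x|) exceeds 1 while q |x| stays below 1. *)
  destruct (Hu (2 / (1 + Cmod x))) as (M & HM & H).
  { apply Rmult_lt_reg_r with (1 + Cmod x); [lra|].
    unfold Rdiv. rewrite Rmult_assoc, Rinv_l by lra. lra. }
  exists M. split; auto. split.
  - split.
    + apply Rmult_le_pos; [lra|]. left; apply Rinv_0_lt_compat; lra.
    + apply Rmult_lt_reg_r with (1 + Cmod x); [lra|].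
      unfold Rdiv. rewrite Rmult_assoc, Rinv_l by lra. lra.
  - intros n. rewrite Cmod_mult, Cmod_pow.
    replace (2 * Cmod x / (1 + Cmod x)) with (2 / (1 + Cmod x) * Cmod x) by (field; lra).
    rewrite Rpow_mult_distr, <- Rmult_assoc.
    apply Rmult_le_compat_r; auto. now apply pow_le.
Qed.

Lemma nat_above (x : R) : exists m : nat, x <= INR m.
Proof. destruct (INR_unbounded x) as [m Hm]. exists m. lra. Qed.

(** The ratio of consecutive terms is (x + n) / (y + n), of modulus at most q as soon as n (q - 1)
    >= |x|. *)
Lemma poch_ratio_subexp (x : C) (y : R) : 0 < y -> subexp (fun n => poch x n / poch y n)%C.
Proof.
  intros Hy q Hq.
  destruct (nat_above (Cmod x / (q - 1))) as [N HN'].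
  assert (HN : Cmod x <= INR N * (q - 1)).
  { apply Rmult_le_reg_r with (/ (q - 1)); [apply Rinv_0_lt_compat; lra|].
    rewrite Rmult_assoc, Rinv_r by lra. unfold Rdiv in HN'. lra. }
  apply ratio_growth with N; [lra|].
  intros n Hn. simpl poch.
  replace (poch x n * (x + INR n) / (poch y n * (y + INR n)))%C with
    ((x + INR n) / (y + INR n) * (poch x n / poch y n))%C
    by (field; split; [apply RtoC_pos_plus_INR_neq_0; auto|now apply poch_pos_neq_0]).
  rewrite Cmod_mult. apply Rmult_le_compat_r; [apply Cmod_ge_0|].
  assert (Hp : 0 < y + INR n) by (generalize (pos_INR n); lra).
  rewrite Cmod_div by now apply RtoC_pos_plus_INR_neq_0.
  rewrite <- RtoC_plus, (Cmod_RtoC_pos (y + INR n)) by lra.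
  apply Rmult_le_reg_r with (y + INR n); auto.
  unfold Rdiv. rewrite Rmult_assoc, Rinv_l, Rmult_1_r by lra.
  eapply Rle_trans; [apply Cmod_triangle|]. rewrite Cmod_RtoC_pos by apply pos_INR.
  apply le_INR in Hn. nra.
Qed.

Lemma rf_subexp (a : C) : subexp (rf a).
Proof.
  apply subexp_ext with (fun n => poch a n / poch 1 n)%C.
  - intros n. now rewrite poch_1.
  - apply (poch_ratio_subexp a 1). lra.
Qed.

Lemma gauss_coef_subexp (a b : C) (c : R) : 0 < c -> subexp (gauss_coef a b c).
Proof.
  intros Hc. apply subexp_ext with (fun n => rf a n * (poch b n / poch c n))%C.
  - intros n. unfold rf, gauss_coef. field.
    split; [apply RtoC_INR_fact_neq_0|now apply poch_pos_neq_0].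
  - apply subexp_mult; [apply rf_subexp|now apply poch_ratio_subexp].
Qed.

(** For m >= 1, [rf (INR m) k] is the binomial coefficient of m + k - 1 over k, so its product with
    la^k is one term of (1 + la)^(m + k - 1); Pascal's rule proves the bound by a double induction.
    A small la buys slow growth in m at the price of a factor la^(-k). *)
Lemma rf_INR_pow_le (la : R) (m k : nat) :
  0 <= la -> 0 <= Re (rf (INR m) k) /\ Im (rf (INR m) k) = 0
    /\ Re (rf (INR m) k) * la ^ k <= (1 + la) ^ (m + k).
Proof.
  intros Hla. revert m. induction k as [|k IHk].
  - intros m. rewrite rf_0. simpl. split; [lra|]. split; auto.
    rewrite Nat.add_0_r, Rmult_1_r. apply pow_R1_Rle. lra.
  - induction m as [|m IHm].
    + unfold rf. rewrite poch_Sl. change (INR 0) with 0.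
      replace (0 * poch (0 + 1) k / INR (fact (S k)))%C with (RtoC 0)
        by (unfold Cdiv; ring).
      simpl. split; [lra|]. split; auto. rewrite Rmult_0_l.
      apply Rmult_le_pos; [lra|]. apply pow_le; lra.
    + rewrite RtoC_INR_S, rf_pascal, <- RtoC_INR_S.
      destruct IHm as (H1 & H2 & H3), (IHk (S m)) as (H4 & H5 & H6).
      change (Re (rf (INR m) (S k) + rf (INR (S m)) k)%C)
        with (Re (rf (INR m) (S k)) + Re (rf (INR (S m)) k)).
      change (Im (rf (INR m) (S k) + rf (INR (S m)) k)%C)
        with (Im (rf (INR m) (S k)) + Im (rf (INR (S m)) k)).
      split; [lra|]. split; [lra|].
      replace (S m + S k)%nat with (S (m + S k)) by lia.
      replace (S m + k)%nat with (m + S k)%nat in H6 by lia.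
      simpl pow at 1. simpl pow at 1 in H3. simpl pow at 2.
      generalize (Rmult_le_compat_l la _ _ Hla H6). lra.
Qed.

Lemma Cmod_rf_INR_le (la : R) (m k : nat) :
  0 < la -> Cmod (rf (INR m) k) <= (1 + la) ^ (m + k) / la ^ k.
Proof.
  intros Hla. destruct (rf_INR_pow_le la m k) as (H1 & H2 & H3); [lra|].
  assert (0 < la ^ k) by now apply pow_lt.
  apply Rmult_le_reg_r with (la ^ k); auto.
  unfold Rdiv. rewrite Rmult_assoc, Rinv_l, Rmult_1_r by lra.
  eapply Rle_trans; [|exact H3]. apply Rmult_le_compat_r; [lra|].
  eapply Rle_trans; [apply Cmod_le_Re_Im|]. rewrite H2, Rabs_R0, Rabs_pos_eq; lra.
Qed.

Lemma Cmod_poch_le (x : C) (m : R) (k : nat) :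
  Cmod x <= m -> Cmod (poch x k) <= Cmod (poch m k).
Proof.
  intros H. induction k; simpl; [lra|]. rewrite !Cmod_mult.
  assert (H0 := Cmod_ge_0 x). assert (Hk := pos_INR k).
  apply Rmult_le_compat; auto; try apply Cmod_ge_0.
  rewrite <- RtoC_plus, (Cmod_RtoC_pos (m + INR k)) by lra.
  eapply Rle_trans; [apply Cmod_triangle|]. rewrite Cmod_RtoC_pos by auto. lra.
Qed.

Lemma Cmod_rf_le (x : C) (m k : nat) :
  Cmod x <= INR m -> Cmod (rf x k) <= 2 ^ (m + k).
Proof.
  intros H. apply Rle_trans with (Cmod (rf (INR m) k)).
  - unfold rf. rewrite !Cmod_div by apply RtoC_INR_fact_neq_0.
    apply Rmult_le_compat_r.
    + left. apply Rinv_0_lt_compat, Cmod_gt_0, RtoC_INR_fact_neq_0.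
    + now apply Cmod_poch_le.
  - eapply Rle_trans; [apply (Cmod_rf_INR_le 1); lra|].
    rewrite pow1. right. replace (1 + 1) with 2 by ring. field.
Qed.

(** * The binomial series *)

(** [(1 - v) ^ (- a)] for [|v| < 1]. *)
Definition bs (a v : C) : C := CSer (fun n => rf a n * v ^ n)%C.

Lemma conv_pow (s t : nat -> C) (v : C) (n : nat) :
  conv (fun i => s i * v ^ i)%C (fun i => t i * v ^ i)%C n = (conv s t n * v ^ n)%C.
Proof.
  unfold conv. rewrite Cmult_comm, <- csum_scal. apply csum_ext. intros i Hi.
  replace (v ^ n)%C with (v ^ i * v ^ (n - i))%C
    by (rewrite <- Cpow_add_r; f_equal; lia). ring.
Qed.

Lemma CSer_pow_mult (s t : nat -> C) (v : C) (M M' r : R) :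
  geom (fun n => s n * v ^ n)%C M r -> geom (fun n => t n * v ^ n)%C M' r ->
  Csums (fun n => conv s t n * v ^ n)%C
    (CSer (fun n => s n * v ^ n) * CSer (fun n => t n * v ^ n))%C.
Proof.
  intros Hs Ht. eapply Csums_ext; [|apply (CSer_mult _ _ _ _ _ Hs Ht)].
  intros n. symmetry. rewrite <- conv_pow. reflexivity.
Qed.

Lemma bs_correct (a v : C) : Cmod v < 1 -> Csums (fun n => rf a n * v ^ n)%C (bs a v).
Proof.
  intros Hv. destruct (subexp_geom _ v (rf_subexp a) Hv) as [M H].
  eapply CSer_correct; eauto.
Qed.

Lemma bs_mult (a b v : C) : Cmod v < 1 -> (bs a v * bs b v)%C = bs (a + b) v.
Proof.
  intros Hv.
  destruct (subexp_geom _ v (rf_subexp a) Hv) as [M H].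
  destruct (subexp_geom _ v (rf_subexp b) Hv) as [M' H'].
  apply Csums_unique with (fun n => rf (a + b) n * v ^ n)%C; [|now apply bs_correct].
  eapply Csums_ext; [|eapply CSer_pow_mult; eauto].
  intros n. simpl. now rewrite rf_vandermonde.
Qed.

Lemma bs_0 (v : C) : bs 0 v = 1%C.
Proof.
  apply CSer_unique. replace (RtoC 1) with (rf 0 0 * v ^ 0 + 0)%C
    by (rewrite rf_0; simpl; now rewrite Cmult_1_l, Cplus_0_r).
  apply (Csums_S (fun n => rf 0 n * v ^ n)%C).
  apply Clim_ext with (fun _ => 0%C); [|apply Clim_const].
  intros n. symmetry. erewrite csum_ext; [apply csum_zero|].
  intros i Hi. simpl. unfold rf. rewrite poch_Sl. unfold Cdiv. ring.
Qed.

Lemma Copp_1 : (- (1))%C = RtoC (-1).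
Proof. now rewrite <- RtoC_opp. Qed.

Lemma bs_m1 (v : C) : bs (- (1)) v = (1 - v)%C.
Proof.
  rewrite Copp_1. apply CSer_unique.
  replace (1 - v)%C with (rf (-1) 0 * v ^ 0 + (rf (-1) 1 * v ^ 1 + 0))%C
    by (unfold rf; simpl; field).
  apply (Csums_S (fun n => rf (-1) n * v ^ n)%C).
  apply (Csums_S (fun n => rf (-1) (S n) * v ^ (S n))%C).
  apply Clim_ext with (fun _ => 0%C); [|apply Clim_const].
  intros n. symmetry. erewrite csum_ext; [apply csum_zero|].
  intros i Hi. simpl. unfold rf. rewrite !poch_Sl.
  replace (-1 + 1)%C with (RtoC 0) by (rewrite <- RtoC_plus; f_equal; ring).
  unfold Cdiv. ring.
Qed.

Lemma bs_inv (a v : C) : Cmod v < 1 -> (bs a v * bs (- a) v)%C = 1%C.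
Proof.
  intros Hv. rewrite bs_mult by auto. rewrite Cplus_opp_r. apply bs_0.
Qed.

Lemma one_minus_neq_0 (v : C) : Cmod v < 1 -> (1 - v)%C <> 0%C.
Proof.
  intros Hv E. replace v with (RtoC 1) in Hv; [rewrite Cmod_1 in Hv; lra|].
  symmetry. replace v with (1 - (1 - v))%C by ring. rewrite E. ring.
Qed.

Lemma bs_1 (v : C) : Cmod v < 1 -> bs 1 v = (/ (1 - v))%C.
Proof.
  intros Hv. assert (H := one_minus_neq_0 v Hv).
  generalize (bs_inv 1 v Hv). rewrite bs_m1. intros E.
  replace (bs 1 v) with (bs 1 v * (1 - v) * / (1 - v))%C by (field; auto).
  rewrite E. ring.
Qed.

Lemma bs_INR (j : nat) (v : C) : Cmod v < 1 -> bs (INR j) v = ((/ (1 - v)) ^ j)%C.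
Proof.
  intros Hv. induction j; [apply bs_0|].
  rewrite RtoC_INR_S, <- bs_mult by auto. rewrite IHj, bs_1, Cpow_S by auto. apply Cmult_comm.
Qed.

Lemma S_le_pow2 (n : nat) : INR (S n) <= 2 ^ n.
Proof.
  induction n; [simpl; lra|]. rewrite S_INR. change (2 ^ S n) with (2 * 2 ^ n).
  assert (1 <= 2 ^ n) by (apply pow_R1_Rle; lra). lra.
Qed.

(** * Substituting [- v / (1 - v)] in a power series *)

(** The coefficient of v^N in (1 - v)^(-x) sum_j be_j (- v / (1 - v))^j, obtained by expanding every
    power (1 - v)^(-x - j). *)
Definition moebius_coef (be : nat -> C) (x : C) (N : nat) : C :=
  csum (fun j => (- (1)) ^ j * be j * rf (x + INR j) (N - j))%C (S N).

Lemma moebius_coef_bound (be : nat -> C) (x : C) (M K : R) :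
  0 <= M -> 1 <= K -> (forall j, Cmod (be j) <= M * K ^ j) ->
  exists M', 0 <= M' /\ forall N, Cmod (moebius_coef be x N) <= M' * (4 * K) ^ N.
Proof.
  intros HM HK H. destruct (nat_above (Cmod x)) as [m Hm].
  (* With |x| <= m each [rf (x + INR j) (N - j)] is at most 2^(m + N), and the number N + 1 of terms
     is at most 2^N; hence the rate 4 K. *)
  exists (M * 2 ^ m). split; [apply Rmult_le_pos; auto; apply pow_le; lra|].
  intros N. unfold moebius_coef.
  apply Rle_trans with (INR (S N) * (M * K ^ N * 2 ^ (m + N))).
  - apply csum_Cmod_le. intros j Hj.
    rewrite !Cmod_mult, Cmod_pow, Cmod_m1, pow1, Rmult_1_l.
    apply Rmult_le_compat; try apply Cmod_ge_0.
    + eapply Rle_trans; [apply H|]. apply Rmult_le_compat_l; auto.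
      apply Rle_pow; [lra|lia].
    + eapply Rle_trans; [apply (Cmod_rf_le _ (m + j))|].
      * eapply Rle_trans; [apply Cmod_triangle|].
        rewrite Cmod_RtoC_pos, plus_INR by apply pos_INR. lra.
      * replace (m + j + (N - j))%nat with (m + N)%nat by lia. lra.
  - replace (4 * K) with (2 * (2 * K)) by ring.
    rewrite pow_add, !Rpow_mult_distr.
    replace (M * 2 ^ m * (2 ^ N * (2 ^ N * K ^ N))) with
      (2 ^ N * (M * K ^ N * (2 ^ m * 2 ^ N))) by ring.
    apply Rmult_le_compat_r; [|apply S_le_pow2].
    repeat apply Rmult_le_pos; auto; apply pow_le; lra.
Qed.

(** Expanding each (1 - v)^(-x - j) gives a double series in v^j v^k, which is summed by
    antidiagonals. The condition 8 K |v| <= 1 keeps the ratios 2 K |v|, 2 |v| and 4 K |v| of the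
    dominating geometric series at most 1/2. *)
Lemma moebius_resum (be : nat -> C) (x : C) (M K : R) (v : C) :
  0 <= M -> 1 <= K -> (forall j, Cmod (be j) <= M * K ^ j) -> Cmod v * (8 * K) <= 1 ->
  (bs x v * CSer (fun j => be j * (- v / (1 - v)) ^ j))%C
  = CSer (fun N => moebius_coef be x N * v ^ N)%C.
Proof.
  intros HM HK H Hv. assert (Hv0 := Cmod_ge_0 v).
  assert (Hv8 : Cmod v <= / 8) by nra.
  assert (Hv1 : Cmod v < 1) by lra.
  assert (H1 := one_minus_neq_0 v Hv1).
  destruct (nat_above (Cmod x)) as [m Hm].
  set (c := fun j k => ((- (1)) ^ j * be j * rf (x + INR j) k * v ^ j * v ^ k)%C).
  assert (Hc : geom2 c (M * 2 ^ m) (1 / 2)).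
  { split; [apply Rmult_le_pos; auto; apply pow_le; lra|]. split; [lra|].
    intros j k. unfold c. rewrite !Cmod_mult, !Cmod_pow, Cmod_m1, pow1, Rmult_1_l.
    apply Rle_trans with (M * K ^ j * 2 ^ (m + j + k) * Cmod v ^ j * Cmod v ^ k).
    - apply Rmult_le_compat_r; [now apply pow_le|].
      apply Rmult_le_compat_r; [now apply pow_le|].
      apply Rmult_le_compat; auto; try apply Cmod_ge_0.
      apply Cmod_rf_le. eapply Rle_trans; [apply Cmod_triangle|].
      rewrite Cmod_RtoC_pos, plus_INR by apply pos_INR. lra.
    - rewrite !pow_add.
      replace (M * K ^ j * (2 ^ m * 2 ^ j * 2 ^ k) * Cmod v ^ j * Cmod v ^ k)
        with (M * 2 ^ m * (2 * K * Cmod v) ^ j * (2 * Cmod v) ^ k)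
        by (rewrite !Rpow_mult_distr; ring).
      assert (0 <= M * 2 ^ m) by (apply Rmult_le_pos; auto; apply pow_le; lra).
      assert (0 <= 2 * K * Cmod v) by (apply Rmult_le_pos; lra).
      apply Rmult_le_compat.
      + apply Rmult_le_pos; auto. now apply pow_le.
      + apply pow_le; lra.
      + apply Rmult_le_compat_l; auto. apply pow_incr. lra.
      + apply pow_incr. lra. }
  assert (Hg : geom (fun j => be j * (- v / (1 - v)) ^ j)%C M (1 / 2)).
  { split; auto. split; [lra|]. intros j. rewrite Cmod_mult, Cmod_pow.
    assert (Hy : Cmod (- v / (1 - v)) <= 2 * Cmod v).
    { rewrite Cmod_div, Cmod_opp by auto.
      assert (1 / 2 <= Cmod (1 - v)).
      { generalize (Cmod_rev_triangle 1 (- v)). rewrite Cmod_1, Cmod_opp.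
        unfold Cminus. lra. }
      apply Rmult_le_reg_r with (Cmod (1 - v)); [lra|].
      unfold Rdiv. rewrite Rmult_assoc, Rinv_l by lra. nra. }
    apply Rle_trans with (M * K ^ j * (2 * Cmod v) ^ j).
    - apply Rmult_le_compat; auto; try apply Cmod_ge_0; [apply pow_le, Cmod_ge_0|].
      apply pow_incr. split; auto. apply Cmod_ge_0.
    - rewrite Rmult_assoc, <- Rpow_mult_distr. apply Rmult_le_compat_l; auto.
      apply pow_incr. split; [|nra]. apply Rmult_le_pos; lra. }
  rewrite <- (CSer_scal _ _ _ _ Hg).
  transitivity (CSer (fun j => CSer (c j))).
  - apply CSer_ext. intros j. unfold c.
    destruct (subexp_geom _ v (rf_subexp (x + INR j)) Hv1) as [M' HM'].
    rewrite (CSer_ext _ (fun k => ((- (1)) ^ j * be j * v ^ j) * (rf (x + INR j) k * v ^ k))%C)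
      by (intros; ring).
    rewrite (CSer_scal _ _ _ _ HM').
    change (CSer (fun n => rf (x + INR j) n * v ^ n)%C) with (bs (x + INR j) v).
    rewrite <- bs_mult, bs_INR by auto.
    unfold Cdiv. rewrite Cpow_mult_l.
    replace (- v)%C with (- (1) * v)%C by ring. rewrite Cpow_mult_l. ring.
  - apply Csums_unique with (fun N => moebius_coef be x N * v ^ N)%C.
    + eapply Csums_ext; [|exact (CSer_diag _ _ _ Hc)].
      intros N. unfold moebius_coef. rewrite Cmult_comm, <- csum_scal.
      apply csum_ext. intros j Hj. unfold c.
      replace (v ^ N)%C with (v ^ j * v ^ (N - j))%C
        by (rewrite <- Cpow_add_r; f_equal; lia). ring.
    + destruct (moebius_coef_bound be x M K HM HK H) as (M' & HM' & HN).
      apply CSer_correct with M' (1 / 2). split; auto. split; [lra|].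
      intros N. rewrite Cmod_mult, Cmod_pow.
      apply Rle_trans with (M' * (4 * K) ^ N * Cmod v ^ N).
      * apply Rmult_le_compat_r; auto. now apply pow_le.
      * rewrite Rmult_assoc, <- Rpow_mult_distr. apply Rmult_le_compat_l; auto.
        apply pow_incr. split; [|nra]. apply Rmult_le_pos; lra.
Qed.

(** * Power series expansions in the complex plane *)

Lemma Clim_filterlim (u : nat -> C) (l : C) :
  Clim u l <-> filterlim u eventually (locally (l : C_NormedModule)).
Proof.
  rewrite Clim_Cmod. split.
  - intros H. apply filterlim_locally. intros eps.
    apply is_lim_seq_spec in H. destruct (H eps) as [N HN]. exists N. intros n Hn.
    apply C_NormedModule_mixin_compat1. generalize (HN n Hn).
    rewrite Rminus_0_r, Rabs_pos_eq by apply Cmod_ge_0. auto.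
  - intros H. apply is_lim_seq_spec. intros eps.
    assert (Hs : 0 < sqrt 2) by (apply sqrt_lt_R0; lra).
    assert (He : 0 < eps / sqrt 2) by (apply Rdiv_lt_0_compat; [apply cond_pos|auto]).
    destruct (proj1 (filterlim_locally _ _) H (mkposreal _ He)) as [N HN].
    exists N. intros n Hn. rewrite Rminus_0_r, Rabs_pos_eq by apply Cmod_ge_0.
    generalize (C_NormedModule_mixin_compat2 _ _ _ (HN n Hn)). simpl.
    replace (sqrt 2 * (eps / sqrt 2)) with (pos eps) by (field; lra). auto.
Qed.

Lemma is_pseries_Csums (a : nat -> C) (v l : C) :
  @is_pseries C_AbsRing C_NormedModule a v l <-> Csums (fun n => a n * v ^ n)%C l.
Proof.
  assert (E : forall n, csum (fun n => a n * v ^ n)%C (n + 1) =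
    @sum_n C_NormedModule
      (fun k => @scal C_AbsRing C_NormedModule (@pow_n C_AbsRing v k) (a k)) n).
  { assert (Hp : forall k, @pow_n C_AbsRing v k = (v ^ k)%C).
    { induction k; [reflexivity|]. rewrite Cpow_S, <- IHk. reflexivity. }
    intros n. rewrite Nat.add_1_r. induction n.
    - rewrite sum_O, Hp. simpl. change (0 + a O * 1 = 1 * a O)%C. ring.
    - rewrite sum_Sn, <- IHn, Hp.
      change (csum (fun n => a n * v ^ n) (S n) + a (S n) * v ^ S n
        = csum (fun n => a n * v ^ n) (S n) + v ^ S n * a (S n))%C. ring. }
  unfold is_pseries, is_series, Csums. rewrite (Clim_shift _ _ 1), Clim_filterlim.
  split; apply filterlim_ext; intros n; now rewrite E.
Qed.

(** Binomial expansion of (y0 + eta)^n, rearranged by powers of eta. The exponential bound on the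
    new coefficients [ga] is what the later Moebius substitution requires. *)
Lemma series_recenter (u : nat -> C) (y0 : C) :
  subexp u -> Cmod y0 < 1 ->
  exists (ga : nat -> C) (M K d : R), 0 <= M /\ 1 <= K /\ 0 < d /\
    (forall k, Cmod (ga k) <= M * K ^ k) /\
    forall eta, Cmod eta < d ->
      CSer (fun n => u n * (y0 + eta) ^ n)%C = CSer (fun k => ga k * eta ^ k)%C.
Proof.
  intros Hu Hy. assert (Hy0 := Cmod_ge_0 y0).
  (* The value (1 - y1) / 6 makes (1 + la)^2 y1 <= (1 + y1) / 2 < 1; one factor 1 + la pays for the
     growth of u, the other for the binomial coefficients. *)
  set (y1 := Cmod y0) in *. set (la := (1 - y1) / 6).
  assert (Hla : 0 < la <= / 6) by (unfold la; split; lra).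
  destruct (Hu (1 + la)) as (M & HM & HMn); [lra|].
  set (r := (1 + y1) / 2). assert (Hr : 1 / 2 <= r < 1) by (unfold r; lra).
  set (K := (1 + la) * (1 + la) / la).
  assert (HK : 1 <= K).
  { unfold K. apply Rmult_le_reg_r with la; [lra|].
    unfold Rdiv. rewrite Rmult_assoc, Rinv_l by lra. nra. }
  assert (Hyr : (1 + la) * (1 + la) * y1 <= r).
  { assert ((1 + la) * (1 + la) <= 1 + 3 * la) by nra.
    apply Rle_trans with ((1 + 3 * la) * y1); [nra|]. unfold r. unfold la. nra. }
  assert (Hb : forall k i, Cmod (u (k + i)%nat * rf (INR (S i)) k * y0 ^ i)
    <= M * (1 + la) * K ^ k * r ^ i).
  { intros k i. rewrite !Cmod_mult, Cmod_pow. fold y1.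
    apply Rle_trans with ((M * (1 + la) ^ (k + i)) * ((1 + la) ^ (S i + k) / la ^ k) * y1 ^ i).
    - apply Rmult_le_compat_r; [now apply pow_le|].
      apply Rmult_le_compat; auto; try apply Cmod_ge_0. apply Cmod_rf_INR_le; lra.
    - apply Rle_trans with (M * (1 + la) * K ^ k * ((1 + la) * (1 + la) * y1) ^ i).
      + right. unfold K, Rdiv. rewrite !pow_add, !Rpow_mult_distr, pow_inv. simpl. ring.
      + apply Rmult_le_compat_l.
        * apply Rmult_le_pos; [nra|]. apply pow_le; lra.
        * apply pow_incr. split; auto. apply Rmult_le_pos; nra. }
  set (ga := fun k => CSer (fun i => u (k + i)%nat * rf (INR (S i)) k * y0 ^ i)%C).
  assert (Hg : forall k, geom (fun i => u (k + i)%nat * rf (INR (S i)) k * y0 ^ i)%C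
    (M * (1 + la) * K ^ k) r).
  { intros k. split; [|split]; [|lra|auto].
    apply Rmult_le_pos; [nra|]. apply pow_le; lra. }
  exists ga, (M * (1 + la) / (1 - r)), K, (/ (2 * K)).
  split; [|split; [|split; [|split]]]; auto.
  - apply Rmult_le_pos; [nra|]. left; apply Rinv_0_lt_compat; lra.
  - apply Rinv_0_lt_compat; lra.
  - intros k. eapply Rle_trans; [apply (CSer_bound _ _ _ (Hg k))|]. right; field; lra.
  - intros eta Heta. assert (He0 := Cmod_ge_0 eta).
    assert (HKe : K * Cmod eta <= r).
    { apply Rle_trans with (K * / (2 * K)); [nra|]. replace (K * / (2 * K)) with (1 / 2); [lra|].
      field; lra. }
    set (c := fun k i => (eta ^ k * (u (k + i)%nat * rf (INR (S i)) k * y0 ^ i))%C).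
    assert (Hc : geom2 c (M * (1 + la)) r).
    { split; [nra|]. split; [lra|]. intros k i. unfold c. rewrite Cmod_mult, Cmod_pow.
      apply Rle_trans with (Cmod eta ^ k * (M * (1 + la) * K ^ k * r ^ i)).
      - apply Rmult_le_compat_l; [now apply pow_le|auto].
      - replace (Cmod eta ^ k * (M * (1 + la) * K ^ k * r ^ i))
          with (M * (1 + la) * (K * Cmod eta) ^ k * r ^ i) by (rewrite Rpow_mult_distr; ring).
        apply Rmult_le_compat_r; [apply pow_le; lra|].
        apply Rmult_le_compat_l; [nra|]. apply pow_incr. split; auto.
        apply Rmult_le_pos; lra. }
    transitivity (CSer (fun k => CSer (c k))).
    + apply CSer_unique. eapply Csums_ext; [|exact (CSer_diag _ _ _ Hc)].
      intros n. cbv beta. rewrite (Cplus_comm y0), Cpow_plus_binomial, <- csum_scal.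
      apply csum_ext. intros k Hk. unfold c.
      replace (k + (n - k))%nat with n by lia. ring.
    + apply CSer_ext. intros k. unfold c. rewrite (CSer_scal _ _ _ _ (Hg k)).
      apply Cmult_comm.
Qed.

(** Analyticity with an explicit exponential bound on the coefficients, a form that is easily
    carried through products and through the Moebius substitution. *)
Definition expands (f : C -> C) (w0 : C) : Prop :=
  exists (a : nat -> C) (M K d : R), 0 <= M /\ 1 <= K /\ 0 < d /\
    (forall n, Cmod (a n) <= M * K ^ n) /\
    forall h, Cmod h < d -> f (w0 + h)%C = CSer (fun n => a n * h ^ n)%C.

Lemma geom_pow (a : nat -> C) (M K : R) (h : C) :
  0 <= M -> 1 <= K -> (forall n, Cmod (a n) <= M * K ^ n) -> Cmod h * (2 * K) <= 1 ->
  geom (fun n => a n * h ^ n)%C M (1 / 2).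
Proof.
  intros HM HK H Hh. split; auto. split; [lra|]. intros n.
  rewrite Cmod_mult, Cmod_pow. assert (H0 := Cmod_ge_0 h).
  apply Rle_trans with (M * K ^ n * Cmod h ^ n).
  - apply Rmult_le_compat_r; [now apply pow_le|auto].
  - rewrite Rmult_assoc, <- Rpow_mult_distr. apply Rmult_le_compat_l; auto.
    apply pow_incr. split; [|lra]. apply Rmult_le_pos; lra.
Qed.

Lemma expands_analytic (f : C -> C) (w0 : C) : expands f w0 -> analytic_at f w0.
Proof.
  intros (a & M & K & d & HM & HK & Hd & Ha & Hf).
  exists a, (Rmin d (/ (2 * K))). split.
  - apply Rmin_glb_lt; auto. apply Rinv_0_lt_compat; lra.
  - intros w Hw. apply is_pseries_Csums.
    replace (f w) with (f (w0 + (w - w0))%C) by (f_equal; ring).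
    rewrite Hf by (eapply Rlt_le_trans; [exact Hw|apply Rmin_l]).
    apply CSer_correct with M (1 / 2). apply geom_pow with K; auto.
    apply Rle_trans with (/ (2 * K) * (2 * K)).
    + apply Rmult_le_compat_r; [lra|]. left. eapply Rlt_le_trans; [exact Hw|apply Rmin_r].
    + rewrite Rinv_l; lra.
Qed.

Lemma conv_bound (a b : nat -> C) (M M' K : R) (n : nat) :
  0 <= M -> 0 <= M' -> 1 <= K ->
  (forall n, Cmod (a n) <= M * K ^ n) -> (forall n, Cmod (b n) <= M' * K ^ n) ->
  Cmod (conv a b n) <= M * M' * (2 * K) ^ n.
Proof.
  intros HM HM' HK Ha Hb. unfold conv.
  apply Rle_trans with (INR (S n) * (M * M' * K ^ n)).
  - apply csum_Cmod_le. intros i Hi. rewrite Cmod_mult.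
    apply Rle_trans with ((M * K ^ i) * (M' * K ^ (n - i))).
    + apply Rmult_le_compat; auto; apply Cmod_ge_0.
    + right. replace (K ^ n) with (K ^ i * K ^ (n - i)) by (rewrite <- pow_add; f_equal; lia).
      ring.
  - rewrite Rpow_mult_distr. replace (M * M' * (2 ^ n * K ^ n)) with (2 ^ n * (M * M' * K ^ n)) by ring.
    apply Rmult_le_compat_r; [|apply S_le_pow2].
    apply Rmult_le_pos; [now apply Rmult_le_pos|]. apply pow_le; lra.
Qed.

Lemma expands_mult (f g : C -> C) (w0 : C) :
  expands f w0 -> expands g w0 -> expands (fun w => f w * g w)%C w0.
Proof.
  intros (a & M & K & d & HM & HK & Hd & Ha & Hf) (b & M' & K' & d' & HM' & HK' & Hd' & Hb & Hg).
  set (L := Rmax K K').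
  assert (HL : K <= L /\ K' <= L) by (split; [apply Rmax_l|apply Rmax_r]).
  assert (Ha' : forall n, Cmod (a n) <= M * L ^ n).
  { intros n. eapply Rle_trans; [apply Ha|]. apply Rmult_le_compat_l; auto.
    apply pow_incr; lra. }
  assert (Hb' : forall n, Cmod (b n) <= M' * L ^ n).
  { intros n. eapply Rle_trans; [apply Hb|]. apply Rmult_le_compat_l; auto.
    apply pow_incr; lra. }
  exists (conv a b), (M * M'), (2 * L), (Rmin (Rmin d d') (/ (2 * L))).
  split; [now apply Rmult_le_pos|]. split; [lra|]. split.
  { repeat apply Rmin_glb_lt; auto. apply Rinv_0_lt_compat; lra. }
  split.
  - intros n. apply conv_bound; auto; lra.
  - intros h Hh.
    assert (Hh1 : Cmod h < d) by (eapply Rlt_le_trans; [exact Hh|];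
      eapply Rle_trans; [apply Rmin_l|apply Rmin_l]).
    assert (Hh2 : Cmod h < d') by (eapply Rlt_le_trans; [exact Hh|];
      eapply Rle_trans; [apply Rmin_l|apply Rmin_r]).
    assert (Hh3 : Cmod h * (2 * L) <= 1).
    { apply Rle_trans with (/ (2 * L) * (2 * L)).
      + apply Rmult_le_compat_r; [lra|]. left. eapply Rlt_le_trans; [exact Hh|apply Rmin_r].
      + rewrite Rinv_l; lra. }
    rewrite Hf, Hg by auto. symmetry. apply CSer_unique.
    apply CSer_pow_mult with M M' (1 / 2); apply geom_pow with L; auto; lra.
Qed.

(** A point with real part below 1/2 is closer to 0 than to 1; hence w / (w - 1) lies in the unit
    disc, where Pfaff's series converges. *)
Lemma half_plane_lt (w : C) : Re w < 1 / 2 -> Cmod w < Cmod (1 - w).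
Proof.
  intros H. destruct w as [x y]. unfold Cmod, Re in *. simpl fst in *; simpl snd in *.
  apply sqrt_lt_1; try nra.
Qed.

Lemma half_plane_neq (w : C) : Re w < 1 / 2 -> (1 - w)%C <> 0%C.
Proof.
  intros H. apply Cmod_gt_0. eapply Rle_lt_trans; [apply (Cmod_ge_0 w)|now apply half_plane_lt].
Qed.

(** With e = 1 / (1 - w0) and v = e h, the value of w / (w - 1) at w0 + h is y0 + e (- v / (1 - v)).
    So the series is recentred at y0, and [moebius_resum] with x = 0 turns powers of - v / (1 - v)
    into powers of h. *)
Lemma expands_moebius (u : nat -> C) (w0 : C) :
  subexp u -> Re w0 < 1 / 2 -> expands (fun w => CSer (fun n => u n * (w / (w - 1)) ^ n)%C) w0.
Proof.
  intros Hu Hw.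
  assert (Hn := half_plane_neq w0 Hw). assert (Hlt := half_plane_lt w0 Hw).
  set (y0 := (w0 / (w0 - 1))%C). set (e := (/ (1 - w0))%C).
  assert (Hn' : (w0 - 1)%C <> 0%C).
  { intros E. apply Hn. replace (1 - w0)%C with (- (w0 - 1))%C by ring. rewrite E. apply Copp_0. }
  assert (Hy : Cmod y0 < 1).
  { unfold y0. rewrite Cmod_div by auto. rewrite (Cmod_minus_sym w0 1).
    apply Rmult_lt_reg_r with (Cmod (1 - w0)); [now apply Cmod_gt_0|].
    unfold Rdiv. rewrite Rmult_assoc, Rinv_l, Rmult_1_r, Rmult_1_l; auto.
    generalize (Cmod_ge_0 w0). lra. }
  destruct (series_recenter u y0 Hu Hy) as (ga & M & K & d & HM & HK & Hd & Hga & Hser).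
  assert (He : 0 < Cmod e) by (apply Cmod_gt_0, Cmod_gt_0; unfold e; rewrite Cmod_inv by auto;
    apply Rinv_0_lt_compat, Cmod_gt_0; auto).
  set (E := 1 + Cmod e). set (K' := K * E).
  assert (HE : 1 <= E) by (unfold E; lra).
  assert (HK' : 1 <= K') by (unfold K'; nra).
  assert (Hbe : forall k, Cmod (ga k * e ^ k) <= M * K' ^ k).
  { intros k. rewrite Cmod_mult, Cmod_pow. unfold K'. rewrite Rpow_mult_distr, <- Rmult_assoc.
    apply Rmult_le_compat; auto; try apply Cmod_ge_0; [apply pow_le; lra|].
    apply pow_incr. unfold E. lra. }
  destruct (moebius_coef_bound _ 0 M K' HM HK' Hbe) as (M' & HM' & HM'n).
  exists (fun N => moebius_coef (fun k => ga k * e ^ k) 0 N * e ^ N)%C, M', (4 * K' * E),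
    (Rmin (/ (8 * K' * E)) (d / (2 * E * E))).
  split; auto. split; [nra|]. split.
  { apply Rmin_glb_lt; [apply Rinv_0_lt_compat; nra|].
    apply Rdiv_lt_0_compat; nra. }
  split.
  - intros n. rewrite Cmod_mult, Cmod_pow, (Rpow_mult_distr (4 * K')), <- Rmult_assoc.
    apply Rmult_le_compat; auto; try apply Cmod_ge_0; [apply pow_le; lra|].
    apply pow_incr. unfold E. lra.
  - intros h Hh. assert (Hh0 := Cmod_ge_0 h).
    set (v := (e * h)%C).
    assert (Hv : Cmod v <= E * Cmod h) by (unfold v; rewrite Cmod_mult; unfold E; nra).
    assert (Hh1 : Cmod h * (8 * K' * E) <= 1).
    { apply Rle_trans with (/ (8 * K' * E) * (8 * K' * E)).
      - apply Rmult_le_compat_r; [nra|]. left. eapply Rlt_le_trans; [exact Hh|apply Rmin_l].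
      - rewrite Rinv_l; nra. }
    assert (Hh2 : Cmod h * (2 * E * E) < d).
    { apply Rlt_le_trans with (d / (2 * E * E) * (2 * E * E)).
      - apply Rmult_lt_compat_r; [nra|]. eapply Rlt_le_trans; [exact Hh|apply Rmin_r].
      - right; field; nra. }
    assert (Hv8 : Cmod v * (8 * K') <= 1).
    { apply Rle_trans with (E * Cmod h * (8 * K')); [nra|]. lra. }
    assert (Hv0 := Cmod_ge_0 v).
    assert (Hv1 : Cmod v <= / 8) by nra.
    assert (Hvn : (1 - v)%C <> 0%C) by (apply one_minus_neq_0; lra).
    assert (Hhalf : 1 / 2 <= Cmod (1 - v)).
    { generalize (Cmod_rev_triangle 1 (- v)). rewrite Cmod_1, Cmod_opp. unfold Cminus. lra. }
    assert (Ey : ((w0 + h) / (w0 + h - 1))%C = (y0 + e * (- v / (1 - v)))%C).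
    { assert (Hvn2 : (1 - w0 - h)%C <> 0%C).
      { replace (1 - w0 - h)%C with ((1 - w0) * (1 - v))%C by (unfold v, e; field; auto).
        now apply Cmult_neq_0. }
      assert (Hvn3 : (w0 + h - 1)%C <> 0%C).
      { intros E0. apply Hvn2. replace (1 - w0 - h)%C with (- (w0 + h - 1))%C by ring.
        rewrite E0. apply Copp_0. }
      unfold y0, v, e. field. repeat split; auto. }
    rewrite Ey, Hser.
    + transitivity (bs 0 v * CSer (fun k => (ga k * e ^ k) * (- v / (1 - v)) ^ k))%C.
      * rewrite bs_0, Cmult_1_l. apply CSer_ext. intros k. rewrite Cpow_mult_l. ring.
      * rewrite (moebius_resum _ 0 M K' v HM HK' Hbe Hv8).
        apply CSer_ext. intros N. unfold v. rewrite Cpow_mult_l. ring.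
    + rewrite Cmod_mult, Cmod_div, Cmod_opp by auto.
      assert (Cmod v / Cmod (1 - v) <= 2 * Cmod v).
      { apply Rmult_le_reg_r with (Cmod (1 - v)); [lra|].
        unfold Rdiv. rewrite Rmult_assoc, Rinv_l by lra. nra. }
      apply Rle_lt_trans with (E * (2 * (E * Cmod h))); [|nra].
      apply Rmult_le_compat; [lra| |unfold E; lra|lra].
      apply Rmult_le_pos; auto. left. apply Rinv_0_lt_compat; lra.
Qed.

(** * Uniqueness of the analytic continuation along a segment *)

(** The terms are differences of consecutive partial sums, so they converge to 0 and are bounded. *)
Lemma Csums_bounded_coef (c : nat -> C) (h l : C) :
  h <> 0%C -> Csums (fun n => c n * h ^ n)%C l ->
  exists M K, 0 <= M /\ 1 <= K /\ forall n, Cmod (c n) <= M * K ^ n.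
Proof.
  intros Hh H. assert (Hp : 0 < Cmod h) by now apply Cmod_gt_0.
  assert (H0 : Clim (fun n => csum (fun n => c n * h ^ n) (n + 1)
    + - csum (fun n => c n * h ^ n) n)%C (l + - l)).
  { apply Clim_plus; [now apply (proj1 (Clim_shift _ l 1))|now apply Clim_opp]. }
  apply Clim_filterlim in H0.
  destruct (filterlim_bounded (K := C_AbsRing) (V := C_NormedModule) _
    (ex_intro (fun x : C_NormedModule => filterlim _ eventually (locally x)) _ H0)) as [M HM].
  assert (HM' : forall n, Cmod (c n) * Cmod h ^ n <= M).
  { intros n. rewrite <- Cmod_pow, <- Cmod_mult. eapply Rle_trans; [|apply (HM n)].
    right. change (@norm C_AbsRing C_NormedModule) with Cmod. f_equal.
    rewrite Nat.add_1_r. simpl. ring. }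
  exists M, (1 + / Cmod h).
  assert (0 < / Cmod h) by now apply Rinv_0_lt_compat.
  split; [|split; [lra|]].
  - eapply Rle_trans; [|apply (HM' O)]. simpl. generalize (Cmod_ge_0 (c O)); lra.
  - intros n. apply Rle_trans with (M * (/ Cmod h) ^ n).
    + rewrite pow_inv. assert (0 < Cmod h ^ n) by now apply pow_lt.
      apply Rmult_le_reg_r with (Cmod h ^ n); auto.
      rewrite (Rmult_assoc M), Rinv_l, Rmult_1_r by lra. auto.
    + apply Rmult_le_compat_l.
      * eapply Rle_trans; [|apply (HM' O)]. simpl. generalize (Cmod_ge_0 (c O)); lra.
      * apply pow_incr. lra.
Qed.

(** The lowest nonzero coefficient would dominate the sum for small tau. The minus sign reflects the
    use made of it: the points (s - tau) w approach the centre s w from the side of the origin. *)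
Lemma pseries_zero (c : nat -> C) (w : C) (d : R) :
  w <> 0%C -> 0 < d ->
  (forall tau, 0 < tau < d -> Csums (fun n => c n * (- (tau * w)) ^ n)%C 0) ->
  forall n, c n = 0%C.
Proof.
  intros Hw Hd H.
  assert (Hp : 0 < Cmod w) by now apply Cmod_gt_0.
  assert (Hh : forall tau, 0 < tau -> (- (tau * w))%C <> 0%C).
  { intros tau Ht. apply Cmod_gt_0. rewrite Cmod_opp, Cmod_mult, Cmod_RtoC_pos by lra. nra. }
  destruct (Csums_bounded_coef c (- (RtoC (d / 2) * w)) 0 (Hh (d / 2) ltac:(lra))
    (H (d / 2) ltac:(lra))) as (M & K & HM & HK & Hc).
  intros n. induction n as [n IH] using (well_founded_induction Wf_nat.lt_wf).
  apply Cmod_eq_0. apply Rle_antisym; [|apply Cmod_ge_0].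
  apply Rnot_lt_le. intros Hpos.
  set (B := 2 * (M * K ^ n * K)).
  assert (HKn : 0 <= K ^ n) by (apply pow_le; lra).
  assert (HB : 0 <= B) by (unfold B; repeat apply Rmult_le_pos; lra).
  (* Three requirements: stay in the range of the hypothesis, give the remaining series the ratio
     1/2, and make |h| B smaller than |c n|, where B bounds the sum of the terms after the n-th once
     h^(n + 1) is taken out. *)
  set (tau := Rmin (d / 2) (Rmin (/ (2 * K * Cmod w)) (Cmod (c n) / (2 * (B + 1) * Cmod w)))).
  assert (Htau : 0 < tau).
  { unfold tau. repeat apply Rmin_glb_lt; [lra| |].
    - apply Rinv_0_lt_compat. nra.
    - apply Rdiv_lt_0_compat; nra. }
  assert (Ht1 : tau <= d / 2) by apply Rmin_l.
  assert (Ht2 : tau * (2 * K * Cmod w) <= 1).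
  { apply Rle_trans with (/ (2 * K * Cmod w) * (2 * K * Cmod w)); [|rewrite Rinv_l; nra].
    apply Rmult_le_compat_r; [nra|].
    eapply Rle_trans; [apply Rmin_r|apply Rmin_l]. }
  assert (Ht3 : tau * (2 * (B + 1) * Cmod w) <= Cmod (c n)).
  { apply Rle_trans with (Cmod (c n) / (2 * (B + 1) * Cmod w) * (2 * (B + 1) * Cmod w)).
    - apply Rmult_le_compat_r; [nra|]. eapply Rle_trans; [apply Rmin_r|apply Rmin_r].
    - right; field; nra. }
  set (h := (- (tau * w))%C).
  assert (Hmh : Cmod h = tau * Cmod w).
  { unfold h. rewrite Cmod_opp, Cmod_mult, Cmod_RtoC_pos by lra. auto. }
  assert (Hh0 : h <> 0%C) by (unfold h; auto).
  assert (Hg : forall m, geom (fun k => c (m + k)%nat * h ^ k)%C (M * K ^ m) (1 / 2)).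
  { intros m. apply geom_pow with K; auto.
    - apply Rmult_le_pos; auto. apply pow_le; lra.
    - intros k. rewrite Rmult_assoc, <- pow_add. auto.
    - rewrite Hmh. lra. }
  assert (E0 : CSer (fun k => c (n + k)%nat * h ^ k)%C = 0%C).
  { assert (Hcs : Csums (fun k => h ^ n * (c (n + k)%nat * h ^ k))%C 0).
    { unfold Csums. apply Clim_ext with (fun m => csum (fun k => c k * h ^ k)%C (m + n)).
      - intros m. rewrite (Nat.add_comm m n), csum_tail.
        rewrite (csum_ext _ (fun _ => 0%C) n).
        + rewrite csum_zero, Cplus_0_l. apply csum_ext. intros i _. rewrite Cpow_add_r. ring.
        + intros i Hi. rewrite (IH i Hi). ring.
      - apply (proj1 (Clim_shift _ _ n)). apply H. lra. }
    assert (E1 := Csums_unique _ _ _ Hcs (Csums_scal (h ^ n) _ _ (CSer_correct _ _ _ (Hg n)))).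
    assert (Hhn := Cpow_nz h n Hh0).
    replace (CSer (fun k => c (n + k)%nat * h ^ k)%C) with
      (/ h ^ n * (h ^ n * CSer (fun k => c (n + k)%nat * h ^ k)))%C by (field; auto).
    rewrite <- E1. ring. }
  rewrite (CSer_S _ _ _ (Hg n)) in E0.
  rewrite Nat.add_0_r in E0. simpl in E0.
  rewrite (CSer_ext _ (fun k => h * (c (S n + k)%nat * h ^ k))%C) in E0
    by (intros k; rewrite Nat.add_succ_r; simpl; ring).
  rewrite (CSer_scal _ _ _ _ (Hg (S n))) in E0.
  assert (E2 : c n = (- (h * CSer (fun k => c (S n + k)%nat * h ^ k)))%C).
  { replace (c n) with ((c n * 1 + h * CSer (fun k => c (S n + k)%nat * h ^ k))
      - h * CSer (fun k => c (S n + k)%nat * h ^ k))%C by ring. rewrite E0. ring. }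
  assert (HcB : Cmod (c n) <= tau * Cmod w * B).
  { rewrite E2, Cmod_opp, Cmod_mult, Hmh. apply Rmult_le_compat_l; [nra|].
    eapply Rle_trans; [apply (CSer_bound _ _ _ (Hg (S n)))|]. right. unfold B. simpl. field. }
  assert (0 < tau * Cmod w) by nra. nra.
Qed.

Lemma analytic_eq_near (f g : C -> C) (w : C) (s d : R) :
  w <> 0%C -> 0 < d -> analytic_at f (s * w) -> analytic_at g (s * w) ->
  (forall s', s - d < s' < s -> f (s' * w)%C = g (s' * w)%C) ->
  exists r, 0 < r /\ forall v, Cmod (v - s * w) < r -> f v = g v.
Proof.
  intros Hw Hd (a & r & Hr & Ha) (b & r' & Hr' & Hb) H.
  assert (Hp : 0 < Cmod w) by now apply Cmod_gt_0.
  assert (Hsum : forall v, Cmod (v - s * w) < Rmin r r' ->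
    Csums (fun n => (a n + - b n) * (v - s * w) ^ n)%C (f v + - g v)).
  { intros v Hv.
    assert (H1 := proj1 (is_pseries_Csums _ _ _) (Ha v (Rlt_le_trans _ _ _ Hv (Rmin_l _ _)))).
    assert (H2 := proj1 (is_pseries_Csums _ _ _) (Hb v (Rlt_le_trans _ _ _ Hv (Rmin_r _ _)))).
    replace (- g v)%C with (- (1) * g v)%C by ring.
    eapply Csums_ext; [|apply Csums_plus; [exact H1|apply (Csums_scal (- (1))), H2]].
    intros n. simpl. ring. }
  assert (Hm : 0 < Rmin r r') by now apply Rmin_glb_lt.
  assert (Hz : forall n, (a n + - b n)%C = 0%C).
  { apply pseries_zero with w (Rmin d (Rmin r r' / Cmod w)); auto.
    - apply Rmin_glb_lt; auto. now apply Rdiv_lt_0_compat.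
    - intros tau Ht.
      assert (Ht1 : tau < d) by (eapply Rlt_le_trans; [apply Ht|apply Rmin_l]).
      assert (Ht2 : tau * Cmod w < Rmin r r').
      { apply Rlt_le_trans with (Rmin r r' / Cmod w * Cmod w); [|right; field; lra].
        apply Rmult_lt_compat_r; auto. eapply Rlt_le_trans; [apply Ht|apply Rmin_r]. }
      assert (Ev : (RtoC (s - tau) * w - s * w)%C = (- (tau * w))%C)
        by (rewrite RtoC_minus; ring).
      generalize (Hsum (RtoC (s - tau) * w)%C). rewrite Ev. intros Hs.
      rewrite <- (H (s - tau)) in Hs by lra.
      rewrite Cplus_opp_r in Hs. apply Hs.
      rewrite Cmod_opp, Cmod_mult, Cmod_RtoC_pos by lra. auto. }
  exists (Rmin r r'). split; auto. intros v Hv.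
  assert (E : (f v + - g v)%C = 0%C).
  { apply Csums_unique with (1 := Hsum v Hv).
    apply Clim_ext with (fun _ => 0%C); [|apply Clim_const].
    intros n. symmetry. erewrite csum_ext; [apply csum_zero|]. intros i _. simpl. rewrite Hz. ring. }
  replace (f v) with (f v + - g v + g v)%C by ring. rewrite E. ring.
Qed.

(** Star-shapedness puts the segment from 0 to w in both domains. The continuations agree near 0,
    where both are the Gauss series; at the supremum s of the parameters up to which they agree, the
    identity theorem carries the agreement past s. Hence s = 1, endpoint included. *)
Lemma hyp2F1_value_unique (a b c w y y' : C) :
  w <> 0%C -> hyp2F1_value a b c w y -> hyp2F1_value a b c w y' -> y = y'.
Proof.
  intros Hw (U & f & _ & Hstar & _ & Han & (r & Hr & Hf) & HUw & <-)
    (V & g & _ & Hstar' & _ & Han' & (r' & Hr' & Hg) & HVw & <-).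
  assert (Hp : 0 < Cmod w) by now apply Cmod_gt_0.
  set (E := fun s => 0 <= s <= 1 /\ forall s', 0 <= s' <= s -> f (s' * w)%C = g (s' * w)%C).
  set (m := Rmin r r'). assert (Hm : 0 < m) by (now apply Rmin_glb_lt).
  set (s0 := Rmin 1 (m / 2 / Cmod w)).
  assert (Hs0 : 0 < s0).
  { apply Rmin_glb_lt; [lra|]. apply Rdiv_lt_0_compat; lra. }
  assert (HE0 : E s0).
  { split; [split; [lra|apply Rmin_l]|]. intros s' Hs'.
    assert (Hsm : Cmod (s' * w) < m).
    { rewrite Cmod_mult, Cmod_RtoC_pos by lra.
      apply Rle_lt_trans with (m / 2 / Cmod w * Cmod w).
      - apply Rmult_le_compat_r; [lra|]. eapply Rle_trans; [apply Hs'|apply Rmin_r].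
      - replace (m / 2 / Cmod w * Cmod w) with (m / 2) by (field; lra). lra. }
    apply Csums_unique with (fun n => gauss_coef a b c n * (s' * w) ^ n)%C; apply is_pseries_Csums.
    - apply Hf. eapply Rlt_le_trans; [exact Hsm|apply Rmin_l].
    - apply Hg. eapply Rlt_le_trans; [exact Hsm|apply Rmin_r]. }
  destruct (completeness E) as [s [Hub Hlub]].
  - exists 1. intros x [Hx _]. lra.
  - now exists s0.
  - assert (Hs1 : s <= 1) by (apply Hlub; intros x [Hx _]; lra).
    assert (Hs0s : s0 <= s) by now apply Hub.
    assert (Hbelow : forall s', 0 <= s' < s -> f (s' * w)%C = g (s' * w)%C).
    { intros s' Hs'. destruct (classic (exists x, E x /\ s' <= x)) as [(x & [Hx Hx'] & Hsx)|Hno].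
      - apply Hx'. lra.
      - exfalso. assert (s <= s'); [|lra]. apply Hlub. intros x Hx.
        apply Rnot_lt_le. intros Hlt. apply Hno. exists x. split; auto. lra. }
    destruct (analytic_eq_near f g w s s Hw) as (d & Hd & Heq).
    + lra.
    + apply Han, Hstar; auto. lra.
    + apply Han', Hstar'; auto. lra.
    + intros s' Hs'. apply Hbelow. lra.
    + assert (Hnear : forall s', 0 <= s' < s + d / Cmod w -> f (s' * w)%C = g (s' * w)%C).
      { intros s' Hs'. destruct (Rlt_dec s' s) as [Hlt|Hge]; [apply Hbelow; lra|].
        apply Heq. replace (s' * w - s * w)%C with (RtoC (s' - s) * w)%C
          by (rewrite RtoC_minus; ring).
        rewrite Cmod_mult, Cmod_RtoC_pos by lra.
        apply Rlt_le_trans with (d / Cmod w * Cmod w); [|right; field; lra].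
        apply Rmult_lt_compat_r; lra. }
      assert (Hdw : 0 < d / Cmod w) by now apply Rdiv_lt_0_compat.
      assert (s = 1) as ->.
      { apply Rle_antisym; auto. apply Rnot_lt_le. intros Hlt.
        assert (Rmin 1 (s + d / Cmod w / 2) <= s).
        { apply Hub. split.
          - split; [|apply Rmin_l]. apply Rmin_glb; lra.
          - intros s' Hs'. apply Hnear. split; [lra|].
            eapply Rle_lt_trans; [apply Hs'|]. eapply Rle_lt_trans; [apply Rmin_r|]. lra. }
        generalize (Rmin_glb_lt 1 (s + d / Cmod w / 2) s). lra. }
      replace w with (RtoC 1 * w)%C by ring. apply Hnear. lra.
Qed.

(** * The value of the continued function on the negative axis *)

Definition hyp_ser (a b c : C) (x : C) : C := CSer (fun n => gauss_coef a b c n * x ^ n)%C.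

(** The identity (1 + v / (1 - v))^a = (1 - v)^(-a) on coefficients, which is the case c = 0 of
    [rf_pfaff]. *)
Lemma moebius_coef_rf (a : C) (N : nat) : moebius_coef (rf (- a)) 0 N = rf a N.
Proof.
  rewrite <- (rf_pfaff a 0). unfold moebius_coef. apply csum_ext. intros n Hn.
  now replace (0 - a)%C with (- a)%C by ring.
Qed.

(** Pfaff's transformation on coefficients: once the common factor (a)_N / (c)_N is taken out, what
    remains is [rf_pfaff]. *)
Lemma moebius_coef_gauss (a b : C) (c : R) (N : nat) :
  0 < c -> moebius_coef (gauss_coef a (c - b) c) a N = gauss_coef a b c N.
Proof.
  intros Hc. transitivity (poch a N / poch c N * rf b N)%C.
  - rewrite <- (rf_pfaff b c), <- csum_scal. unfold moebius_coef.
    apply csum_ext. intros n Hn. unfold gauss_coef, rf.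
    replace (poch a N) with (poch a n * poch (a + INR n) (N - n))%C
      by (rewrite <- poch_add; f_equal; lia).
    replace (poch c N) with (poch c n * poch (c + INR n) (N - n))%C
      by (rewrite <- poch_add; f_equal; lia).
    field. repeat split; try apply RtoC_INR_fact_neq_0.
    + rewrite <- RtoC_plus. apply poch_pos_neq_0. generalize (pos_INR n); lra.
    + now apply poch_pos_neq_0.
  - unfold gauss_coef, rf. field. split; [apply RtoC_INR_fact_neq_0|now apply poch_pos_neq_0].
Qed.

Lemma subexp_bound2 (u : nat -> C) :
  subexp u -> exists M, 0 <= M /\ forall n, Cmod (u n) <= M * 2 ^ n.
Proof. intros H. apply H. lra. Qed.

(** Pfaff's transformation continues the Gauss series to the half-plane [Re w < 1/2]. *)
Lemma hyp2F1_value_pfaff (a b : C) (c : R) (w : C) :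
  0 < c -> Re w < 1 / 2 ->
  hyp2F1_value a b c w (bs (- a) (w / (w - 1)) * hyp_ser a (c - b) c (w / (w - 1))).
Proof.
  intros Hc Hw. exists (fun v => Re v < 1 / 2),
    (fun v => bs (- a) (v / (v - 1)) * hyp_ser a (c - b) c (v / (v - 1)))%C.
  assert (Hs1 := rf_subexp (- a)). assert (Hs2 := gauss_coef_subexp a (c - b) c Hc).
  split; [|split; [|split; [|split; [|split; [|split]]]]]; auto.
  - intros v Hv. exists (1 / 2 - Re v). split; [lra|]. intros v' Hv'.
    generalize (re_le_Cmod (v' - v)) (Rle_abs (Re (v' - v))).
    replace (Re (v' - v)%C) with (Re v' - Re v) by (destruct v, v'; reflexivity). lra.
  - intros v s Hv Hs. rewrite re_scal_l. destruct (Rle_dec (Re v) 0); nra.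
  - intros x Hx. simpl. lra.
  - intros v Hv. apply expands_analytic, expands_mult; now apply expands_moebius.
  - destruct (subexp_bound2 _ Hs1) as (M1 & HM1 & H1), (subexp_bound2 _ Hs2) as (M2 & HM2 & H2).
    (* Both coefficient sequences grow at most like 2^n, and [moebius_resum] with K = 2 asks for 16
       |v| <= 1. *)
    exists (/ 16). split; [lra|]. intros v Hv. apply is_pseries_Csums.
    assert (Hv1 : Cmod v < 1) by lra.
    assert (Hvn := one_minus_neq_0 v Hv1).
    assert (Hvn' : (v - 1)%C <> 0%C).
    { intros E. apply Hvn. replace (1 - v)%C with (- (v - 1))%C by ring. rewrite E. apply Copp_0. }
    replace (v / (v - 1))%C with (- v / (1 - v))%C by (field; auto).
    assert (E1 : bs (- a) (- v / (1 - v)) = bs a v).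
    { generalize (moebius_resum _ 0 M1 2 v HM1 ltac:(lra) H1 ltac:(lra)).
      rewrite bs_0, Cmult_1_l. intros E. unfold bs at 1. rewrite E.
      apply CSer_ext. intros n. now rewrite moebius_coef_rf. }
    rewrite E1. unfold hyp_ser.
    rewrite (moebius_resum _ a M2 2 v HM2 ltac:(lra) H2 ltac:(lra)).
    rewrite (CSer_ext _ (fun N => gauss_coef a b c N * v ^ N)%C)
      by (intros n; now rewrite moebius_coef_gauss).
    destruct (subexp_geom _ v (gauss_coef_subexp a b c Hc) Hv1) as [M' HM'].
    eapply CSer_correct; eauto.
Qed.

(** The involution w -> w / (w - 1) sends the argument back to xi. The choice operator in [hyp2F1]
    is resolved by existence, from the half-plane, together with uniqueness along the segment. *)
Lemma hyp2F1_pfaff (a b : C) (c xi : R) :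
  0 < c -> 0 < xi < 1 ->
  hyp2F1 a b c (RtoC (xi / (xi - 1))) = (bs (- a) xi * hyp_ser a (c - b) c xi)%C.
Proof.
  intros Hc Hxi.
  assert (Hw : xi / (xi - 1) < 0).
  { apply Ropp_lt_cancel. rewrite Ropp_0. replace (- (xi / (xi - 1))) with (xi / (1 - xi))
      by (field; lra). apply Rdiv_lt_0_compat; lra. }
  assert (H : hyp2F1_value a b c (RtoC (xi / (xi - 1))) (bs (- a) xi * hyp_ser a (c - b) c xi)%C).
  { generalize (hyp2F1_value_pfaff a b c (RtoC (xi / (xi - 1))) Hc).
    replace (RtoC (xi / (xi - 1)) / (RtoC (xi / (xi - 1)) - 1))%C with (RtoC xi).
    - intros K. apply K. simpl. lra.
    - rewrite <- RtoC_minus, <- RtoC_div.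
      + f_equal. field. split; [lra|]. replace (xi - (xi - 1)) with 1 by ring. lra.
      + lra. }
  apply (hyp2F1_value_unique a b c (RtoC (xi / (xi - 1)))); auto.
  - intros E. apply RtoC_inj in E. lra.
  - unfold hyp2F1. apply epsilon_spec. eexists; exact H.
Qed.

Lemma gauss_coef_sym (a b c : C) : gauss_coef a b c = gauss_coef b a c.
Proof.
  apply functional_extensionality. intros n. unfold gauss_coef. now rewrite (Cmult_comm (poch a n)).
Qed.

(** Pfaff's transformation singles out one numerator parameter; the symmetry allows either to be
    chosen. *)
Lemma hyp2F1_sym (a b c w : C) : hyp2F1 a b c w = hyp2F1 b a c w.
Proof. unfold hyp2F1, hyp2F1_value. now rewrite (gauss_coef_sym a b). Qed.

(** * Real exponents *)

Fixpoint rpoch (a : R) (n : nat) : R :=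
  match n with O => 1 | S m => rpoch a m * (a + INR m) end.

Lemma rf_RtoC (a : R) (n : nat) : rf a n = RtoC (rpoch a n / INR (fact n)).
Proof.
  unfold rf. rewrite RtoC_div by apply INR_fact_neq_0. f_equal.
  induction n; [reflexivity|]. simpl. rewrite IHn, RtoC_mult, RtoC_plus. reflexivity.
Qed.

Lemma csum_RtoC (g : nat -> R) (n : nat) :
  csum (fun i => RtoC (g i)) (S n) = RtoC (sum_n g n).
Proof.
  induction n; [rewrite sum_O; simpl; ring|].
  rewrite sum_Sn. change (Hierarchy.plus (sum_n g n) (g (S n))) with (sum_n g n + g (S n)).
  rewrite RtoC_plus, <- IHn. reflexivity.
Qed.

Lemma CV_radius_subexp (al : nat -> R) (x : R) :
  subexp (fun n => RtoC (al n)) -> Rabs x < 1 -> Rbar_lt (Rabs x) (CV_radius al).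
Proof.
  intros H Hx. assert (H0 := Rabs_pos x).
  assert (Hx' : Cmod (RtoC ((1 + Rabs x) / 2)) < 1) by (rewrite Cmod_RtoC_pos; lra).
  destruct (subexp_geom _ _ H Hx') as [M (HM & Hr & HMn)].
  apply Rbar_lt_le_trans with (Finite ((1 + Rabs x) / 2)); [change (Rabs x < (1 + Rabs x) / 2); lra|].
  destruct (CV_radius_bounded al) as [Hub _]. apply Hub.
  exists M. intros n.
  rewrite <- Cmod_R, RtoC_mult, RtoC_pow. eapply Rle_trans; [apply HMn|].
  rewrite <- (Rmult_1_r M) at 2. apply Rmult_le_compat_l; auto.
  eapply Rle_trans; [apply (pow_incr _ 1); lra|]. rewrite pow1; lra.
Qed.

Lemma bs_PSeries (a x : R) :
  Rabs x < 1 -> bs a x = RtoC (PSeries (fun n => rpoch a n / INR (fact n)) x).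
Proof.
  intros Hx. set (al := fun n => rpoch a n / INR (fact n)).
  assert (Hs : subexp (fun n => RtoC (al n))).
  { apply subexp_ext with (rf a); [intros; apply rf_RtoC|apply rf_subexp]. }
  assert (Hser := Series_correct _ (proj1 (ex_pseries_R _ _)
    (CV_disk_correct _ _ (CV_disk_inside _ _ (CV_radius_subexp al x Hs Hx))))).
  apply CSer_unique, (Clim_shift _ _ 1).
  apply Clim_ext with (fun n => RtoC (sum_n (fun k => al k * x ^ k) n)).
  - intros n. rewrite Nat.add_1_r, <- csum_RtoC. apply csum_ext. intros i _.
    rewrite rf_RtoC, RtoC_mult, RtoC_pow. reflexivity.
  - apply Clim_RtoC. exact Hser.
Qed.

(** The function [y = sum al_n x^n] solves [(1 - x) y' = a y]. *)
Lemma bs_real_power (a x : R) : 0 < x < 1 -> bs a x = RtoC (exp (- a * ln (1 - x))).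
Proof.
  intros Hx. rewrite bs_PSeries by (rewrite Rabs_pos_eq; lra). f_equal.
  set (al := fun n => rpoch a n / INR (fact n)).
  assert (Hs : subexp (fun n => RtoC (al n))).
  { apply subexp_ext with (rf a); [intros; apply rf_RtoC|apply rf_subexp]. }
  (* The series times (1 - t)^a has zero derivative by the differential equation, so it keeps its
     value 1 at t = 0. *)
  set (f := fun t => PSeries al t * exp (a * ln (1 - t))).
  assert (Hf : f 0 = f x).
  { apply (eq_is_derive f); [|lra].
    intros t Ht.
    assert (Hcv : Rbar_lt (Rabs t) (CV_radius al)).
    { apply CV_radius_subexp; auto. rewrite Rabs_pos_eq; lra. }
    assert (Hcv' : Rbar_lt (Rabs t) (CV_radius (PS_derive al))) by now rewrite CV_radius_derive.
    assert (Hd := is_derive_PSeries al t Hcv).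
    assert (Hode : PSeries (PS_derive al) t = a * PSeries al t + t * PSeries (PS_derive al) t).
    { rewrite <- PSeries_scal, <- PSeries_incr_1, <- PSeries_plus.
      - apply PSeries_ext. intros n. unfold PS_plus, PS_scal, PS_derive, PS_incr_1.
        destruct n as [|n].
        + unfold al. simpl. change (Hierarchy.plus (scal a (1 / 1)) zero) with (a * (1 / 1) + 0). field.
        + change (Hierarchy.plus (scal a (al (S n))) (INR (S n) * al (S n)))
            with (a * al (S n) + INR (S n) * al (S n)).
          unfold al. rewrite (fact_simpl (S n)), mult_INR.
          change (rpoch a (S (S n))) with (rpoch a (S n) * (a + INR (S n))).
          field. split; [apply INR_fact_neq_0|]. apply not_0_INR. lia.
      - apply ex_pseries_scal; [apply Rmult_comm|]. now apply CV_disk_correct, CV_disk_inside.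
      - apply ex_pseries_incr_1. now apply CV_disk_correct, CV_disk_inside. }
    unfold f.
    evar_last.
    { apply (is_derive_mult (PSeries al) (fun t => exp (a * ln (1 - t)))); [exact Hd| |].
      - auto_derive; [lra|reflexivity].
      - intros; apply Rmult_comm. }
    change (PSeries (PS_derive al) t * exp (a * ln (1 - t))
      + PSeries al t * (a * (- (1) * / (1 - t)) * exp (a * ln (1 - t))) = 0).
    replace (PSeries (PS_derive al) t) with (a * PSeries al t / (1 - t)).
    - field. lra.
    - apply Rmult_eq_reg_r with (1 - t); [|lra]. unfold Rdiv.
      rewrite Rmult_assoc, Rinv_l by lra. lra. }
  unfold f in Hf. rewrite PSeries_0, Rminus_0_r, ln_1, Rmult_0_r, exp_0 in Hf.
  replace (al O) with 1 in Hf by (unfold al; simpl; field).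
  replace (- a * ln (1 - x)) with (- (a * ln (1 - x))) by ring.
  rewrite exp_Ropp. apply Rmult_eq_reg_r with (exp (a * ln (1 - x))).
  - rewrite <- Hf, Rinv_l; [ring|]. apply Rgt_not_eq, exp_pos.
  - apply Rgt_not_eq, exp_pos.
Qed.

Lemma Cpower_RtoC (x s : R) : Cpower x s = RtoC (exp (s * ln x)).
Proof.
  unfold Cpower, Cexp. rewrite <- RtoC_mult. simpl. rewrite cos_0, sin_0.
  unfold RtoC. f_equal; ring.
Qed.

Lemma Cpower_bs (x s : R) : 0 < x < 1 -> Cpower (1 - x) s = bs (- s) x.
Proof.
  intros Hx. rewrite Cpower_RtoC, <- RtoC_opp, bs_real_power by auto. do 3 f_equal. ring.
Qed.

(** * Partial fractions in [u] *)

(** The coefficient of x^n in the product of sum_m [rf al m] x^m / (u + m + 1) and (1 - x)^(-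
    be). *)
Definition pf_sum (al be u : C) (n : nat) : C :=
  csum (fun m => rf al m * rf be (n - m) / (u + INR m + 1))%C (S n).

(** Write u + n + 2 = (u + m + 1) + (n + 1 - m). The first part cancels the denominator and leaves a
    Vandermonde sum; the second lowers the index of [rf be], and the resulting factor be + n - m is
    split off u + m + 1 once more. *)
Lemma pf_sum_S (al be u : C) (n : nat) :
  (forall m, (u + INR m + 1)%C <> 0%C) ->
  ((u + INR n + 2) * pf_sum al be u (S n)
  = rf (al + be) (S n) - rf (al + be) n + (be + INR n + u + 1) * pf_sum al be u n)%C.
Proof.
  intros Hu. unfold pf_sum. rewrite <- csum_scal.
  transitivity (conv (rf al) (rf be) (S n)
    + csum (fun m => INR (S n - m) * rf be (S n - m) * rf al m / (u + INR m + 1)) (S (S n)))%C.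
  { unfold conv. rewrite <- csum_plus. apply csum_ext. intros m Hm.
    rewrite minus_INR, RtoC_minus, RtoC_INR_S by lia.
    field. apply Hu. }
  rewrite rf_vandermonde.
  change (csum (fun m => INR (S n - m) * rf be (S n - m) * rf al m / (u + INR m + 1)) (S (S n)))%C
    with (csum (fun m => INR (S n - m) * rf be (S n - m) * rf al m / (u + INR m + 1)) (S n)
      + INR (S n - S n) * rf be (S n - S n) * rf al (S n) / (u + INR (S n) + 1))%C.
  rewrite Nat.sub_diag. change (INR 0) with 0.
  rewrite (csum_ext _ (fun m => - (1) * (rf al m * rf be (n - m)%nat)
    + (be + INR n + u + 1) * (rf al m * rf be (n - m)%nat / (u + INR m + 1)))%C).
  2:{ intros m Hm. replace (S n - m)%nat with (S (n - m)) by lia.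
      rewrite RtoC_INR_S, rf_S, minus_INR, RtoC_minus by lia. field. apply Hu. }
  rewrite csum_plus, !csum_scal.
  change (csum (fun m => rf al m * rf be (n - m)%nat)%C (S n)) with (conv (rf al) (rf be) n).
  rewrite rf_vandermonde. unfold Cdiv. ring.
Qed.

Lemma pf_neq_0 (u : R) (m : nat) : -1 < u -> (RtoC u + INR m + 1)%C <> 0%C.
Proof.
  intros Hu E. rewrite <- !RtoC_plus in E. apply RtoC_inj in E. generalize (pos_INR m); lra.
Qed.

Lemma poch_ratio_neq_0 (u : R) (n : nat) : -1 < u -> poch (u + 1) n <> 0%C.
Proof. intros Hu. rewrite <- RtoC_plus. apply poch_pos_neq_0. lra. Qed.

Lemma rf_1 (n : nat) : rf 1 n = 1%C.
Proof. unfold rf. rewrite poch_1. field. apply RtoC_INR_fact_neq_0. Qed.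

Lemma rf_2 (n : nat) : rf 2 n = (INR n + 1)%C.
Proof.
  replace (RtoC 2) with (1 + 1)%C by ring.
  induction n; [rewrite rf_0; simpl; ring|].
  rewrite rf_pascal, IHn, rf_1, RtoC_INR_S. ring.
Qed.

(** The two parameters add to 1, which makes the inhomogeneous term [rf 1 (S n) - rf 1 n] of
    [pf_sum_S] vanish; both sides satisfy the same homogeneous first-order recurrence. *)
Lemma pf_simple (z' : C) (u : R) (n : nat) :
  -1 < u -> (poch (u + 1 + z') n / poch (u + 1) (S n))%C = pf_sum (1 - z') z' u n.
Proof.
  intros Hu. induction n.
  - unfold pf_sum. simpl. rewrite !rf_0. field.
    generalize (pf_neq_0 u 0 Hu). simpl. rewrite Cplus_0_r. auto.
  - assert (Hn : (u + INR n + 2)%C <> 0%C).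
    { generalize (pf_neq_0 u (S n) Hu). rewrite RtoC_INR_S.
      intros H E. apply H. rewrite <- E. ring. }
    assert (E := pf_sum_S (1 - z') z' u n (fun m => pf_neq_0 u m Hu)).
    replace (1 - z' + z')%C with (RtoC 1) in E by ring. rewrite !rf_1, <- IHn in E.
    replace (pf_sum (1 - z') z' u (S n))
      with (((u + INR n + 2) * pf_sum (1 - z') z' u (S n)) / (u + INR n + 2))%C by (field; auto).
    rewrite E. generalize (poch_ratio_neq_0 u (S n) Hu). intros Hp.
    change (poch (u + 1 + z') (S n)) with (poch (u + 1 + z') n * (u + 1 + z' + INR n))%C.
    change (poch (u + 1) (S (S n))) with (poch (u + 1) (S n) * (u + 1 + INR (S n)))%C.
    rewrite RtoC_INR_S. field. repeat split; auto.
Qed.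

(** The two parameters add to 2, so the inhomogeneous term of [pf_sum_S] equals 1. It accounts for
    the constant 1, the value at infinity of a quotient of polynomials of equal degree in u. *)
Lemma pf_double (z' : C) (u : R) (n : nat) :
  -1 < u -> (poch (u + 1 + z') (S n) / poch (u + 1) (S n))%C
    = (1 + z' * pf_sum (1 - z') (1 + z') u n)%C.
Proof.
  intros Hu. induction n.
  - unfold pf_sum. simpl. rewrite !rf_0. field.
    generalize (pf_neq_0 u 0 Hu). simpl. rewrite Cplus_0_r. auto.
  - assert (Hn : (u + INR n + 2)%C <> 0%C).
    { generalize (pf_neq_0 u (S n) Hu). rewrite RtoC_INR_S.
      intros H E. apply H. rewrite <- E. ring. }
    assert (E := pf_sum_S (1 - z') (1 + z') u n (fun m => pf_neq_0 u m Hu)).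
    replace (1 - z' + (1 + z'))%C with (RtoC 2) in E by ring. rewrite !rf_2, RtoC_INR_S in E.
    replace (pf_sum (1 - z') (1 + z') u (S n))
      with (((u + INR n + 2) * pf_sum (1 - z') (1 + z') u (S n)) / (u + INR n + 2))%C
      by (field; auto).
    rewrite E.
    replace (1 + z' * ((INR n + 1 + 1 - (INR n + 1)
      + (1 + z' + INR n + u + 1) * pf_sum (1 - z') (1 + z') u n) / (u + INR n + 2)))%C
      with ((z' + INR n + u + 2) * (1 + z' * pf_sum (1 - z') (1 + z') u n) / (u + INR n + 2))%C
      by (field; auto).
    rewrite <- IHn. generalize (poch_ratio_neq_0 u (S n) Hu). intros Hp.
    change (poch (u + 1 + z') (S (S n)))
      with (poch (u + 1 + z') (S n) * (u + 1 + z' + INR (S n)))%C.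
    change (poch (u + 1) (S (S n))) with (poch (u + 1) (S n) * (u + 1 + INR (S n)))%C.
    rewrite RtoC_INR_S. field. repeat split; auto.
Qed.

(** [pf_term] is the residue at [u = - m - 1], up to sign, of the resummed series. *)
Definition pf_term (z al be : C) (c xi : R) (m : nat) : C :=
  (poch (1 - z) m / poch c m * rf al m * xi ^ m
   * hyp_ser be (1 - z + INR m) (c + INR m) xi)%C.

Lemma Cmod_inv_pf (u : R) (m : nat) : -1 < u -> Cmod (/ (u + INR m + 1)) <= / (u + 1).
Proof.
  intros Hu. rewrite Cmod_inv by now apply pf_neq_0. rewrite <- !RtoC_plus.
  assert (Hm := pos_INR m). rewrite Cmod_RtoC_pos by lra.
  apply Rinv_le_contravar; lra.
Qed.

(** The sum over n of finite partial fractions is rearranged so that each pole collects its whole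
    residue. The bound on the residues is the same for all u. *)
Lemma pf_resum (z al be : C) (c xi : R) :
  0 < c -> 0 < xi < 1 ->
  exists M r, geom (pf_term z al be c xi) M r /\
    forall u : R, -1 < u ->
    Csums (fun n => poch (1 - z) n / poch c n * pf_sum al be u n * xi ^ n)%C
      (CSer (fun m => pf_term z al be c xi m / (u + INR m + 1))%C).
Proof.
  intros Hc Hxi. set (A := fun n => (poch (1 - z) n / poch c n)%C).
  (* The three coefficient sequences contribute q^(m + i), q^m and q^i, together q^(2 (m + i)); with
     this q the rate q^2 xi = 2 xi / (1 + xi) is below 1. *)
  set (q := sqrt (2 / (1 + xi))).
  assert (Hq1 : 1 < 2 / (1 + xi)).
  { apply Rmult_lt_reg_r with (1 + xi); [lra|].
    unfold Rdiv. rewrite Rmult_assoc, Rinv_l by lra. lra. }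
  assert (Hq : 1 < q) by (unfold q; rewrite <- sqrt_1 at 1; apply sqrt_lt_1; lra).
  assert (Hqq : q * q = 2 / (1 + xi)) by (unfold q; apply sqrt_def; lra).
  set (r := q * q * xi).
  assert (Hr : 0 <= r < 1).
  { unfold r. rewrite Hqq. split; [apply Rmult_le_pos; lra|].
    apply Rmult_lt_reg_r with (1 + xi); [lra|].
    replace (2 / (1 + xi) * xi * (1 + xi)) with (2 * xi) by (field; lra). lra. }
  destruct (poch_ratio_subexp (1 - z) c Hc q Hq) as (M1 & HM1 & H1).
  destruct (rf_subexp al q Hq) as (M2 & HM2 & H2).
  destruct (rf_subexp be q Hq) as (M3 & HM3 & H3).
  set (M := M1 * M2 * M3). assert (HM : 0 <= M) by (unfold M; repeat apply Rmult_le_pos; auto).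
  set (c0 := fun m i => (A (m + i)%nat * rf al m * rf be i * xi ^ (m + i))%C).
  assert (Hc0 : geom2 c0 M r).
  { split; auto. split; auto. intros m i. unfold c0. rewrite !Cmod_mult, Cmod_pow.
    rewrite Cmod_RtoC_pos by lra.
    apply Rle_trans with ((M1 * q ^ (m + i)) * (M2 * q ^ m) * (M3 * q ^ i) * xi ^ (m + i)).
    - apply Rmult_le_compat_r; [apply pow_le; lra|].
      apply Rmult_le_compat; auto; try apply Cmod_ge_0.
      + apply Rmult_le_pos; apply Cmod_ge_0.
      + apply Rmult_le_compat; auto; try apply Cmod_ge_0. apply H1.
    - right. unfold r, M. rewrite !pow_add, !Rpow_mult_distr. ring. }
  assert (Hrow : forall m, CSer (c0 m) = pf_term z al be c xi m).
  { intros m. unfold c0, pf_term, hyp_ser.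
    assert (Hg : subexp (gauss_coef be (1 - z + INR m) (c + INR m))).
    { rewrite <- RtoC_plus. apply gauss_coef_subexp. generalize (pos_INR m); lra. }
    destruct (subexp_geom _ (RtoC xi) Hg) as [M4 HM4]; [rewrite Cmod_RtoC_pos; lra|].
    rewrite <- (CSer_scal _ _ _ _ HM4). apply CSer_ext. intros i.
    unfold A. rewrite !poch_add, Cpow_add_r. unfold gauss_coef, rf at 2.
    field. repeat split; try apply RtoC_INR_fact_neq_0.
    - rewrite <- RtoC_plus. apply poch_pos_neq_0. generalize (pos_INR m); lra.
    - now apply poch_pos_neq_0. }
  exists (M / (1 - r)), r. split.
  { destruct (geom2_sum _ _ _ Hc0) as (G1 & G2 & G3). split; auto. split; auto.
    intros m. rewrite <- Hrow. apply G3. }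
  intros u Hu.
  set (cu := fun m i => (/ (u + INR m + 1) * c0 m i)%C).
  assert (Hiu : 0 < / (u + 1)) by (apply Rinv_0_lt_compat; lra).
  assert (Hcu : geom2 cu (/ (u + 1) * M) r).
  { split; [apply Rmult_le_pos; lra|]. split; auto. intros m i. unfold cu.
    rewrite Cmod_mult, !Rmult_assoc.
    apply Rmult_le_compat; try apply Cmod_ge_0; [now apply Cmod_inv_pf|].
    rewrite <- Rmult_assoc. apply Hc0. }
  assert (E : forall n, csum (fun m => cu m (n - m)%nat) (S n)
    = (A n * pf_sum al be u n * xi ^ n)%C).
  { intros n. unfold pf_sum.
    replace (A n * csum (fun m => rf al m * rf be (n - m)%nat / (u + INR m + 1)) (S n)
      * xi ^ n)%C with ((A n * xi ^ n)
        * csum (fun m => rf al m * rf be (n - m)%nat / (u + INR m + 1)) (S n))%C by ring.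
    rewrite <- csum_scal. apply csum_ext. intros m Hm. unfold cu, c0.
    replace (m + (n - m))%nat with n by lia. unfold Cdiv. ring. }
  eapply Csums_ext; [exact E|].
  rewrite (CSer_ext _ (fun m => CSer (cu m))); [exact (CSer_diag _ _ _ Hcu)|].
  intros m. unfold cu. rewrite (CSer_scal _ _ _ _ (geom2_row _ _ _ m Hc0)), Hrow.
  unfold Cdiv. ring.
Qed.

(** [Pfun = psi ^ (1/2) hypP], [Qfun = psi ^ (1/2) hypQ], and [psi_int] is [psi] on [Z_+];
    [tau] stands for [t ^ (1/2)]. *)
Definition hypP (z z' : C) (xi : R) (u : R) : C :=
  hyp2F1 (- z) (- z') (u + 1) (RtoC (xi / (xi - 1))).

Definition hypQ (tau z z' : C) (xi : R) (u : R) : C :=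
  (tau * sqrt xi / (1 - xi)
   * (hyp2F1 (1 - z) (1 - z') (u + 2) (RtoC (xi / (xi - 1))) / (u + 1)))%C.

Definition psi_int (tau z z' : C) (xi : R) (k : nat) : C :=
  (tau * sqrt xi * xi ^ k * bs (- (z + z')) xi * (rf (1 + z) k * rf (1 + z') k))%C.

Lemma RtoC_one_minus_neq_0 (xi : R) : 0 < xi < 1 -> (1 - RtoC xi)%C <> 0%C.
Proof. intros Hxi. apply one_minus_neq_0. rewrite Cmod_RtoC_pos; lra. Qed.

Lemma RtoC_sqrt_sqr (xi : R) : 0 <= xi -> (RtoC (sqrt xi) * RtoC (sqrt xi))%C = xi.
Proof. intros H. rewrite <- RtoC_mult, sqrt_def; auto. Qed.

Lemma bs_succ (a : C) (xi : R) : 0 < xi < 1 -> bs (a - 1) xi = (bs a xi * (1 - xi))%C.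
Proof.
  intros Hxi. rewrite <- bs_m1, bs_mult; [reflexivity|]. rewrite Cmod_RtoC_pos; lra.
Qed.

(** The numerator parameters are exchanged before Pfaff's transformation, so that the power of 1 -
    xi it produces removes the z' part of the factor (1 - xi)^(-(z + z')) in [psi_int] and leaves
    [bs z xi]. The denominator m + 1 of [hypQ] is absorbed by (2)_m = (m + 1)!. *)
Lemma psi_hypQ_int (tau z z' : C) (xi : R) (m : nat) :
  0 < xi < 1 -> (tau * tau)%C = (z * z')%C ->
  (psi_int tau (- z) (- z') xi m * hypQ tau (- z) (- z') xi (INR m))%C
  = (z * z' * xi * bs z xi * pf_term z (1 - z') (1 + z') 2 xi m)%C.
Proof.
  intros Hxi Htau. unfold psi_int, hypQ, pf_term.
  assert (Hx1 : Cmod xi < 1) by (rewrite Cmod_RtoC_pos; lra).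
  assert (Hm := pos_INR m).
  rewrite hyp2F1_sym, <- RtoC_plus, hyp2F1_pfaff by lra.
  replace (- (1 - - z'))%C with (- z' - 1)%C by ring.
  rewrite bs_succ by auto.
  replace (RtoC (INR m + 2) - (1 - - z))%C with (1 - z + INR m)%C by (rewrite RtoC_plus; ring).
  replace (1 - - z')%C with (1 + z')%C by ring.
  replace (RtoC (INR m + 2)) with (2 + INR m)%C by (rewrite RtoC_plus; ring).
  replace (- (- z + - z'))%C with (z + z')%C by ring.
  rewrite <- bs_mult by auto.
  transitivity (tau * tau * (sqrt xi * sqrt xi) * xi ^ m * bs z xi * (bs z' xi * bs (- z') xi)
    * (rf (1 + - z) m / (INR m + 1)) * rf (1 + - z') m
    * hyp_ser (1 + z') (1 - z + INR m) (2 + INR m) xi)%C.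
  - field. split; [|now apply RtoC_one_minus_neq_0].
    rewrite <- RtoC_plus. intros E0. apply RtoC_inj in E0. lra.
  - rewrite Htau, RtoC_sqrt_sqr, bs_inv by (auto; lra).
    unfold rf at 1.
    assert (E2 : poch 2 m = (INR (fact m) * (INR m + 1))%C).
    { rewrite <- RtoC_fact_S, <- poch_1, poch_Sl, Cmult_1_l. f_equal. ring. }
    rewrite E2. replace (1 + - z)%C with (1 - z)%C by ring.
    replace (1 + - z')%C with (1 - z')%C by ring.
    field. split; [|apply RtoC_INR_fact_neq_0].
    rewrite <- RtoC_plus. intros E0. apply RtoC_inj in E0. lra.
Qed.

Lemma psi_hypP_int (tau z z' : C) (xi : R) (m : nat) :
  0 < xi < 1 ->
  (psi_int tau (- z) (- z') xi m * hypP (- z) (- z') xi (INR m))%C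
  = (tau * sqrt xi * bs z xi * pf_term z (1 - z') z' 1 xi m)%C.
Proof.
  intros Hxi. unfold psi_int, hypP, pf_term.
  assert (Hx1 : Cmod xi < 1) by (rewrite Cmod_RtoC_pos; lra).
  assert (Hm := pos_INR m).
  rewrite hyp2F1_sym, <- RtoC_plus, hyp2F1_pfaff by lra.
  replace (- - - z')%C with (- z')%C by ring.
  replace (RtoC (INR m + 1) - - - z)%C with (1 - z + INR m)%C by (rewrite RtoC_plus; ring).
  replace (- - z')%C with z' by ring.
  replace (RtoC (INR m + 1)) with (1 + INR m)%C by (rewrite RtoC_plus; ring).
  replace (- (- z + - z'))%C with (z + z')%C by ring.
  rewrite <- bs_mult by auto.
  transitivity (tau * sqrt xi * xi ^ m * bs z xi * (bs z' xi * bs (- z') xi)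
    * rf (1 + - z) m * rf (1 + - z') m
    * hyp_ser z' (1 - z + INR m) (1 + INR m) xi)%C.
  - ring.
  - rewrite bs_inv by auto. rewrite poch_1. unfold rf at 1.
    replace (1 + - z)%C with (1 - z)%C by ring.
    replace (1 + - z')%C with (1 - z')%C by ring. unfold Cdiv. ring.
Qed.

Lemma geom_div_pf (a : nat -> C) (M r u : R) :
  -1 < u -> geom a M r -> geom (fun m => a m / (u + INR m + 1))%C (/ (u + 1) * M) r.
Proof.
  intros Hu Ha.
  destruct (geom_bounded_mult (fun m => / (u + INR m + 1))%C a (/ (u + 1)) M r) as (H1 & H2 & H3).
  - intros m. now apply Cmod_inv_pf.
  - exact Ha.
  - split; auto. split; auto. intros n. unfold Cdiv. rewrite Cmult_comm. auto.
Qed.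

(** Pfaff's transformation of [hypQ] produces the coefficients (1 - z)_n / n! times (u + 1 + z')_n /
    (u + 1)_(n + 1); [pf_simple] expands the second quotient, and [psi_hypP_int] recognises the
    residues. *)
Lemma hypQ_expansion (tau z z' : C) (xi : R) :
  0 < xi < 1 ->
  exists M r, geom (fun m => psi_int tau (- z) (- z') xi m * hypP (- z) (- z') xi (INR m))%C M r /\
    forall u, -1 < u -> hypQ tau z z' xi u
      = CSer (fun m => psi_int tau (- z) (- z') xi m * hypP (- z) (- z') xi (INR m)
                       / (u + INR m + 1))%C.
Proof.
  intros Hxi.
  destruct (pf_resum z (1 - z') z' 1 xi ltac:(lra) Hxi) as (M & r & Hg & Hsum).
  exists (Cmod (tau * sqrt xi * bs z xi) * M), r. split.
  - destruct (geom_scal (tau * sqrt xi * bs z xi) _ _ _ Hg) as (H1 & H2 & H3).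
    split; auto. split; auto. intros n. rewrite psi_hypP_int by auto. auto.
  - intros u Hu.
    rewrite (CSer_ext _ (fun m => (tau * sqrt xi * bs z xi)
      * (pf_term z (1 - z') z' 1 xi m / (u + INR m + 1)))%C).
    2:{ intros m. rewrite psi_hypP_int by auto. unfold Cdiv. ring. }
    rewrite (CSer_scal _ _ _ _ (geom_div_pf _ _ _ u Hu Hg)).
    rewrite <- (CSer_unique _ _ (Hsum u Hu)).
    unfold hypQ. rewrite <- !RtoC_plus, hyp2F1_pfaff by lra.
    replace (- (1 - z))%C with (z - 1)%C by ring. rewrite bs_succ by auto.
    assert (Hs := gauss_coef_subexp (1 - z) (u + 1 + z') (u + 2) ltac:(lra)).
    assert (Hx1 : Cmod xi < 1) by (rewrite Cmod_RtoC_pos; lra).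
    destruct (subexp_geom _ xi Hs Hx1) as [M' HM'].
    assert (Hu1 : (RtoC u + 1)%C <> 0%C).
    { generalize (pf_neq_0 u 0 Hu). simpl. rewrite Cplus_0_r. auto. }
    replace (RtoC (u + 2) - (1 - z'))%C with (u + 1 + z')%C by (rewrite RtoC_plus; ring).
    rewrite (CSer_ext (fun n => poch (1 - z) n / poch 1 n * pf_sum (1 - z') z' u n * xi ^ n)%C
      (fun n => / (u + 1) * (gauss_coef (1 - z) (u + 1 + z') (RtoC (u + 2)) n * xi ^ n))%C).
    + rewrite (CSer_scal _ _ _ _ HM'). unfold hyp_ser. rewrite !RtoC_plus.
      field. split; [auto|now apply RtoC_one_minus_neq_0].
    + intros n. rewrite <- pf_simple by auto. rewrite (poch_Sl (u + 1)), poch_1.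
      unfold gauss_coef. replace (RtoC (u + 2)) with (u + 1 + 1)%C by (rewrite RtoC_plus; ring).
      field. repeat split; auto; [apply RtoC_INR_fact_neq_0|].
      rewrite <- !RtoC_plus. apply poch_pos_neq_0. lra.
Qed.

Lemma hypP_expansion (tau z z' : C) (xi : R) :
  0 < xi < 1 -> (tau * tau)%C = (z * z')%C ->
  exists M r, geom (fun m => psi_int tau (- z) (- z') xi m * hypQ tau (- z) (- z') xi (INR m))%C M r /\
    forall u, -1 < u -> hypP z z' xi u
      = (1 - CSer (fun m => psi_int tau (- z) (- z') xi m * hypQ tau (- z) (- z') xi (INR m)
                       / (u + INR m + 1)))%C.
Proof.
  intros Hxi Htau.
  destruct (pf_resum z (1 - z') (1 + z') 2 xi ltac:(lra) Hxi) as (M & r & Hg & Hsum).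
  set (k := (z * z' * xi * bs z xi)%C).
  exists (Cmod k * M), r. split.
  - destruct (geom_scal k _ _ _ Hg) as (H1 & H2 & H3).
    split; auto. split; auto. intros n. rewrite psi_hypQ_int by auto. apply H3.
  - intros u Hu.
    rewrite (CSer_ext _ (fun m => k
      * (pf_term z (1 - z') (1 + z') 2 xi m / (u + INR m + 1)))%C).
    2:{ intros m. rewrite psi_hypQ_int by auto. unfold Cdiv, k. ring. }
    rewrite (CSer_scal _ _ _ _ (geom_div_pf _ _ _ u Hu Hg)).
    unfold hypP. rewrite <- RtoC_plus, hyp2F1_pfaff by lra.
    assert (Hs := gauss_coef_subexp (- z) (u + 1 + z') (u + 1) ltac:(lra)).
    assert (Hx1 : Cmod xi < 1) by (rewrite Cmod_RtoC_pos; lra).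
    destruct (subexp_geom _ xi Hs Hx1) as [M' HM'].
    destruct (subexp_geom _ xi (rf_subexp (- z)) Hx1) as [M2 HM2].
    replace (RtoC (u + 1) - - z')%C with (u + 1 + z')%C by (rewrite RtoC_plus; ring).
    replace (- - z)%C with z by ring.
    (* [pf_double] treats the coefficient of index n + 1, so the term of index 0 is split off. The
       constants 1 of the partial fractions build up the binomial series (1 - xi)^z, which the
       prefactor [bs z xi] turns into the 1 of the conclusion. *)
    assert (E : hyp_ser (- z) (u + 1 + z') (RtoC (u + 1)) xi = (bs (- z) xi - z * z' * xi
      * CSer (fun m => pf_term z (1 - z') (1 + z') 2 xi m / (u + INR m + 1)))%C).
    { unfold hyp_ser, bs. rewrite (CSer_S _ _ _ HM'), (CSer_S _ _ _ HM2).
      replace (gauss_coef (- z) (u + 1 + z') (RtoC (u + 1)) 0) with (RtoC 1)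
        by (unfold gauss_coef; simpl; field).
      rewrite rf_0.
      replace (CSer (fun n => gauss_coef (- z) (u + 1 + z') (RtoC (u + 1)) (S n) * xi ^ S n)%C)
        with (CSer (fun n => rf (- z) (S n) * xi ^ S n)%C + - (z * z' * xi)
          * CSer (fun m => pf_term z (1 - z') (1 + z') 2 xi m / (u + INR m + 1)))%C.
      - ring.
      - symmetry. apply CSer_unique.
        eapply Csums_ext; [|apply (Csums_plus (fun n => rf (- z) (S n) * xi ^ S n)%C);
          [|apply Csums_scal, (Hsum u Hu)]].
        + intros n. cbv beta.
          transitivity (rf (- z) (S n) * xi ^ S n
            * (1 + z' * pf_sum (1 - z') (1 + z') u n))%C.
          * assert (E2 : poch 2 n = INR (fact (S n))).
            { rewrite <- poch_1, poch_Sl, Cmult_1_l. f_equal. ring. }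
            rewrite E2. unfold rf. rewrite (poch_Sl (- z)).
            replace (- z + 1)%C with (1 - z)%C by ring. rewrite Cpow_S.
            field. apply RtoC_INR_fact_neq_0.
          * rewrite <- pf_double by auto. unfold rf, gauss_coef. rewrite RtoC_plus.
            field. split; [apply RtoC_INR_fact_neq_0|]. now apply poch_ratio_neq_0.
        + destruct HM2 as (G1 & G2 & G3).
          eapply CSer_correct with (r := 2 * Cmod xi / (1 + Cmod xi)).
          split; [|split; [exact G2|]].
          2:{ intros n. eapply Rle_trans; [apply (G3 (S n))|]. simpl.
              rewrite <- Rmult_assoc. right; reflexivity. }
          apply Rmult_le_pos; lra. }
    rewrite E. unfold k.
    replace (bs z xi * (bs (- z) xi - z * z' * xi
      * CSer (fun m => pf_term z (1 - z') (1 + z') 2 xi m / (u + INR m + 1))))%C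
      with (bs z xi * bs (- z) xi - z * z' * xi * bs z xi
      * CSer (fun m => pf_term z (1 - z') (1 + z') 2 xi m / (u + INR m + 1)))%C by ring.
    rewrite bs_inv by auto. reflexivity.
Qed.

Lemma psi_int_geom (tau z z' : C) (xi : R) :
  0 < xi < 1 -> exists M r, geom (psi_int tau z z' xi) M r.
Proof.
  intros Hxi.
  assert (Hx1 : Cmod xi < 1) by (rewrite Cmod_RtoC_pos; lra).
  destruct (subexp_geom _ xi (subexp_mult _ _ (rf_subexp (1 + z)) (rf_subexp (1 + z'))) Hx1)
    as [M HM].
  destruct (geom_scal (tau * sqrt xi * bs (- (z + z')) xi) _ _ _ HM) as (H1 & H2 & H3).
  do 2 eexists. split; [exact H1|]. split; [exact H2|].
  intros n. unfold psi_int. eapply Rle_trans; [|apply (H3 n)].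
  right. f_equal. ring.
Qed.

(** * The Gamma function *)

Lemma exp_quadratic (x : R) : Rabs x <= 1 / 2 -> Rabs (exp x - 1 - x) <= 2 * x ^ 2.
Proof.
  intros Hx. apply Rabs_le_between in Hx.
  assert (H1 := exp_ineq1_le x). assert (H2 := exp_ineq1_le (- x)).
  assert (Hp := exp_pos x). rewrite exp_Ropp in H2.
  assert (H3 : exp x * (1 - x) <= 1).
  { apply Rle_trans with (exp x * / exp x); [apply Rmult_le_compat_l; lra|].
    rewrite Rinv_r; lra. }
  rewrite Rabs_pos_eq by lra. nra.
Qed.

Lemma Rabs_sin_le (y : R) : Rabs (sin y) <= Rabs y.
Proof.
  destruct (MVT_gen sin 0 y cos) as (c & _ & Hc).
  - intros; apply is_derive_sin.
  - intros; apply continuity_sin.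
  - rewrite sin_0, !Rminus_0_r in Hc. rewrite Hc, Rabs_mult.
    assert (Rabs (cos c) <= 1) by (apply Rabs_le; generalize (COS_bound c); lra).
    generalize (Rabs_pos y). nra.
Qed.

Lemma cos_quadratic (y : R) : 0 <= 1 - cos y <= y ^ 2 / 2.
Proof.
  replace y with (2 * (y / 2)) at 1 2 by field. rewrite cos_2a_sin.
  assert (H := Rabs_sin_le (y / 2)).
  assert (H2 : sin (y / 2) ^ 2 <= (y / 2) ^ 2).
  { rewrite <- (pow2_abs (sin (y / 2))), <- (pow2_abs (y / 2)).
    apply pow_incr. split; [apply Rabs_pos|auto]. }
  split; [generalize (pow2_ge_0 (sin (y / 2))); lra|lra].
Qed.

Lemma sin_cubic (y : R) : Rabs (sin y - y) <= Rabs y * (y ^ 2 / 2).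
Proof.
  destruct (MVT_gen (fun y => sin y - y) 0 y (fun y => cos y - 1)) as (c & Hc1 & Hc).
  - intros; auto_derive; auto; ring.
  - intros x _. apply derivable_continuous_pt. reg.
  - rewrite sin_0, !Rminus_0_r in Hc. rewrite Hc, Rabs_mult, Rmult_comm.
    apply Rmult_le_compat_l; [apply Rabs_pos|].
    destruct (cos_quadratic c) as [H1 H2]. rewrite Rabs_minus_sym, Rabs_pos_eq by lra.
    assert (c ^ 2 <= y ^ 2); [|lra].
    destruct (Rle_dec 0 y).
    + rewrite Rmin_left, Rmax_right in Hc1 by lra. nra.
    + rewrite Rmin_right, Rmax_left in Hc1 by lra. nra.
Qed.

Lemma Cexp_quadratic (w : C) : Cmod w <= 1 / 2 -> Cmod (Cexp w - 1 - w) <= 3 * Cmod w ^ 2.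
Proof.
  intros Hw. assert (Hx := Rle_trans _ _ _ (re_le_Cmod w) Hw).
  assert (Hy := Rle_trans _ _ _ (Cmod_im_le w) Hw).
  rewrite Cmod2_alt. eapply Rle_trans; [apply Cmod_le_Re_Im|].
  destruct w as [x y]. unfold Cexp in *. simpl Re in *. simpl Im in *.
  assert (E1 := exp_quadratic x Hx). assert (C1 := cos_quadratic y).
  assert (S1 := Rabs_sin_le y). assert (S2 := sin_cubic y).
  assert (Hex : Rabs (exp x - 1) <= 2 * Rabs x).
  { replace (exp x - 1) with ((exp x - 1 - x) + x) by ring.
    eapply Rle_trans; [apply Rabs_triang|]. rewrite <- pow2_abs in E1.
    generalize (Rabs_pos x). nra. }
  assert (Hex2 : 0 < exp x <= 2).
  { split; [apply exp_pos|]. apply Rabs_le_between in Hex.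
    apply Rabs_le_between in Hx. generalize (Rabs_pos x).
    assert (Rabs x <= 1 / 2) by (apply Rabs_le; lra). lra. }
  assert (HRe : Rabs (exp x * cos y + - (1) + - x) <= 2 * x ^ 2 + y ^ 2).
  { replace (exp x * cos y + - (1) + - x) with ((exp x - 1 - x) - exp x * (1 - cos y)) by ring.
    eapply Rle_trans; [apply Rabs_triang|]. rewrite Rabs_Ropp, (Rabs_pos_eq (exp x * _)) by nra.
    nra. }
  assert (HIm : Rabs (exp x * sin y + - 0 + - y) <= 2 * Rabs x * Rabs y + y ^ 2).
  { replace (exp x * sin y + - 0 + - y) with ((exp x - 1) * sin y + (sin y - y)) by ring.
    eapply Rle_trans; [apply Rabs_triang|]. rewrite Rabs_mult.
    apply Rplus_le_compat.
    - apply Rmult_le_compat; auto; apply Rabs_pos.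
    - eapply Rle_trans; [exact S2|]. generalize (pow2_ge_0 y). nra. }
  generalize (pow2_abs x) (pow2_abs y) (pow2_ge_0 (Rabs x - Rabs y)). nra.
Qed.

Lemma Cexp_plus (a b : C) : Cexp (a + b) = (Cexp a * Cexp b)%C.
Proof.
  destruct a as [x y], b as [x' y']. unfold Cexp. simpl.
  rewrite exp_plus, cos_plus, sin_plus. apply C_ext; simpl; ring.
Qed.

Lemma Cpower_plus (x : R) (a b : C) : Cpower x (a + b) = (Cpower x a * Cpower x b)%C.
Proof. unfold Cpower. rewrite <- Cexp_plus. f_equal. ring. Qed.

Lemma Cexp_neq_0 (w : C) : Cexp w <> 0%C.
Proof.
  intros E. assert (H : (Cexp w * Cexp (- w))%C = 1%C).
  { rewrite <- Cexp_plus, Cplus_opp_r. unfold Cexp. simpl. rewrite exp_0, cos_0, sin_0.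
    unfold RtoC. f_equal; ring. }
  rewrite E, Cmult_0_l in H. apply C1_nz. now symmetry.
Qed.

(** B / ((n + 1) (n + 2)) is the difference of B / (n + 1) and B / (n + 2). Telescoping bounds the
    sequence by |a 0| exp B and its tails by a multiple of 1 / (n + 1). *)
Lemma prod_step_converges (a : nat -> C) (B : R) :
  0 <= B ->
  (forall n, Cmod (a (S n) - a n) <= B / (INR (S n) * INR (S (S n))) * Cmod (a n)) ->
  exists l, Clim a l.
Proof.
  intros HB H.
  assert (HS : forall n, 0 < INR (S n)) by (intros; apply lt_0_INR; lia).
  assert (Hd : forall n, B / (INR (S n) * INR (S (S n))) = B / INR (S n) - B / INR (S (S n))).
  { intros n. assert (H1 := HS n). assert (H2 := HS (S n)).
    rewrite (S_INR (S n)) in *. field. lra. }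
  assert (Hbd : forall n, Cmod (a n) <= Cmod (a O) * exp (B - B / INR (S n))).
  { induction n.
    - simpl. replace (B - B / 1) with 0 by field. rewrite exp_0. lra.
    - replace (a (S n)) with ((a (S n) - a n) + a n)%C by ring.
      eapply Rle_trans; [apply Cmod_triangle|].
      apply Rle_trans with (Cmod (a n) * exp (B / (INR (S n) * INR (S (S n))))).
      + generalize (H n) (exp_ineq1_le (B / (INR (S n) * INR (S (S n))))) (Cmod_ge_0 (a n)). nra.
      + replace (B - B / INR (S (S n))) with
          ((B - B / INR (S n)) + B / (INR (S n) * INR (S (S n)))) by (rewrite Hd; ring).
        rewrite exp_plus, <- Rmult_assoc. apply Rmult_le_compat_r; auto.
        left; apply exp_pos. }
  set (A := Cmod (a O) * exp B).
  assert (HA : 0 <= A) by (apply Rmult_le_pos; [apply Cmod_ge_0|left; apply exp_pos]).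
  assert (HbA : forall n, Cmod (a n) <= A).
  { intros n. eapply Rle_trans; [apply Hbd|]. apply Rmult_le_compat_l; [apply Cmod_ge_0|].
    destruct (Req_dec B 0) as [->|HB0].
    - unfold Rdiv. rewrite Rmult_0_l, Rminus_0_r. lra.
    - left. apply exp_increasing. assert (0 < B / INR (S n)) by (apply Rdiv_lt_0_compat; auto; lra).
      lra. }
  apply (Clim_complete a (fun n => A * B * / INR (S n))).
  - intros n m.
    apply Rle_trans with (A * (B / INR (S n) - B / INR (S (n + m)))).
    + induction m.
      * rewrite Nat.add_0_r. unfold Cminus. rewrite Cplus_opp_r, Cmod_0. lra.
      * rewrite Nat.add_succ_r.
        replace (a (S (n + m)) - a n)%C
          with ((a (S (n + m)) - a (n + m)%nat) + (a (n + m)%nat - a n))%C by ring.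
        eapply Rle_trans; [apply Cmod_triangle|].
        assert (Hstep : Cmod (a (S (n + m)) - a (n + m)%nat)
          <= A * (B / INR (S (n + m)) - B / INR (S (S (n + m))))).
        { eapply Rle_trans; [apply H|]. rewrite <- Hd, Rmult_comm.
          apply Rmult_le_compat_r; auto.
          apply Rmult_le_pos; auto. left; apply Rinv_0_lt_compat, Rmult_lt_0_compat; auto. }
        lra.
    + assert (0 <= B / INR (S (n + m))).
      { apply Rmult_le_pos; auto. left; apply Rinv_0_lt_compat; auto. }
      unfold Rdiv in *. nra.
  - rewrite <- (Rmult_0_r (A * B)). apply is_lim_seq_mult'; [apply is_lim_seq_const|].
    apply (is_lim_seq_incr_1 (fun n => / INR n)).
    replace (Finite 0) with (Rbar_inv p_infty) by reflexivity.
    apply is_lim_seq_inv; [apply is_lim_seq_INR|discriminate].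
Qed.

(** Once the relative steps are at most 1/2, which the shift by K ensures, the reciprocals satisfy
    the same kind of estimate with 2 B. They converge too, and the product of the two limits is
    1. *)
Lemma prod_step_converges_neq_0 (a : nat -> C) (B : R) (N : nat) :
  0 <= B -> (forall n, a n <> 0%C) ->
  (forall n, (N <= n)%nat ->
     Cmod (a (S n) - a n) <= B / (INR (S n) * INR (S (S n))) * Cmod (a n)) ->
  exists l : C, l <> 0%C /\ Clim a l.
Proof.
  intros HB Ha H. destruct (nat_above (2 * B)) as [m Hm].
  set (K := (N + m)%nat). set (b := fun n => a (n + K)%nat).
  assert (HS : forall n, 0 < INR (S n)) by (intros; apply lt_0_INR; lia).
  assert (Hle : forall n, B / (INR (S (n + K)) * INR (S (S (n + K))))
    <= B / (INR (S n) * INR (S (S n)))).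
  { intros n. apply Rmult_le_compat_l; auto. apply Rinv_le_contravar.
    - apply Rmult_lt_0_compat; auto.
    - apply Rmult_le_compat; try (left; apply HS); apply le_INR; lia. }
  assert (Hsmall : forall n, B / (INR (S (n + K)) * INR (S (S (n + K)))) <= 1 / 2).
  { intros n. assert (H1 := HS (n + K)%nat). assert (H2 := HS (S (n + K))).
    apply Rmult_le_reg_r with (INR (S (n + K)) * INR (S (S (n + K))));
      [now apply Rmult_lt_0_compat|].
    unfold Rdiv at 1. rewrite Rmult_assoc, Rinv_l by (apply Rgt_not_eq, Rmult_lt_0_compat; auto).
    assert (INR m <= INR (S (n + K))) by (apply le_INR; unfold K; lia).
    assert (1 <= INR (S (S (n + K)))) by (rewrite S_INR; generalize (pos_INR (S (n + K))); lra).
    nra. }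
  assert (Hb : forall n, Cmod (b (S n) - b n)
    <= B / (INR (S (n + K)) * INR (S (S (n + K)))) * Cmod (b n)).
  { intros n. apply H. unfold K. lia. }
  destruct (prod_step_converges b B HB) as [l Hl].
  { intros n. eapply Rle_trans; [apply Hb|]. apply Rmult_le_compat_r; [apply Cmod_ge_0|auto]. }
  destruct (prod_step_converges (fun n => / b n)%C (2 * B)) as [l' Hl']; [lra| |].
  { intros n. assert (Hn : b n <> 0%C) by apply Ha. assert (Hn1 : b (S n) <> 0%C) by apply Ha.
    replace (/ b (S n) - / b n)%C with (- (b (S n) - b n) / (b (S n) * b n))%C by (field; auto).
    rewrite Cmod_div, Cmod_opp, Cmod_mult by now apply Cmult_neq_0.
    rewrite Cmod_inv by auto.
    assert (P := proj1 (Cmod_gt_0 _) Hn). assert (P1 := proj1 (Cmod_gt_0 _) Hn1).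
    assert (Hhalf : Cmod (b n) <= 2 * Cmod (b (S n))).
    { generalize (Cmod_rev_triangle (b n) (b (S n) - b n)) (Hb n) (Hsmall n).
      replace (b n + (b (S n) - b n))%C with (b (S n)) by ring. nra. }
    set (eps := B / (INR (S n) * INR (S (S n)))).
    assert (Heps : Cmod (b (S n) - b n) <= eps * Cmod (b n)).
    { eapply Rle_trans; [apply Hb|]. apply Rmult_le_compat_r; [lra|apply Hle]. }
    assert (0 <= eps).
    { apply Rmult_le_pos; auto. left; apply Rinv_0_lt_compat, Rmult_lt_0_compat; auto. }
    replace (2 * B / (INR (S n) * INR (S (S n)))) with (2 * eps)
      by (unfold eps, Rdiv; ring).
    apply Rmult_le_reg_r with (Cmod (b (S n)) * Cmod (b n)); [nra|].
    unfold Rdiv. rewrite Rmult_assoc, Rinv_l by nra.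
    replace (2 * eps * / Cmod (b n) * (Cmod (b (S n)) * Cmod (b n)))
      with (2 * eps * Cmod (b (S n))) by (field; lra). nra. }
  exists l. split; [|now apply (Clim_shift a l K)].
  intros E. subst l. apply C1_nz.
  apply Clim_unique with (fun n => b n * / b n)%C.
  - apply Clim_ext with (fun _ => 1%C); [|apply Clim_const].
    intros n. rewrite Cinv_r; auto. apply Ha.
  - rewrite <- (Cmult_0_l l'). now apply Clim_mult.
Qed.

Definition gamma_seq (s : C) (n : nat) : C :=
  (INR (fact n) * Cpower (INR n) s / poch s (S n))%C.

Lemma ln_step (n : nat) :
  (1 <= n)%nat -> / INR (S n) <= ln (INR (S n)) - ln (INR n) <= / INR n.
Proof.
  intros Hn. assert (H1 : 1 <= INR n) by now apply (le_INR 1).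
  rewrite S_INR. rewrite <- ln_div by lra. split.
  - replace ((INR n + 1) / INR n) with (/ (INR n / (INR n + 1))) by (field; lra).
    rewrite ln_Rinv by (apply Rdiv_lt_0_compat; lra).
    assert (H := exp_ineq1_le (ln (INR n / (INR n + 1)))).
    rewrite exp_ln in H by (apply Rdiv_lt_0_compat; lra).
    replace (/ (INR n + 1)) with (1 - INR n / (INR n + 1)) by (field; lra). lra.
  - assert (H := exp_ineq1_le (ln ((INR n + 1) / INR n))).
    rewrite exp_ln in H by (apply Rdiv_lt_0_compat; lra).
    replace (/ INR n) with ((INR n + 1) / INR n - 1) by (field; lra). lra.
Qed.

(** The quotient of consecutive terms is (n + 1) exp(s x) / (s + n + 1) with x = ln((n + 1) / n),
    and it differs from 1 by O(1 / n^2). The product criterion is applied from index 1 on, because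
    [ln_step] needs a positive n. *)
Lemma gamma_seq_converges (s : C) :
  (forall k, (s + INR k)%C <> 0%C) -> exists l : C, l <> 0%C /\ Clim (gamma_seq s) l.
Proof.
  intros Hs. set (m := Cmod s). assert (Hm0 : 0 <= m) by apply Cmod_ge_0.
  (* From this index on, |s x| <= 1/2, as [Cexp_quadratic] requires, and |s + n + 1| >= (n + 1) /
     2. *)
  destruct (nat_above (2 * m + 2)) as [N HN].
  destruct (prod_step_converges_neq_0 (fun n => gamma_seq s (S n)) (4 * (6 * m ^ 2 + m)) N)
    as (l & Hl & Hlim).
  - nra.
  - intros n. unfold gamma_seq. repeat apply Cmult_neq_0.
    + apply RtoC_INR_fact_neq_0.
    + apply Cexp_neq_0.
    + intros E. apply C1_nz. rewrite <- (Cinv_l (poch s (S (S n)))); [rewrite E; ring|].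
      now apply poch_neq_0.
  - intros n' Hn'. set (n := S n'). assert (Hn : (1 <= n)%nat) by (unfold n; lia).
    destruct (ln_step n Hn) as [L1 L2]. set (x := ln (INR (S n)) - ln (INR n)) in *.
    assert (Hnr : 1 <= INR n) by now apply (le_INR 1).
    assert (HNn : 2 * m + 2 <= INR n).
    { eapply Rle_trans; [exact HN|]. apply le_INR. unfold n. lia. }
    assert (E : gamma_seq s (S n) = ((INR n + 1) * Cexp (s * x) / (s + INR n + 1) * gamma_seq s n)%C).
    { unfold gamma_seq. rewrite RtoC_fact_S.
      replace (Cpower (INR (S n)) s) with (Cpower (INR n) s * Cexp (s * x))%C.
      - change (poch s (S (S n))) with (poch s (S n) * (s + INR (S n)))%C.
        rewrite RtoC_INR_S. field. split.
        + now apply poch_neq_0.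
        + generalize (Hs (S n)). rewrite RtoC_INR_S. intros H E. apply H. rewrite <- E. ring.
      - unfold Cpower. rewrite <- Cexp_plus. f_equal. unfold x. rewrite RtoC_minus. ring. }
    rewrite E.
    assert (Hden : (INR n + 1) / 2 <= Cmod (s + INR n + 1)).
    { generalize (Cmod_rev_triangle (RtoC (INR n + 1)) s). rewrite Cmod_RtoC_pos by lra. fold m.
      replace (RtoC (INR n + 1) + s)%C with (s + INR n + 1)%C by (rewrite RtoC_plus; ring). lra. }
    assert (Hden0 : (s + INR n + 1)%C <> 0%C) by (apply Cmod_gt_0; lra).
    (* The numerator (n + 1) (exp(s x) - 1) - s is split into the quadratic remainder of the
       exponential and s ((n + 1) x - 1); each part is O(1 / n). *)
    replace ((INR n + 1) * Cexp (s * x) / (s + INR n + 1) * gamma_seq s n - gamma_seq s n)%C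
      with (((INR n + 1) * (Cexp (s * x) - 1 - s * x) + s * ((INR n + 1) * x - 1))
        / (s + INR n + 1) * gamma_seq s n)%C by (field; auto).
    rewrite Cmod_mult. apply Rmult_le_compat_r; [apply Cmod_ge_0|].
    rewrite Cmod_div by auto.
    assert (Hin : 0 < / INR n) by (apply Rinv_0_lt_compat; lra).
    assert (Hin1 : 0 < / INR (S n)) by (apply Rinv_0_lt_compat; rewrite S_INR; lra).
    assert (Hnn : INR n * / INR n = 1) by (apply Rinv_r; lra).
    assert (Hx : Cmod (s * x) = m * x) by (rewrite Cmod_mult, Cmod_RtoC_pos by lra; auto).
    assert (Hmx : m * x <= m * / INR n) by (apply Rmult_le_compat_l; lra).
    assert (Hmn : m * / INR n <= 1 / 2).
    { apply Rmult_le_reg_r with (INR n); [lra|]. rewrite Rmult_assoc, Rinv_l by lra. lra. }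
    assert (Hnum : Cmod ((INR n + 1) * (Cexp (s * x) - 1 - s * x) + s * ((INR n + 1) * x - 1))
      <= (6 * m ^ 2 + m) * / INR n).
    { eapply Rle_trans; [apply Cmod_triangle|]. rewrite !Cmod_mult. fold m.
      rewrite <- RtoC_plus, Cmod_RtoC_pos by lra.
      rewrite <- RtoC_mult, <- RtoC_minus.
      assert (Hx1 : 0 <= (INR n + 1) * x - 1 <= / INR n).
      { rewrite S_INR in L1. assert ((INR n + 1) * / (INR n + 1) = 1) by (apply Rinv_r; lra).
        split; nra. }
      rewrite (Cmod_RtoC_pos ((INR n + 1) * x - 1)) by lra.
      assert (Hq : Cmod (Cexp (s * x) - 1 - s * x) <= 3 * (m * / INR n) ^ 2).
      { eapply Rle_trans; [apply Cexp_quadratic; rewrite Hx; lra|]. rewrite Hx.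
        apply Rmult_le_compat_l; [lra|]. apply pow_incr. split; [|lra].
        apply Rmult_le_pos; lra. }
      apply Rle_trans with ((INR n + 1) * (3 * (m * / INR n) ^ 2) + m * / INR n).
      - apply Rplus_le_compat; apply Rmult_le_compat_l; lra.
      - assert ((INR n + 1) * (3 * (m * / INR n) ^ 2) <= 6 * m ^ 2 * / INR n); [|lra].
        apply Rle_trans with (2 * INR n * (3 * (m * / INR n) ^ 2)).
        + apply Rmult_le_compat_r; [|lra]. generalize (pow2_ge_0 (m * / INR n)); lra.
        + right. replace (2 * INR n * (3 * (m * / INR n) ^ 2))
            with (6 * m ^ 2 * / INR n * (INR n * / INR n)) by ring. rewrite Hnn. ring. }
    apply Rle_trans with ((6 * m ^ 2 + m) * / INR n * / ((INR n + 1) / 2)).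
    + apply Rmult_le_compat; auto.
      * apply Cmod_ge_0.
      * left; apply Rinv_0_lt_compat; lra.
      * apply Rinv_le_contravar; lra.
    + rewrite (S_INR n). fold n.
      assert (0 <= 6 * m ^ 2 + m) by nra.
      apply Rle_trans with (2 * (6 * m ^ 2 + m) / (INR n * (INR n + 1))).
      * right. field. lra.
      * apply Rmult_le_compat_r; [left; apply Rinv_0_lt_compat; nra|]. lra.
  - exists l. split; auto. apply (Clim_shift _ _ 1).
    apply Clim_ext with (2 := Hlim). intros n. now rewrite Nat.add_1_r.
Qed.

Lemma Gamma_correct (s : C) :
  (forall k, (s + INR k)%C <> 0%C) -> Clim (gamma_seq s) (Gamma s) /\ Gamma s <> 0%C.
Proof.
  intros Hs. destruct (gamma_seq_converges s Hs) as (l & Hl & Hlim).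
  assert (E : Gamma s = l) by exact (Clim_seq_correct _ _ Hlim).
  now rewrite E.
Qed.

Lemma Cpower_INR_1 (n : nat) : (1 <= n)%nat -> Cpower (INR n) 1 = INR n.
Proof.
  intros Hn. rewrite Cpower_RtoC, Rmult_1_l, exp_ln; auto. apply lt_0_INR; lia.
Qed.

Lemma Clim_inv_INR_S : Clim (fun n => / (INR n + 1))%C 0.
Proof.
  apply Clim_squeeze with (fun n => / INR (S n)).
  - intros n. unfold Cminus. rewrite Copp_0, Cplus_0_r, <- RtoC_INR_S.
    rewrite Cmod_inv by apply RtoC_INR_S_neq_0. rewrite Cmod_RtoC_pos by apply pos_INR. lra.
  - apply (is_lim_seq_incr_1 (fun n => / INR n)).
    replace (Finite 0) with (Rbar_inv p_infty) by reflexivity.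
    apply is_lim_seq_inv; [apply is_lim_seq_INR|discriminate].
Qed.

(** The quotient of the approximating sequences at s + 1 and at s is s n / (s + n + 1), written
    through 1 / (n + 1) so that its limit s is visible. *)
Lemma Gamma_S (s : C) :
  (forall k, (s + INR k)%C <> 0%C) -> Gamma (s + 1) = (s * Gamma s)%C.
Proof.
  intros Hs. destruct (Gamma_correct s Hs) as [H1 _].
  assert (Hs1 : forall k, (s + 1 + INR k)%C <> 0%C).
  { intros k E. apply (Hs (S k)). rewrite RtoC_INR_S, <- E. ring. }
  destruct (Gamma_correct _ Hs1) as [H2 _].
  apply Clim_unique with (1 := H2).
  assert (Hr : Clim (fun n => (1 - / (INR n + 1)) * / (1 + s * / (INR n + 1)))%C
    ((1 + - 0) * / (1 + s * 0))%C).
  { apply Clim_mult.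
    - apply Clim_plus; [apply Clim_const|apply Clim_opp, Clim_inv_INR_S].
    - apply Clim_inv; [rewrite Cmult_0_r, Cplus_0_r; apply C1_nz|].
      apply Clim_plus; [apply Clim_const|apply Clim_scal, Clim_inv_INR_S]. }
  replace (s * Gamma s)%C with (s * (Gamma s * ((1 + - 0) * / (1 + s * 0))))%C.
  2:{ rewrite Cmult_0_r, Copp_0, !Cplus_0_r. field. }
  eapply Clim_ext_loc; [|apply Clim_scal, (Clim_mult _ _ _ _ H1 Hr)].
  exists 1%nat. intros n Hn. unfold gamma_seq.
  rewrite Cpower_plus, Cpower_INR_1 by auto.
  assert (Hp : poch s (S (S n)) <> 0%C) by now apply poch_neq_0.
  assert (E : (s * poch (s + 1) (S n))%C = (poch s (S n) * (s + INR n + 1))%C).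
  { rewrite <- poch_Sl.
    change (poch s (S (S n))) with (poch s (S n) * (s + INR (S n)))%C.
    rewrite RtoC_INR_S. ring. }
  assert (Hs0 : s <> 0%C) by (intros E0; apply (Hs O); rewrite E0; simpl; ring).
  assert (Hn1 := RtoC_INR_S_neq_0 n). rewrite RtoC_INR_S in Hn1.
  assert (Hsn : (s + INR n + 1)%C <> 0%C).
  { generalize (Hs (S n)). rewrite RtoC_INR_S. intros H E0. apply H. rewrite <- E0. ring. }
  replace (poch (s + 1) (S n)) with (poch s (S n) * (s + INR n + 1) / s)%C
    by (rewrite <- E; field; auto).
  field. repeat split; auto. now apply poch_neq_0.
Qed.

Lemma Gamma_plus_INR (s : C) (k : nat) :
  (forall k, (s + INR k)%C <> 0%C) -> Gamma (s + INR k) = (poch s k * Gamma s)%C.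
Proof.
  intros Hs. induction k.
  - simpl. rewrite Cplus_0_r. ring.
  - rewrite RtoC_INR_S, Cplus_assoc, Gamma_S, IHk; [simpl; ring|].
    intros j E. apply (Hs (k + j)%nat). rewrite <- E, plus_INR, RtoC_plus. ring.
Qed.

Lemma Gamma_1 : Gamma 1 = 1%C.
Proof.
  apply Clim_seq_correct.
  replace (RtoC 1) with (1 + - 0)%C by (rewrite Copp_0; ring).
  eapply Clim_ext_loc; [|apply Clim_plus; [apply Clim_const|apply Clim_opp, Clim_inv_INR_S]].
  exists 1%nat. intros n Hn. cbv beta.
  replace (1 + - 0)%C with (RtoC 1) by (rewrite Copp_0; ring).
  rewrite Cpower_INR_1, poch_1, RtoC_fact_S by auto.
  field. split; [|apply RtoC_INR_fact_neq_0].
  rewrite <- RtoC_INR_S. apply RtoC_INR_S_neq_0.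
Qed.

(** * Derivatives from quadratic error bounds *)

(** A quadratic error bound adds up over the terms of a series and survives passage to the limit;
    this is how infinite sums are differentiated below. *)
Lemma is_derive_quadratic (f : R -> R) (x d del B : R) :
  0 < del -> (forall h, Rabs h < del -> Rabs (f (x + h) - f x - h * d) <= B * h ^ 2) ->
  is_derive f x d.
Proof.
  intros Hdel H. apply is_derive_Reals. intros eps Heps.
  assert (HB : 0 < Rabs B + 1) by (generalize (Rabs_pos B); lra).
  assert (Hd : 0 < Rmin del (eps / (Rabs B + 1))).
  { apply Rmin_glb_lt; auto. now apply Rdiv_lt_0_compat. }
  exists (mkposreal _ Hd). intros h Hh0 Hh. simpl in Hh.
  assert (H1 : Rabs h < del) by (eapply Rlt_le_trans; [exact Hh|apply Rmin_l]).
  assert (H2 : Rabs h < eps / (Rabs B + 1)) by (eapply Rlt_le_trans; [exact Hh|apply Rmin_r]).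
  assert (Hp : 0 < Rabs h) by now apply Rabs_pos_lt.
  replace ((f (x + h) - f x) / h - d) with ((f (x + h) - f x - h * d) / h) by (field; auto).
  unfold Rdiv. rewrite Rabs_mult, Rabs_inv.
  apply Rle_lt_trans with (B * h ^ 2 * / Rabs h).
  - apply Rmult_le_compat_r; [left; now apply Rinv_0_lt_compat|auto].
  - rewrite <- pow2_abs. replace (B * Rabs h ^ 2 * / Rabs h) with (B * Rabs h) by (field; lra).
    apply Rle_lt_trans with (Rabs h * (Rabs B + 1)).
    + generalize (Rle_abs B). nra.
    + apply Rmult_lt_reg_r with (/ (Rabs B + 1)); [now apply Rinv_0_lt_compat|].
      rewrite Rmult_assoc, Rinv_r by lra. unfold Rdiv in H2. lra.
Qed.

Lemma ln_quadratic (y : R) : Rabs y <= 1 / 2 -> Rabs (ln (1 + y) - y) <= 2 * y ^ 2.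
Proof.
  intros Hy. apply Rabs_le_between in Hy.
  assert (H1 := exp_ineq1_le (ln (1 + y))). rewrite exp_ln in H1 by lra.
  assert (H2 := exp_ineq1_le (- ln (1 + y))).
  rewrite exp_Ropp, exp_ln in H2 by lra.
  assert (E : / (1 + y) = 1 - y + y ^ 2 * / (1 + y)) by (field; lra).
  assert (/ (1 + y) <= 2).
  { replace 2 with (/ (1 / 2)) by field. apply Rinv_le_contravar; lra. }
  rewrite Rabs_left1 by lra. generalize (pow2_ge_0 y). nra.
Qed.

Lemma sum_inv_sqr_bound (n : nat) : sum_n (fun j => / INR (S j) ^ 2) n <= 2 - / INR (S n).
Proof.
  induction n.
  - rewrite sum_O. simpl. lra.
  - rewrite sum_Sn.
    change (sum_n (fun j => / INR (S j) ^ 2) n + / INR (S (S n)) ^ 2 <= 2 - / INR (S (S n))).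
    assert (H : 0 < INR (S n)) by (apply lt_0_INR; lia).
    rewrite (S_INR (S n)) in *. set (x := INR (S n)) in *.
    assert (E : / x - / (x + 1) - / (x + 1) ^ 2 = / (x * (x + 1) ^ 2)) by (field; lra).
    assert (0 < / (x * (x + 1) ^ 2)).
    { apply Rinv_0_lt_compat. apply Rmult_lt_0_compat; auto. apply pow_lt; lra. }
    lra.
Qed.

Lemma sum_n_Rabs_le (f g : nat -> R) (n : nat) :
  (forall j, Rabs (f j) <= g j) -> Rabs (sum_n f n) <= sum_n g n.
Proof.
  intros H. induction n; [rewrite !sum_O; auto|].
  rewrite !sum_Sn.
  change (Rabs (sum_n f n + f (S n)) <= sum_n g n + g (S n)).
  eapply Rle_trans; [apply Rabs_triang|]. generalize (H (S n)). lra.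
Qed.

Lemma ex_series_inv_sqr : ex_series (fun j => / INR (S j) ^ 2).
Proof.
  apply ex_finite_lim_seq_incr with 2.
  - intros n. rewrite sum_Sn.
    change (sum_n (fun j => / INR (S j) ^ 2) n
      <= sum_n (fun j => / INR (S j) ^ 2) n + / INR (S (S n)) ^ 2).
    assert (0 < / INR (S (S n)) ^ 2); [|lra].
    apply Rinv_0_lt_compat, pow_lt, lt_0_INR. lia.
  - intros n. eapply Rle_trans; [apply sum_inv_sqr_bound|].
    assert (0 < / INR (S n)) by (apply Rinv_0_lt_compat, lt_0_INR; lia). lra.
Qed.

(** * Local behaviour of quotients of Gamma functions *)

(** With [a + a' = si] and [a a' = t] real, [qd si t x = (x + a) (x + a')]. *)
Definition qd (si t x : R) : R := x ^ 2 + si * x + t.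

(** Logarithm of x^2 / ((x + a) (x + a')), one factor of the Euler product for [gamma_quot]; [dlam]
    is its derivative in x. *)
Definition llam (si t x : R) : R := 2 * ln x - ln (qd si t x).

Definition dlam (si t x : R) : R := 2 / x - (2 * x + si) / qd si t x.

(** Finitely many m are handled by a minimum; beyond 2 (|si| + |t|) the quadratic term dominates and
    the constant 1/2 works. *)
Lemma qd_lower (si t : R) :
  (forall m, (1 <= m)%nat -> 0 < qd si t (INR m)) ->
  exists c, 0 < c /\ forall m, (1 <= m)%nat -> c * INR m ^ 2 <= qd si t (INR m).
Proof.
  intros H.
  assert (Hfin : forall N, exists c, 0 < c /\
    forall m, (1 <= m)%nat -> (m <= N)%nat -> c * INR m ^ 2 <= qd si t (INR m)).
  { induction N as [|N (c & Hc & IH)]; [exists 1; split; [lra|intros; lia]|].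
    assert (HS : 0 < INR (S N) ^ 2) by (apply pow_lt, lt_0_INR; lia).
    assert (Hq := H (S N) ltac:(lia)).
    exists (Rmin c (qd si t (INR (S N)) / INR (S N) ^ 2)). split.
    - apply Rmin_glb_lt; auto. now apply Rdiv_lt_0_compat.
    - intros m H1 Hm. destruct (Nat.eq_dec m (S N)) as [->|Hne].
      + apply Rle_trans with (qd si t (INR (S N)) / INR (S N) ^ 2 * INR (S N) ^ 2).
        * apply Rmult_le_compat_r; [lra|apply Rmin_r].
        * right; field. apply not_0_INR; lia.
      + apply Rle_trans with (c * INR m ^ 2); [|apply IH; lia].
        apply Rmult_le_compat_r; [apply pow2_ge_0|apply Rmin_l]. }
  destruct (nat_above (2 * (Rabs si + Rabs t))) as [N HN].
  destruct (Hfin N) as (c & Hc & Hcm).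
  exists (Rmin c (1 / 2)). split; [apply Rmin_glb_lt; lra|].
  intros m Hm. assert (Hm2 := pow2_ge_0 (INR m)).
  destruct (Compare_dec.le_lt_dec m N) as [Hle|Hlt].
  - apply Rle_trans with (c * INR m ^ 2); [|now apply Hcm].
    apply Rmult_le_compat_r; [auto|apply Rmin_l].
  - apply Rle_trans with (1 / 2 * INR m ^ 2).
    + apply Rmult_le_compat_r; [auto|apply Rmin_r].
    + assert (H1 : 1 <= INR m) by now apply (le_INR 1).
      assert (H2 : INR N <= INR m) by (apply le_INR; lia).
      unfold qd. generalize (Rle_abs (- si)) (Rle_abs (- t)) (Rabs_pos si) (Rabs_pos t).
      rewrite !Rabs_Ropp. nra.
Qed.

(** The point is uniformity in m: one radius for all factors, and errors summable like 1 / m^2. The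
    slope is O(1 / m^2) because its leading terms 2 / x cancel. Positivity, assumed at integers,
    extends to the interval because the relative change y of [qd] is at most 1/2 there. *)
Lemma llam_taylor (si t : R) :
  (forall m, (1 <= m)%nat -> 0 < qd si t (INR m)) ->
  exists del B, 0 < del <= 1 / 2 /\ 0 <= B /\ forall m, (1 <= m)%nat ->
    Rabs (dlam si t (INR m)) <= B * / INR m ^ 2 /\
    forall h, Rabs h < del -> 0 < qd si t (INR m + h) /\
      Rabs (llam si t (INR m + h) - llam si t (INR m) - h * dlam si t (INR m))
        <= B * h ^ 2 * / INR m ^ 2.
Proof.
  intros H. destruct (qd_lower si t H) as (c & Hc & Hq).
  set (b := 3 + Rabs si). assert (Hb : 3 <= b) by (unfold b; generalize (Rabs_pos si); lra).
  set (B1 := 4 + 2 * (b / c) ^ 2 + / c). set (B2 := (Rabs si + 2 * Rabs t) / c).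
  assert (Hic : 0 < / c) by now apply Rinv_0_lt_compat.
  assert (HB1 : 0 <= B1) by (unfold B1; generalize (pow2_ge_0 (b / c)); lra).
  assert (HB2 : 0 <= B2).
  { unfold B2. apply Rmult_le_pos; [|lra]. generalize (Rabs_pos si) (Rabs_pos t). lra. }
  exists (Rmin (1 / 2) (c / (2 * b))), (B1 + B2).
  split; [split; [apply Rmin_glb_lt; [lra|apply Rdiv_lt_0_compat; lra]|apply Rmin_l]|].
  split; [lra|]. intros m Hm.
  set (x := INR m). assert (Hx : 1 <= x) by (unfold x; now apply (le_INR 1)).
  assert (Hqx : c * x ^ 2 <= qd si t x) by (unfold x; now apply Hq).
  assert (Hx2 : 0 < x ^ 2) by (apply pow_lt; lra).
  assert (Hqp : 0 < qd si t x) by (generalize (Rmult_lt_0_compat c _ Hc Hx2); lra).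
  assert (Hix2 : 0 < / x ^ 2) by now apply Rinv_0_lt_compat.
  assert (Hiq : / qd si t x <= / c * / x ^ 2).
  { rewrite <- Rinv_mult. apply Rinv_le_contravar; auto. now apply Rmult_lt_0_compat. }
  assert (Hiq0 : 0 < / qd si t x) by now apply Rinv_0_lt_compat.
  split.
  - assert (E : dlam si t x = (si + 2 * t * / x) * / qd si t x).
    { transitivity ((2 * qd si t x - x * (2 * x + si)) * / x * / qd si t x).
      - unfold dlam. field. lra.
      - replace (2 * qd si t x - x * (2 * x + si)) with (si * x + 2 * t) by (unfold qd; ring).
        field. lra. }
    rewrite E, Rabs_mult, (Rabs_pos_eq (/ qd si t x)) by lra.
    apply Rle_trans with ((Rabs si + 2 * Rabs t) * (/ c * / x ^ 2)).
    + apply Rmult_le_compat; try apply Rabs_pos; try lra.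
      eapply Rle_trans; [apply Rabs_triang|].
      assert (Hix : 0 < / x <= 1).
      { split; [apply Rinv_0_lt_compat; lra|]. rewrite <- Rinv_1. apply Rinv_le_contravar; lra. }
      rewrite !Rabs_mult, (Rabs_pos_eq 2), (Rabs_pos_eq (/ x)) by lra.
      generalize (Rabs_pos t). nra.
    + replace ((Rabs si + 2 * Rabs t) * (/ c * / x ^ 2)) with (B2 * / x ^ 2)
        by (unfold B2, Rdiv; ring). nra.
  - intros h Hh.
    assert (Hh1 : Rabs h < 1 / 2) by (eapply Rlt_le_trans; [exact Hh|apply Rmin_l]).
    assert (Hh2 : Rabs h * b <= c / 2).
    { apply Rle_trans with (c / (2 * b) * b).
      - apply Rmult_le_compat_r; [lra|]. left. eapply Rlt_le_trans; [exact Hh|apply Rmin_r].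
      - right; field; lra. }
    assert (Hh0 := Rabs_pos h).
    set (y := (h * (2 * x + si) + h ^ 2) / qd si t x).
    assert (Hy : Rabs y <= Rabs h * (b / c) * / x).
    { unfold y, Rdiv. rewrite Rabs_mult, (Rabs_pos_eq (/ qd si t x)) by lra.
      apply Rle_trans with (Rabs h * b * x * (/ c * / x ^ 2)).
      - apply Rmult_le_compat; try apply Rabs_pos; try lra.
        eapply Rle_trans; [apply Rabs_triang|]. rewrite Rabs_mult, <- RPow_abs.
        assert (Rabs (2 * x + si) <= (2 + Rabs si) * x).
        { eapply Rle_trans; [apply Rabs_triang|]. rewrite Rabs_pos_eq by lra.
          generalize (Rabs_pos si). nra. }
        unfold b. simpl. assert (Rabs h * Rabs h <= Rabs h * x) by nra. nra.
      - right. field. lra. }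
    assert (Hix : 0 < / x <= 1).
    { split; [apply Rinv_0_lt_compat; lra|]. rewrite <- Rinv_1. apply Rinv_le_contravar; lra. }
    assert (Hbc : Rabs h * (b / c) <= 1 / 2).
    { replace (Rabs h * (b / c)) with (Rabs h * b * / c) by (unfold Rdiv; ring).
      apply Rle_trans with (c / 2 * / c); [apply Rmult_le_compat_r; lra|].
      right; field; lra. }
    assert (Hhbc : 0 <= Rabs h * (b / c)).
    { apply Rmult_le_pos; auto. apply Rmult_le_pos; lra. }
    assert (Hy2 : Rabs y <= 1 / 2) by nra.
    assert (Ey : qd si t (x + h) = qd si t x * (1 + y)).
    { unfold y. unfold Rdiv. rewrite Rmult_plus_distr_l, (Rmult_comm (_ + _) (/ _)).
      rewrite <- (Rmult_assoc (qd si t x) (/ _)), Rinv_r by lra. unfold qd. ring. }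
    assert (Hy1 : 0 < 1 + y) by (apply Rabs_le_between in Hy2; lra).
    split; [rewrite Ey; now apply Rmult_lt_0_compat|].
    set (w := h / x).
    assert (Hw : Rabs w = Rabs h * / x) by (unfold w, Rdiv; rewrite Rabs_mult, (Rabs_pos_eq (/ x)) by lra; auto).
    assert (Hw2 : Rabs w <= 1 / 2) by (rewrite Hw; nra).
    assert (Hw1 : 0 < 1 + w) by (apply Rabs_le_between in Hw2; lra).
    (* The linear parts of 2 ln(1 + w) and ln(1 + y) cancel against the slope term, up to the h^2
       that y carries. *)
    assert (E : llam si t (x + h) - llam si t x - h * dlam si t x
      = 2 * (ln (1 + w) - w) - (ln (1 + y) - y) - h ^ 2 * / qd si t x).
    { unfold llam. rewrite Ey, (ln_mult (qd si t x)) by auto.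
      replace (x + h) with (x * (1 + w)) by (unfold w; field; lra).
      rewrite ln_mult by (auto; lra).
      unfold dlam, w, y. field. split; lra. }
    rewrite E.
    assert (L1 := ln_quadratic w Hw2). assert (L2 := ln_quadratic y Hy2).
    rewrite <- pow2_abs, Hw in L1. rewrite <- pow2_abs in L2.
    assert (Hyy : Rabs y ^ 2 <= (Rabs h * (b / c) * / x) ^ 2).
    { apply pow_incr. split; [apply Rabs_pos|auto]. }
    apply Rle_trans with (2 * (2 * (Rabs h * / x) ^ 2) + 2 * (Rabs h * (b / c) * / x) ^ 2
      + h ^ 2 * (/ c * / x ^ 2)).
    + eapply Rle_trans; [apply Rabs_triang|]. rewrite Rabs_Ropp.
      apply Rplus_le_compat.
      * eapply Rle_trans; [apply Rabs_triang|]. rewrite Rabs_Ropp, Rabs_mult, (Rabs_pos_eq 2) by lra.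
        lra.
      * rewrite Rabs_pos_eq.
        -- apply Rmult_le_compat_l; [apply pow2_ge_0|auto].
        -- apply Rmult_le_pos; [apply pow2_ge_0|lra].
    + rewrite !Rpow_mult_distr, pow2_abs, pow_inv.
      replace (2 * (2 * (h ^ 2 * / x ^ 2)) + 2 * (h ^ 2 * (b / c) ^ 2 * / x ^ 2)
        + h ^ 2 * (/ c * / x ^ 2)) with (B1 * h ^ 2 * / x ^ 2) by (unfold B1; ring).
      apply Rmult_le_compat_r; [lra|]. apply Rmult_le_compat_r; [apply pow2_ge_0|lra].
Qed.

(** Logarithm of the n-th approximation to [gamma_quot] from Euler's formula: the factorials and the
    powers n^(u + 1) cancel, and n^si remains. *)
Definition log_quot (si t u : R) (n : nat) : R :=
  si * ln (INR n) + sum_n (fun j => llam si t (u + 1 + INR j)) n.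

Lemma poch_quot (a a' : C) (si t u : R) (n : nat) :
  (a + a')%C = si -> (a * a')%C = t -> -1 < u ->
  (forall j, 0 < qd si t (u + 1 + INR j)) ->
  (poch (u + 1) (S n) * poch (u + 1) (S n))%C
  = (RtoC (exp (sum_n (fun j => llam si t (u + 1 + INR j)) n))
     * (poch (u + 1 + a) (S n) * poch (u + 1 + a') (S n)))%C.
Proof.
  intros Hs Ht Hu Hq.
  assert (E1 : forall j, ((u + 1 + INR j) * (u + 1 + INR j))%C
    = (RtoC (exp (llam si t (u + 1 + INR j))) * ((u + 1 + a + INR j) * (u + 1 + a' + INR j)))%C).
  { intros j. assert (Hx : 0 < u + 1 + INR j) by (generalize (pos_INR j); lra).
    assert (E : ((u + 1 + a + INR j) * (u + 1 + a' + INR j))%C = RtoC (qd si t (u + 1 + INR j))).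
    { unfold qd. replace ((u + 1 + a + INR j) * (u + 1 + a' + INR j))%C with
        ((u + 1 + INR j) * (u + 1 + INR j) + (a + a') * (u + 1 + INR j) + a * a')%C by ring.
      rewrite Hs, Ht. rewrite !RtoC_plus, RtoC_mult, RtoC_pow, !RtoC_plus. ring. }
    rewrite E, <- !RtoC_plus, <- !RtoC_mult. f_equal.
    unfold llam, Rminus. rewrite exp_plus, exp_Ropp, exp_ln by auto.
    replace (2 * ln (u + 1 + INR j)) with (ln (u + 1 + INR j) + ln (u + 1 + INR j)) by ring.
    rewrite exp_plus, exp_ln by auto. specialize (Hq j). field. lra. }
  induction n.
  - rewrite sum_O. simpl. rewrite !Cmult_1_l. apply (E1 O).
  - rewrite sum_Sn.
    change (Hierarchy.plus (sum_n (fun j => llam si t (u + 1 + INR j)) n)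
      (llam si t (u + 1 + INR (S n)))) with
      (sum_n (fun j => llam si t (u + 1 + INR j)) n + llam si t (u + 1 + INR (S n))).
    rewrite exp_plus, RtoC_mult.
    change (poch (u + 1) (S (S n))) with (poch (u + 1) (S n) * (u + 1 + INR (S n)))%C.
    change (poch (u + 1 + a) (S (S n))) with (poch (u + 1 + a) (S n) * (u + 1 + a + INR (S n)))%C.
    change (poch (u + 1 + a') (S (S n)))
      with (poch (u + 1 + a') (S n) * (u + 1 + a' + INR (S n)))%C.
    replace (poch (u + 1) (S n) * (u + 1 + INR (S n)) * (poch (u + 1) (S n) * (u + 1 + INR (S n))))%C
      with ((poch (u + 1) (S n) * poch (u + 1) (S n))
        * ((u + 1 + INR (S n)) * (u + 1 + INR (S n))))%C by ring.
    rewrite IHn, (E1 (S n)). ring.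
Qed.

Definition gamma_quot (a a' : C) (u : R) : C :=
  (Gamma (u + 1 + a) * Gamma (u + 1 + a') / (Gamma (u + 1) * Gamma (u + 1)))%C.

Lemma qd_nonpole (a a' : C) (si t u : R) :
  (a + a')%C = si -> (a * a')%C = t -> (forall j, 0 < qd si t (u + 1 + INR j)) ->
  forall j, (u + 1 + a + INR j)%C <> 0%C.
Proof.
  intros Hs Ht Hq j E. specialize (Hq j).
  assert (E1 : RtoC (qd si t (u + 1 + INR j)) = 0%C).
  { unfold qd. rewrite !RtoC_plus, RtoC_mult, RtoC_pow, !RtoC_plus, <- Hs, <- Ht.
    replace ((u + 1 + INR j) ^ 2 + (a + a') * (u + 1 + INR j) + a * a')%C with
      ((u + 1 + a + INR j) * (u + 1 + a' + INR j))%C by ring.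
    rewrite E. ring. }
  apply RtoC_inj in E1. lra.
Qed.

(** The approximations are positive reals, so the limit is real and nonnegative; it is positive
    because [Gamma] does not vanish at the points concerned. *)
Lemma gamma_quot_limit (a a' : C) (si t u : R) :
  (a + a')%C = si -> (a * a')%C = t -> -1 < u ->
  (forall j, 0 < qd si t (u + 1 + INR j)) ->
  exists v, gamma_quot a a' u = RtoC v /\ 0 < v /\ is_lim_seq (log_quot si t u) (ln v).
Proof.
  intros Hs Ht Hu Hq.
  assert (Hpole := qd_nonpole a a' si t u Hs Ht Hq).
  assert (Hpole' := qd_nonpole a' a si t u ltac:(rewrite Cplus_comm; auto)
    ltac:(rewrite Cmult_comm; auto) Hq).
  assert (Hu1 : forall j, (u + 1 + INR j)%C <> 0%C).
  { intros j. rewrite <- RtoC_plus. apply RtoC_pos_plus_INR_neq_0. lra. }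
  destruct (Gamma_correct _ Hpole) as [L1 N1]. destruct (Gamma_correct _ Hpole') as [L2 N2].
  destruct (Gamma_correct _ Hu1) as [L3 N3].
  assert (Hne : gamma_quot a a' u <> 0%C).
  { unfold gamma_quot. intros E. assert (Hd := Cmult_neq_0 _ _ N3 N3).
    apply (Cmult_neq_0 _ _ N1 N2).
    replace (Gamma (u + 1 + a) * Gamma (u + 1 + a'))%C with
      (Gamma (u + 1 + a) * Gamma (u + 1 + a') / (Gamma (u + 1) * Gamma (u + 1))
        * (Gamma (u + 1) * Gamma (u + 1)))%C by (field; auto).
    rewrite E. ring. }
  assert (L : Clim (fun n => RtoC (exp (log_quot si t u n))) (gamma_quot a a' u)).
  { unfold gamma_quot. eapply Clim_ext_loc;
      [|apply Clim_mult; [apply (Clim_mult _ _ _ _ L1 L2)|apply Clim_inv;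
        [now apply Cmult_neq_0|apply (Clim_mult _ _ _ _ L3 L3)]]].
    exists 1%nat. intros n Hn. unfold log_quot, gamma_seq.
    rewrite exp_plus, RtoC_mult, <- Cpower_RtoC, <- Hs.
    rewrite !Cpower_plus.
    generalize (poch_quot a a' si t u n Hs Ht Hu Hq). intros Hp.
    assert (P1 : poch (u + 1 + a) (S n) <> 0%C) by now apply poch_neq_0.
    assert (P2 : poch (u + 1 + a') (S n) <> 0%C) by now apply poch_neq_0.
    assert (P3 : poch (u + 1) (S n) <> 0%C) by now apply poch_neq_0.
    replace (RtoC (exp (sum_n (fun j => llam si t (u + 1 + INR j)) n))) with
      ((poch (u + 1) (S n) * poch (u + 1) (S n))
        / (poch (u + 1 + a) (S n) * poch (u + 1 + a') (S n)))%C by (rewrite Hp; field; auto).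
    field. repeat split; auto; try apply Cexp_neq_0; apply RtoC_INR_fact_neq_0. }
  exists (Re (gamma_quot a a' u)).
  assert (Him : Im (gamma_quot a a' u) = 0).
  { destruct L as [_ L]. apply is_lim_seq_unique in L. simpl in L.
    rewrite Lim_seq_const in L. now injection L. }
  assert (E : gamma_quot a a' u = RtoC (Re (gamma_quot a a' u))) by (apply C_ext; auto).
  assert (Hpos : 0 < Re (gamma_quot a a' u)).
  { assert (0 <= Re (gamma_quot a a' u)).
    { destruct L as [L _].
      apply (is_lim_seq_le (fun _ => 0) _ 0 (Re (gamma_quot a a' u))) with (2 := is_lim_seq_const 0)
        (3 := L). intros n. simpl. left; apply exp_pos. }
    destruct (Req_dec (Re (gamma_quot a a' u)) 0) as [E0|]; [|lra].
    exfalso. apply Hne. rewrite E, E0. reflexivity. }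
  split; auto. split; auto.
  apply is_lim_seq_ext with (fun n => ln (exp (log_quot si t u n))).
  - intros n. apply ln_exp.
  - apply is_lim_seq_continuous; [|apply L].
    apply derivable_continuous_pt. exists (/ Re (gamma_quot a a' u)). now apply derivable_pt_lim_ln.
Qed.

(** Summing [llam_taylor] over the factors bounds the error by 2 B h^2 for every n, the sum of 1 /
    j^2 being at most 2. The bound passes to the limit and gives the derivative of the logarithm at
    k; the term si ln n cancels in the difference. *)
Lemma gamma_quot_local (a a' : C) (si t : R) (k : nat) :
  (a + a')%C = si -> (a * a')%C = t ->
  (forall m, (1 <= m)%nat -> 0 < qd si t (INR m)) ->
  exists (del : R) (Lam : R -> R), 0 < del /\
    (forall u, Rabs (u - INR k) < del -> -1 < u /\ gamma_quot a a' u = RtoC (Lam u) /\ 0 < Lam u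
      /\ forall j, (u + 1 + a + INR j)%C <> 0%C) /\
    ex_derive Lam (INR k).
Proof.
  intros Hs Ht Hq.
  destruct (llam_taylor si t Hq) as (del & B & Hdel & HB & Hlam).
  assert (Hxk : forall j, INR k + 1 + INR j = INR (k + S j)).
  { intros j. rewrite plus_INR, S_INR. ring. }
  assert (Hqu : forall u, Rabs (u - INR k) < del -> -1 < u /\ forall j, 0 < qd si t (u + 1 + INR j)).
  { intros u Hu. split.
    - apply Rabs_lt_between in Hu. generalize (pos_INR k). lra.
    - intros j. destruct (Hlam (k + S j)%nat ltac:(lia)) as [_ H2].
      destruct (H2 (u - INR k) Hu) as [H3 _]. rewrite <- Hxk in H3.
      replace (u + 1 + INR j) with (INR k + 1 + INR j + (u - INR k)) by ring. auto. }
  set (Lam := fun u => Re (gamma_quot a a' u)).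
  assert (HL : forall u, Rabs (u - INR k) < del -> gamma_quot a a' u = RtoC (Lam u) /\ 0 < Lam u
    /\ is_lim_seq (log_quot si t u) (ln (Lam u))).
  { intros u Hu. destruct (Hqu u Hu) as [Hu1 Hj].
    destruct (gamma_quot_limit a a' si t u Hs Ht Hu1 Hj) as (v & E & Hv & Hlim).
    unfold Lam. rewrite E. simpl. auto. }
  exists del, Lam. split; [lra|]. split.
  - intros u Hu. destruct (Hqu u Hu) as [H1 H2], (HL u Hu) as (H3 & H4 & _).
    split; auto. split; auto. split; auto. now apply qd_nonpole with a' si t.
  - assert (Hmu : ex_series (fun j => dlam si t (INR (k + S j)))).
    { apply (ex_series_le (V := R_CompleteNormedModule) _ (fun j => B * / INR (S j) ^ 2)).
      - intros j. change (@norm R_AbsRing R_NormedModule (dlam si t (INR (k + S j)))) with (Rabs (dlam si t (INR (k + S j)))).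
        eapply Rle_trans; [apply Hlam; lia|]. apply Rmult_le_compat_l; auto.
        apply Rinv_le_contravar; [apply pow_lt, lt_0_INR; lia|].
        apply pow_incr. split; [apply pos_INR|apply le_INR; lia].
      - apply (ex_series_scal (V := R_NormedModule) B (fun j => / INR (S j) ^ 2)). apply ex_series_inv_sqr. }
    destruct Hmu as [d Hd].
    assert (Hder : is_derive (fun u => ln (Lam u)) (INR k) d).
    { apply is_derive_quadratic with del (2 * B); [lra|].
      intros h Hh.
      assert (Hk0 : Rabs (INR k - INR k) < del) by (rewrite Rminus_diag, Rabs_R0; lra).
      assert (Hkh : Rabs (INR k + h - INR k) < del) by (replace (INR k + h - INR k) with h by ring; auto).
      assert (L1 := proj2 (proj2 (HL _ Hkh))). assert (L0 := proj2 (proj2 (HL _ Hk0))).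
      assert (Lall : is_lim_seq (fun n => Rabs (log_quot si t (INR k + h) n - log_quot si t (INR k) n
        - h * sum_n (fun j => dlam si t (INR (k + S j))) n))
        (Rabs (ln (Lam (INR k + h)) - ln (Lam (INR k)) - h * d))).
      { apply (is_lim_seq_abs _ (Finite _)). apply is_lim_seq_minus'.
        - apply is_lim_seq_minus'; auto.
        - apply is_lim_seq_mult'; [apply is_lim_seq_const|exact Hd]. }
      apply (is_lim_seq_le _ (fun _ => 2 * B * h ^ 2) _ (2 * B * h ^ 2)) with (2 := Lall)
        (3 := is_lim_seq_const _).
      intros n.
      replace (log_quot si t (INR k + h) n - log_quot si t (INR k) n
        - h * sum_n (fun j => dlam si t (INR (k + S j))) n) with
        (sum_n (fun j => llam si t (INR (k + S j) + h) - llam si t (INR (k + S j))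
          - h * dlam si t (INR (k + S j))) n).
      - apply Rle_trans with (sum_n (fun j => B * h ^ 2 * / INR (S j) ^ 2) n).
        + apply sum_n_Rabs_le. intros j.
          destruct (Hlam (k + S j)%nat ltac:(lia)) as [_ H2].
          eapply Rle_trans; [apply H2; auto|]. apply Rmult_le_compat_l.
          * apply Rmult_le_pos; auto. apply pow2_ge_0.
          * apply Rinv_le_contravar; [apply pow_lt, lt_0_INR; lia|].
            apply pow_incr. split; [apply pos_INR|apply le_INR; lia].
        + rewrite (sum_n_mult_l (B * h ^ 2) (fun j => / INR (S j) ^ 2)).
          change (B * h ^ 2 * sum_n (fun j => / INR (S j) ^ 2) n <= 2 * B * h ^ 2).
          assert (0 < / INR (S n)) by (apply Rinv_0_lt_compat, lt_0_INR; lia).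
          generalize (sum_inv_sqr_bound n). intros Hb.
          replace (2 * B * h ^ 2) with (B * h ^ 2 * 2) by ring.
          apply Rmult_le_compat_l; [|lra]. apply Rmult_le_pos; auto. apply pow2_ge_0.
      - unfold log_quot. induction n.
        + rewrite !sum_O. rewrite <- Hxk.
          replace (INR k + h + 1 + INR 0) with (INR k + 1 + INR 0 + h) by ring.
          match goal with |- ?a = ?b => change (@eq R a b) end. ring.
        + rewrite !sum_Sn.
          match goal with |- Hierarchy.plus ?a ?b = _ => change (Hierarchy.plus a b) with (a + b) end.
          rewrite IHn.
          match goal with |- _ = _ + Hierarchy.plus ?a ?b - (_ + Hierarchy.plus ?a' ?b')
            - _ * Hierarchy.plus ?a'' ?b'' =>
            change (Hierarchy.plus a b) with (a + b); change (Hierarchy.plus a' b') with (a' + b');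
            change (Hierarchy.plus a'' b'') with (a'' + b'') end.
          rewrite <- Hxk.
          replace (INR k + h + 1 + INR (S n)) with (INR k + 1 + INR (S n) + h) by ring.
          match goal with |- ?a = ?b => change (@eq R a b) end. ring. }
    exists (d * exp (ln (Lam (INR k)))).
    apply is_derive_ext_loc with (fun u => exp (ln (Lam u))).
    + assert (Hd0 : 0 < del) by lra. exists (mkposreal _ Hd0). intros u Hu.
      apply exp_ln. apply (HL u). exact Hu.
    + apply (is_derive_comp exp (fun u => ln (Lam u))); [apply is_derive_exp|exact Hder].
Qed.

(** * Square-summable vectors *)

Definition nsq (v : vec) : R :=
  Series (fun k => Cmod (v plus k) ^ 2) + Series (fun k => Cmod (v minus k) ^ 2).

Lemma l2_norm_nsq (v : vec) : l2_norm v = sqrt (nsq v).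
Proof. reflexivity. Qed.

Lemma Series_pos (a : nat -> R) : (forall n, 0 <= a n) -> ex_series a -> 0 <= Series a.
Proof.
  intros H Ha. replace 0 with (Series (fun n => 0 * a n)).
  - apply Series_le; auto. intros n; rewrite Rmult_0_l; split; [lra|auto].
  - rewrite Series_scal_l. ring.
Qed.

Lemma Series_term_le (a : nat -> R) (k : nat) :
  (forall n, 0 <= a n) -> ex_series a -> a k <= Series a.
Proof.
  intros H Ha. rewrite (Series_incr_n a (S k)) by (auto; lia). simpl pred.
  assert (Hk : a k <= sum_f_R0 a k).
  { destruct k; [simpl; lra|]. simpl. generalize (cond_pos_sum a k H). lra. }
  assert (0 <= Series (fun j => a (S k + j)%nat)); [|lra].
  apply Series_pos; [auto|]. now apply (ex_series_incr_n a (S k)).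
Qed.

Lemma in_l2_series_pos (v : vec) (s : sign) : in_l2 v -> 0 <= Series (fun k => Cmod (v s k) ^ 2).
Proof. intros H. apply Series_pos; [intros; apply pow2_ge_0|apply H]. Qed.

Lemma nsq_pos (v : vec) : in_l2 v -> 0 <= nsq v.
Proof.
  intros H. unfold nsq.
  generalize (in_l2_series_pos v plus H) (in_l2_series_pos v minus H). lra.
Qed.

Lemma in_l2_entry (v : vec) (s : sign) (k : nat) : in_l2 v -> Cmod (v s k) <= l2_norm v.
Proof.
  intros H. rewrite <- (sqrt_pow2 (Cmod (v s k))) by apply Cmod_ge_0.
  apply sqrt_le_1_alt.
  assert (H1 := Series_term_le (fun k => Cmod (v s k) ^ 2) k (fun _ => pow2_ge_0 _) (H s)).
  cbv beta in H1. generalize (in_l2_series_pos v plus H) (in_l2_series_pos v minus H).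
  destruct s; lra.
Qed.

Lemma Cmod_plus_sqr (a b : C) : Cmod (a + b) ^ 2 <= 2 * Cmod a ^ 2 + 2 * Cmod b ^ 2.
Proof.
  assert (H := Cmod_triangle a b). assert (0 <= Cmod (a + b)) by apply Cmod_ge_0.
  generalize (pow2_ge_0 (Cmod a - Cmod b)). nra.
Qed.

Lemma ex_series_Rle (a b : nat -> R) :
  (forall n, 0 <= a n <= b n) -> ex_series b -> ex_series a.
Proof.
  intros H Hb. apply (ex_series_le (V := R_CompleteNormedModule) a b); auto.
  intros n. change (Rabs (a n) <= b n). rewrite Rabs_pos_eq; apply H.
Qed.

Lemma ex_series_Rscal (c : R) (a : nat -> R) : ex_series a -> ex_series (fun n => c * a n).
Proof. apply (ex_series_scal (V := R_NormedModule) c a). Qed.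

Lemma ex_series_Rplus (a b : nat -> R) :
  ex_series a -> ex_series b -> ex_series (fun n => a n + b n).
Proof. apply (ex_series_plus (V := R_NormedModule) a b). Qed.

Lemma in_l2_vplus (v w : vec) : in_l2 v -> in_l2 w -> in_l2 (vplus v w).
Proof.
  intros Hv Hw s. apply ex_series_Rle with (fun k => 2 * Cmod (v s k) ^ 2 + 2 * Cmod (w s k) ^ 2).
  - intros k. split; [apply pow2_ge_0|apply Cmod_plus_sqr].
  - apply ex_series_Rplus; now apply ex_series_Rscal.
Qed.

Lemma nsq_vplus (v w : vec) : in_l2 v -> in_l2 w -> nsq (vplus v w) <= 2 * nsq v + 2 * nsq w.
Proof.
  intros Hv Hw.
  assert (H : forall s, Series (fun k => Cmod (vplus v w s k) ^ 2)
    <= 2 * Series (fun k => Cmod (v s k) ^ 2) + 2 * Series (fun k => Cmod (w s k) ^ 2)).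
  { intros s. rewrite <- !Series_scal_l, <- Series_plus by now apply ex_series_Rscal.
    apply Series_le.
    - intros k. split; [apply pow2_ge_0|apply Cmod_plus_sqr].
    - apply ex_series_Rplus; now apply ex_series_Rscal. }
  unfold nsq. generalize (H plus) (H minus). lra.
Qed.

Lemma in_l2_vscal (c : C) (v : vec) : in_l2 v -> in_l2 (vscal c v).
Proof.
  intros Hv s. apply ex_series_ext with (fun k => Cmod c ^ 2 * Cmod (v s k) ^ 2).
  - intros k. unfold vscal. now rewrite Cmod_mult, Rpow_mult_distr.
  - now apply ex_series_Rscal.
Qed.

Lemma nsq_vscal (c : C) (v : vec) : nsq (vscal c v) = Cmod c ^ 2 * nsq v.
Proof.
  unfold nsq. rewrite Rmult_plus_distr_l, <- !Series_scal_l.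
  f_equal; apply Series_ext; intros k; unfold vscal; now rewrite Cmod_mult, Rpow_mult_distr.
Qed.

Lemma geom_in_l2 (v : vec) (M r : R) :
  0 <= M -> 0 <= r < 1 -> (forall s k, Cmod (v s k) <= M * r ^ k) ->
  in_l2 v /\ nsq v <= 2 / (1 - r) * M ^ 2.
Proof.
  intros HM Hr H.
  assert (Hle : forall s k, 0 <= Cmod (v s k) ^ 2 <= M ^ 2 * r ^ k).
  { intros s k. split; [apply pow2_ge_0|].
    assert (0 <= r ^ k <= 1).
    { split; [apply pow_le; lra|]. rewrite <- (pow1 k). apply pow_incr. lra. }
    apply Rle_trans with ((M * r ^ k) ^ 2).
    - apply pow_incr. split; [apply Cmod_ge_0|auto].
    - rewrite Rpow_mult_distr. apply Rmult_le_compat_l; [apply pow2_ge_0|]. nra. }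
  assert (Hex : ex_series (fun k => M ^ 2 * r ^ k)).
  { apply ex_series_Rscal, ex_series_geom. rewrite Rabs_pos_eq; lra. }
  assert (HS : Series (fun k => M ^ 2 * r ^ k) = M ^ 2 * / (1 - r)).
  { rewrite Series_scal_l, Series_geom; [auto|]. rewrite Rabs_pos_eq; lra. }
  split.
  - intros s. now apply ex_series_Rle with (fun k => M ^ 2 * r ^ k).
  - unfold nsq. generalize (Series_le _ _ (Hle plus) Hex) (Series_le _ _ (Hle minus) Hex).
    rewrite HS. unfold Rdiv. lra.
Qed.

Lemma nsq_bound_norm (T : vec -> vec) (B : R) :
  0 <= B -> (forall v, in_l2 v -> nsq (T v) <= B * nsq v) ->
  forall v, in_l2 v -> l2_norm (T v) <= sqrt B * l2_norm v.
Proof.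
  intros HB H v Hv. rewrite !l2_norm_nsq, <- sqrt_mult; auto.
  - now apply sqrt_le_1_alt, H.
  - now apply nsq_pos.
Qed.

(** * Antisymmetric real matrices with geometrically small entries *)

(** Geometric decay of the matrix entries makes all sums converge for merely bounded vectors, and a
    square-summable vector is bounded by its norm. *)
Definition bnd (v : vec) (B : R) : Prop := forall s k, Cmod (v s k) <= B.

Lemma in_l2_bnd (v : vec) : in_l2 v -> bnd v (l2_norm v).
Proof. intros H s k. now apply in_l2_entry. Qed.

Lemma bnd_vscal (c : C) (v : vec) (B : R) : bnd v B -> bnd (vscal c v) (Cmod c * B).
Proof.
  intros Hv s k. unfold vscal. rewrite Cmod_mult.
  apply Rmult_le_compat_l; [apply Cmod_ge_0|apply Hv].
Qed.

Definition mat_op (A : block_matrix) (v : vec) : vec := fun s k =>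
  CSer (fun l => A s k plus l * v plus l + A s k minus l * v minus l)%C.

(** Bilinear, without conjugation, so that antisymmetry of the matrix transfers directly; the
    Hermitian product arises by conjugating the first argument. *)
Definition pairing (g h : vec) : C := CSer (fun k => g plus k * h plus k + g minus k * h minus k)%C.

Section Operator.

Variables (A : block_matrix) (M r : R).
Hypothesis HM : 0 <= M.
Hypothesis Hr : 0 <= r < 1.
Hypothesis HA : forall s k s' l, Cmod (A s k s' l) <= M * r ^ k * r ^ l.
Hypothesis Hanti : forall s k s' l, A s k s' l = (- A s' l s k)%C.
Hypothesis Hreal : forall s k s' l, Im (A s k s' l) = 0.

Lemma bnd_pos (v : vec) (B : R) : bnd v B -> 0 <= B.
Proof. intros H. eapply Rle_trans; [apply Cmod_ge_0|apply (H plus O)]. Qed.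

Lemma mat_op_geom (v : vec) (B : R) (s : sign) (k : nat) :
  bnd v B ->
  geom (fun l => A s k plus l * v plus l + A s k minus l * v minus l)%C (2 * (M * r ^ k * B)) r.
Proof.
  intros Hv. assert (HB := bnd_pos v B Hv).
  assert (H1 : forall s', geom (fun l => A s k s' l * v s' l)%C (M * r ^ k * B) r).
  { intros s'. assert (0 <= r ^ k) by (apply pow_le; lra).
    split; [repeat apply Rmult_le_pos; auto|]. split; auto.
    intros l. rewrite Cmod_mult.
    replace (M * r ^ k * B * r ^ l) with (M * r ^ k * r ^ l * B) by ring.
    apply Rmult_le_compat; auto; try apply Cmod_ge_0. }
  replace (2 * (M * r ^ k * B)) with (M * r ^ k * B + M * r ^ k * B) by ring.
  now apply geom_plus.
Qed.

Lemma mat_op_entry (v : vec) (B : R) (s : sign) (k : nat) :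
  bnd v B -> Cmod (mat_op A v s k) <= 2 * M * B / (1 - r) * r ^ k.
Proof.
  intros Hv. eapply Rle_trans; [apply (CSer_bound _ _ _ (mat_op_geom v B s k Hv))|].
  right. field. lra.
Qed.

Lemma mat_op_bnd (v : vec) (B : R) : bnd v B -> bnd (mat_op A v) (2 * M * B / (1 - r)).
Proof.
  intros Hv s k. eapply Rle_trans; [apply (mat_op_entry v B s k Hv)|].
  assert (HB := bnd_pos v B Hv).
  rewrite <- (Rmult_1_r (2 * M * B / (1 - r))) at 2. apply Rmult_le_compat_l.
  - apply Rmult_le_pos; [nra|]. left; apply Rinv_0_lt_compat; lra.
  - rewrite <- (pow1 k). apply pow_incr. lra.
Qed.

Lemma mat_op_vplus (v w : vec) (B B' : R) :
  bnd v B -> bnd w B' -> mat_op A (vplus v w) = vplus (mat_op A v) (mat_op A w).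
Proof.
  intros Hv Hw. apply functional_extensionality; intros s; apply functional_extensionality; intros k.
  unfold mat_op, vplus. rewrite <- (CSer_plus _ _ _ _ _ _ (mat_op_geom v B s k Hv)
    (mat_op_geom w B' s k Hw)).
  apply CSer_ext. intros l. ring.
Qed.

Lemma mat_op_vscal (c : C) (v : vec) (B : R) :
  bnd v B -> mat_op A (vscal c v) = vscal c (mat_op A v).
Proof.
  intros Hv. apply functional_extensionality; intros s; apply functional_extensionality; intros k.
  unfold mat_op, vscal. rewrite <- (CSer_scal _ _ _ _ (mat_op_geom v B s k Hv)).
  apply CSer_ext. intros l. ring.
Qed.

Lemma pairing_antisym (g h : vec) (B B' : R) :
  bnd g B -> bnd h B' -> pairing g (mat_op A h) = (- pairing (mat_op A g) h)%C.
Proof.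
  intros Hg Hh. assert (HB := bnd_pos g B Hg). assert (HB' := bnd_pos h B' Hh).
  set (c := fun k l => (g plus k * (A plus k plus l * h plus l + A plus k minus l * h minus l)
    + g minus k * (A minus k plus l * h plus l + A minus k minus l * h minus l))%C).
  assert (Hc1 : forall s k l, Cmod (g s k * (A s k plus l * h plus l + A s k minus l * h minus l))
    <= 2 * M * B * B' * r ^ k * r ^ l).
  { intros s k l. rewrite Cmod_mult. destruct (mat_op_geom h B' s k Hh) as (_ & _ & H).
    apply Rle_trans with (B * (2 * (M * r ^ k * B') * r ^ l)).
    - apply Rmult_le_compat; try apply Cmod_ge_0; [apply Hg|apply (H l)].
    - right; ring. }
  assert (Hc : geom2 c (4 * M * B * B') r).
  { split; [repeat apply Rmult_le_pos; auto; lra|]. split; auto. intros k l. unfold c.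
    eapply Rle_trans; [apply Cmod_triangle|]. generalize (Hc1 plus k l) (Hc1 minus k l). lra. }
  assert (E1 : pairing g (mat_op A h) = CSer (fun k => CSer (c k))).
  { apply CSer_ext. intros k. unfold mat_op, c.
    rewrite <- (CSer_scal (g plus k) _ _ _ (mat_op_geom h B' plus k Hh)),
      <- (CSer_scal (g minus k) _ _ _ (mat_op_geom h B' minus k Hh)).
    symmetry. eapply CSer_plus; apply geom_scal; apply (mat_op_geom h B'); auto. }
  assert (E2 : pairing (mat_op A g) h = CSer (fun l => - (1) * CSer (fun k => c k l))%C).
  { apply CSer_ext. intros l. unfold mat_op.
    rewrite <- (CSer_scal _ _ _ _ (geom2_row _ _ _ l (geom2_flip _ _ _ Hc))).
    rewrite (Cmult_comm (CSer _) (h plus l)), (Cmult_comm (CSer _) (h minus l)).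
    rewrite <- (CSer_scal (h plus l) _ _ _ (mat_op_geom g B plus l Hg)),
      <- (CSer_scal (h minus l) _ _ _ (mat_op_geom g B minus l Hg)).
    erewrite <- CSer_plus; [|apply geom_scal, (mat_op_geom g B); auto
      |apply geom_scal, (mat_op_geom g B); auto].
    apply CSer_ext. intros k. unfold c.
    rewrite (Hanti plus k plus l), (Hanti plus k minus l), (Hanti minus k plus l),
      (Hanti minus k minus l). ring. }
  rewrite E1, E2, (CSer_swap _ _ _ Hc).
  rewrite (CSer_scal _ _ _ _ (geom2_sum _ _ _ (geom2_flip _ _ _ Hc))). ring.
Qed.

Lemma pairing_geom (g h : vec) (B M' r' : R) :
  0 <= M' -> 0 <= r' < 1 -> bnd g B -> (forall s k, Cmod (h s k) <= M' * r' ^ k) ->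
  geom (fun k => g plus k * h plus k + g minus k * h minus k)%C (B * M' + B * M') r'.
Proof.
  intros HM' Hr' Hg Hh.
  apply geom_plus; apply geom_bounded_mult; try (intros; apply Hg); (split; [auto|split; auto]).
Qed.

(** As A is real and antisymmetric, the pairing of the conjugate of v with A v is minus its own
    complex conjugate. *)
Lemma pairing_conj_re (v : vec) (B : R) :
  bnd v B -> Re (pairing (fun s k => Cconj (v s k)) (mat_op A v)) = 0.
Proof.
  intros Hv. set (w := fun s k => Cconj (v s k)).
  assert (Hw : bnd w B) by (intros s k; unfold w; rewrite Cmod_conj; apply Hv).
  assert (E : pairing w (mat_op A v) = (- pairing (mat_op A w) v)%C)
    by now apply (pairing_antisym w v B B).
  assert (HAc : forall s k s' l, Cconj (A s k s' l) = A s k s' l).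
  { intros s k s' l. apply C_ext; simpl; [reflexivity|]. generalize (Hreal s k s' l).
    destruct (A s k s' l); simpl. intros ->. ring. }
  assert (Hcc : forall a M' r', geom a M' r' -> CSer (fun n => Cconj (a n)) = Cconj (CSer a)).
  { intros a M' r' Ha. destruct (CSer_correct _ _ _ Ha) as [H1 H2].
    apply CSer_unique.
    assert (Es : forall n, csum (fun n => Cconj (a n)) n = Cconj (csum a n)).
    { induction n; simpl; [apply C_ext; simpl; ring|].
      rewrite IHn, Cplus_conj. reflexivity. }
    split.
    - apply is_lim_seq_ext with (2 := H1). intros n. now rewrite Es.
    - apply is_lim_seq_ext with (fun n => - Im (csum a n)); [intros n; now rewrite Es|].
      apply (is_lim_seq_opp _ (Im (CSer a))). exact H2. }
  assert (Ew : forall s k, mat_op A w s k = Cconj (mat_op A v s k)).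
  { intros s k. unfold mat_op. rewrite <- (Hcc _ _ _ (mat_op_geom v B s k Hv)).
    apply CSer_ext. intros l. unfold w. now rewrite Cplus_conj, !Cmult_conj, !HAc. }
  assert (Hg : geom (fun k => w plus k * mat_op A v plus k + w minus k * mat_op A v minus k)%C
    (B * (2 * M * B / (1 - r)) + B * (2 * M * B / (1 - r))) r).
  { apply pairing_geom; auto.
    - assert (HB := bnd_pos v B Hv). apply Rmult_le_pos; [nra|].
      left; apply Rinv_0_lt_compat; lra.
    - intros s k. now apply mat_op_entry. }
  assert (E2 : pairing (mat_op A w) v = Cconj (pairing w (mat_op A v))).
  { unfold pairing at 2. rewrite <- (Hcc _ _ _ Hg). apply CSer_ext. intros k.
    rewrite Cplus_conj, !Cmult_conj, !Ew. unfold w. rewrite !Cconj_conj. ring. }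
  rewrite E2 in E. apply (f_equal Re) in E.
  change (Re (- Cconj (pairing w (mat_op A v)))) with (- Re (pairing w (mat_op A v))) in E. lra.
Qed.

(** A bound on the squared operator norm: 2 M / (1 - r) bounds the sum over a row, and 2 / (1 - r)
    comes from summing the decay in k over the two components. *)
Let C2 := 2 / (1 - r) * (2 * M / (1 - r)) ^ 2.

Lemma C2_pos : 0 <= C2.
Proof.
  unfold C2. apply Rmult_le_pos; [|apply pow2_ge_0].
  apply Rmult_le_pos; [lra|]. left; apply Rinv_0_lt_compat; lra.
Qed.

Lemma norm_pos (v : vec) : 0 <= l2_norm v.
Proof. apply sqrt_pos. Qed.

Lemma norm_sqr (v : vec) : in_l2 v -> l2_norm v ^ 2 = nsq v.
Proof. intros H. rewrite l2_norm_nsq. apply pow2_sqrt. now apply nsq_pos. Qed.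

Lemma mat_op_l2 (v : vec) (B : R) :
  bnd v B -> in_l2 (mat_op A v) /\ nsq (mat_op A v) <= C2 * B ^ 2.
Proof.
  intros Hv. assert (HB := bnd_pos v B Hv).
  destruct (geom_in_l2 (mat_op A v) (2 * M * B / (1 - r)) r) as [H1 H2]; auto.
  - apply Rmult_le_pos; [nra|]. left; apply Rinv_0_lt_compat; lra.
  - intros s k. now apply mat_op_entry.
  - split; auto. eapply Rle_trans; [exact H2|]. unfold C2. right. field. lra.
Qed.

Lemma mat_op_bounded : bounded_operator (mat_op A).
Proof.
  split; [|split; [|split]].
  - intros v Hv. apply (mat_op_l2 v (l2_norm v)). now apply in_l2_bnd.
  - intros v w Hv Hw. apply mat_op_vplus with (l2_norm v) (l2_norm w); now apply in_l2_bnd.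
  - intros c v Hv. apply mat_op_vscal with (l2_norm v). now apply in_l2_bnd.
  - exists (sqrt C2). apply nsq_bound_norm; [apply C2_pos|].
    intros v Hv. rewrite <- (norm_sqr v Hv). apply mat_op_l2. now apply in_l2_bnd.
Qed.

(** [1 + A] is inverted by the Neumann series of the contraction
    [1 - rho (1 + A)]; it is a contraction because [A] is antisymmetric. *)
Let rho := / (1 + C2).

Lemma rho_range : 0 < rho <= 1.
Proof.
  assert (H := C2_pos). unfold rho. split; [apply Rinv_0_lt_compat; lra|].
  rewrite <- Rinv_1. apply Rinv_le_contravar; lra.
Qed.

Definition step (v : vec) : vec :=
  vplus (vscal (1 - RtoC rho)%C v) (vscal (- RtoC rho)%C (mat_op A v)).

Lemma step_l2 (v : vec) : in_l2 v -> in_l2 (step v).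
Proof.
  intros Hv. apply in_l2_vplus; apply in_l2_vscal; auto. now apply mat_op_bounded.
Qed.

(** The cross term vanishes by [pairing_conj_re], so the squared norm is multiplied by at most (1 -
    rho)^2 + rho^2 C2. The choice rho = 1 / (1 + C2) minimises this factor, with value 1 - rho. *)
Lemma step_contract (v : vec) : in_l2 v -> nsq (step v) <= (1 - rho) * nsq v.
Proof.
  intros Hv. assert (Hb := in_l2_bnd v Hv). assert (Hrho := rho_range).
  assert (HLv : in_l2 (mat_op A v)) by now apply mat_op_bounded.
  assert (HLn : nsq (mat_op A v) <= C2 * nsq v).
  { rewrite <- (norm_sqr v Hv). now apply mat_op_l2. }
  set (x := fun s k => Re (Cconj (v s k) * mat_op A v s k)).
  assert (E : forall s k, Cmod (step v s k) ^ 2 = (1 - rho) ^ 2 * Cmod (v s k) ^ 2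
    + (rho ^ 2 * Cmod (mat_op A v s k) ^ 2 + (- 2 * rho * (1 - rho)) * x s k)).
  { intros s k. rewrite !Cmod2_alt. unfold x, step, vplus, vscal.
    destruct (v s k) as [a b], (mat_op A v s k) as [c d]. simpl. ring. }
  assert (Hx : forall s, ex_series (x s)).
  { intros s. apply ex_series_Rabs.
    apply ex_series_Rle with (fun k => (Cmod (v s k) ^ 2 + Cmod (mat_op A v s k) ^ 2)).
    - intros k. split; [apply Rabs_pos|]. unfold x.
      eapply Rle_trans; [apply re_le_Cmod|]. rewrite Cmod_mult, Cmod_conj.
      generalize (pow2_ge_0 (Cmod (v s k) - Cmod (mat_op A v s k))).
      generalize (Cmod_ge_0 (v s k)) (Cmod_ge_0 (mat_op A v s k)). nra.
    - apply ex_series_Rplus; [apply Hv|apply HLv]. }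
  assert (E2 : forall s, Series (fun k => Cmod (step v s k) ^ 2)
    = (1 - rho) ^ 2 * Series (fun k => Cmod (v s k) ^ 2)
    + (rho ^ 2 * Series (fun k => Cmod (mat_op A v s k) ^ 2)
    + (- 2 * rho * (1 - rho)) * Series (x s))).
  { intros s. rewrite (Series_ext _ _ (E s)).
    rewrite Series_plus, Series_plus, !Series_scal_l; auto.
    - apply ex_series_Rscal, HLv.
    - apply ex_series_Rscal, Hx.
    - apply ex_series_Rscal, Hv.
    - apply ex_series_Rplus; apply ex_series_Rscal; [apply HLv|apply Hx]. }
  assert (E0 : Series (x plus) + Series (x minus) = 0).
  { rewrite <- Series_plus by auto. apply is_series_unique.
    rewrite <- (pairing_conj_re v _ Hb).
    assert (Hg : geom (fun k => Cconj (v plus k) * mat_op A v plus k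
      + Cconj (v minus k) * mat_op A v minus k)%C
      (l2_norm v * (2 * M * l2_norm v / (1 - r)) + l2_norm v * (2 * M * l2_norm v / (1 - r))) r).
    { apply (pairing_geom (fun s k => Cconj (v s k)) (mat_op A v)); auto.
      - assert (HB := norm_pos v). apply Rmult_le_pos; [nra|].
        left; apply Rinv_0_lt_compat; lra.
      - intros s k. rewrite Cmod_conj. apply Hb.
      - intros s k. now apply mat_op_entry. }
    destruct (CSer_correct _ _ _ Hg) as [H1 _].
    apply (is_lim_seq_incr_1 (fun n => Re (csum (fun k => Cconj (v plus k) * mat_op A v plus k
      + Cconj (v minus k) * mat_op A v minus k)%C n))) in H1.
    apply is_lim_seq_ext with (2 := H1). intros n.
    induction n.
    - rewrite sum_O. unfold x. simpl. ring.
    - rewrite sum_Sn, <- IHn. unfold x at 1 2. simpl.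
      match goal with |- _ = Hierarchy.plus ?a ?b => change (Hierarchy.plus a b) with (a + b) end.
      ring. }
  unfold nsq in *. rewrite !E2.
  replace (Series (x plus)) with (- Series (x minus)) by lra.
  assert (Hp := nsq_pos v Hv). unfold nsq in Hp.
  set (n1 := Series (fun k => Cmod (v plus k) ^ 2)) in *.
  set (n2 := Series (fun k => Cmod (v minus k) ^ 2)) in *.
  set (m1 := Series (fun k => Cmod (mat_op A v plus k) ^ 2)) in *.
  set (m2 := Series (fun k => Cmod (mat_op A v minus k) ^ 2)) in *.
  apply Rle_trans with ((1 - rho) ^ 2 * (n1 + n2) + rho ^ 2 * (C2 * (n1 + n2))).
  - assert (0 <= rho ^ 2) by apply pow2_ge_0. nra.
  - assert (Er : rho * (1 + C2) = 1) by (unfold rho; apply Rinv_l; generalize C2_pos; lra).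
    right. replace ((1 - rho) ^ 2 * (n1 + n2) + rho ^ 2 * (C2 * (n1 + n2)))
      with ((1 - 2 * rho + rho * (rho * (1 + C2))) * (n1 + n2)) by ring.
    rewrite Er. ring.
Qed.

Fixpoint steps (n : nat) (v : vec) : vec :=
  match n with O => v | S m => step (steps m v) end.

Lemma steps_l2 (n : nat) (v : vec) : in_l2 v -> in_l2 (steps n v).
Proof. intros Hv. induction n; simpl; auto. now apply step_l2. Qed.

Let kap := sqrt (1 - rho).

Lemma kap_range : 0 <= kap < 1.
Proof.
  assert (H := rho_range). unfold kap. split; [apply sqrt_pos|].
  rewrite <- sqrt_1 at 2. apply sqrt_lt_1; lra.
Qed.

Lemma steps_norm (n : nat) (v : vec) : in_l2 v -> l2_norm (steps n v) <= l2_norm v * kap ^ n.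
Proof.
  intros Hv. induction n; simpl; [lra|].
  assert (Hn := steps_l2 n v Hv). assert (Hrho := rho_range).
  apply Rle_trans with (kap * l2_norm (steps n v)).
  - rewrite !l2_norm_nsq. unfold kap. rewrite <- sqrt_mult by (try lra; now apply nsq_pos).
    now apply sqrt_le_1_alt, step_contract.
  - assert (Hk := kap_range). nra.
Qed.

Lemma steps_geom (v : vec) (s : sign) (k : nat) :
  in_l2 v -> geom (fun n => steps n v s k) (l2_norm v) kap.
Proof.
  intros Hv. split; [apply norm_pos|]. split; [apply kap_range|].
  intros n. eapply Rle_trans; [apply in_l2_entry, steps_l2, Hv|now apply steps_norm].
Qed.

Definition neumann (v : vec) : vec := fun s k => (rho * CSer (fun n => steps n v s k))%C.

Lemma neumann_bnd (v : vec) : in_l2 v -> bnd (neumann v) (rho * (l2_norm v / (1 - kap))).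
Proof.
  intros Hv s k. unfold neumann. rewrite Cmod_mult, Cmod_RtoC_pos by (generalize rho_range; lra).
  apply Rmult_le_compat_l; [generalize rho_range; lra|]. now apply CSer_bound, steps_geom.
Qed.

Lemma mat_op_neumann_series (v : vec) (s : sign) (k : nat) :
  in_l2 v -> mat_op A (neumann v) s k = (rho * CSer (fun n => mat_op A (steps n v) s k))%C.
Proof.
  intros Hv. assert (Hk := kap_range). assert (HN := norm_pos v).
  set (c := fun l n => (A s k plus l * steps n v plus l + A s k minus l * steps n v minus l)%C).
  set (r' := Rmax r kap).
  assert (Hr' : 0 <= r' < 1).
  { unfold r'. split; [eapply Rle_trans; [apply Hr|apply Rmax_l]|apply Rmax_lub_lt; lra]. }
  assert (Hrk : 0 <= r ^ k) by (apply pow_le; lra).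
  assert (Hc : geom2 c (2 * (M * r ^ k * l2_norm v)) r').
  { split; [repeat apply Rmult_le_pos; auto; lra|]. split; auto. intros l n. unfold c.
    destruct (mat_op_geom (steps n v) (l2_norm v * kap ^ n) s k) as (_ & _ & H).
    - intros s' l'. eapply Rle_trans; [apply in_l2_entry, steps_l2, Hv|now apply steps_norm].
    - eapply Rle_trans; [apply (H l)|].
      replace (2 * (M * r ^ k * (l2_norm v * kap ^ n)) * r ^ l) with
        (2 * (M * r ^ k * l2_norm v) * r ^ l * kap ^ n) by ring.
      assert (0 <= 2 * (M * r ^ k * l2_norm v)) by (repeat apply Rmult_le_pos; auto; lra).
      apply Rmult_le_compat; try (apply pow_le; lra).
      + apply Rmult_le_pos; auto. apply pow_le; lra.
      + apply Rmult_le_compat_l; auto. apply pow_incr. split; [lra|apply Rmax_l].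
      + apply pow_incr. split; [lra|apply Rmax_r]. }
  change (CSer (fun n => mat_op A (steps n v) s k)) with (CSer (fun n => CSer (fun l => c l n))).
  rewrite <- (CSer_swap _ _ _ Hc), <- (CSer_scal _ _ _ _ (geom2_sum _ _ _ Hc)).
  apply CSer_ext. intros l. unfold c, neumann.
  rewrite (CSer_plus _ _ _ _ _ _ (geom_scal (A s k plus l) _ _ _ (steps_geom v plus l Hv))
    (geom_scal (A s k minus l) _ _ _ (steps_geom v minus l Hv))).
  rewrite (CSer_scal _ _ _ _ (steps_geom v plus l Hv)),
    (CSer_scal _ _ _ _ (steps_geom v minus l Hv)). ring.
Qed.

(** By definition of [step], rho A w = (1 - rho) w - step w. Summed over the iterates w of v, the
    right side telescopes to v - [neumann v]. *)
Lemma mat_op_neumann (v : vec) (s : sign) (k : nat) :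
  in_l2 v -> mat_op A (neumann v) s k = (v s k - neumann v s k)%C.
Proof.
  intros Hv. rewrite mat_op_neumann_series by auto.
  assert (Hg := steps_geom v s k Hv). assert (Hrho := rho_range).
  assert (Hr0 : RtoC rho <> 0%C) by (intros E; apply RtoC_inj in E; lra).
  destruct Hg as (G1 & G2 & G3).
  assert (Hg : geom (fun n => steps n v s k) (l2_norm v) kap) by (split; [auto|split; auto]).
  assert (HgS : geom (fun n => steps (S n) v s k) (l2_norm v * kap) kap).
  { split; [apply Rmult_le_pos; lra|]. split; auto. intros n.
    eapply Rle_trans; [apply (G3 (S n))|]. simpl. right; ring. }
  rewrite (CSer_ext _ (fun n => (1 - rho) / rho * steps n v s k
    + (- / rho) * steps (S n) v s k)%C).
  - rewrite (CSer_plus _ _ _ _ _ _ (geom_scal _ _ _ _ Hg) (geom_scal _ _ _ _ HgS)).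
    rewrite (CSer_scal _ _ _ _ Hg), (CSer_scal _ _ _ _ HgS).
    unfold neumann. rewrite (CSer_S _ _ _ Hg).
    change (steps 0 v s k) with (v s k).
    set (T := CSer (fun n => steps (S n) v s k)).
    field. auto.
  - intros n. simpl. unfold step, vplus, vscal. field. auto.
Qed.

(** The entrywise sum of the Neumann series is at first only known to be bounded. This identity
    makes it square-summable, since [mat_op A] sends bounded vectors to geometrically decaying
    ones. *)
Lemma neumann_split (v : vec) :
  in_l2 v -> neumann v = vplus v (vscal (- (1)) (mat_op A (neumann v))).
Proof.
  intros Hv. apply functional_extensionality; intros s; apply functional_extensionality; intros k.
  unfold vplus, vscal. rewrite mat_op_neumann by auto. ring.
Qed.

Lemma step_vplus (v w : vec) : in_l2 v -> in_l2 w -> step (vplus v w) = vplus (step v) (step w).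
Proof.
  intros Hv Hw. unfold step.
  rewrite (mat_op_vplus v w _ _ (in_l2_bnd v Hv) (in_l2_bnd w Hw)).
  apply functional_extensionality; intros s; apply functional_extensionality; intros k.
  unfold vplus, vscal. ring.
Qed.

Lemma step_vscal (c : C) (v : vec) : in_l2 v -> step (vscal c v) = vscal c (step v).
Proof.
  intros Hv. unfold step. rewrite (mat_op_vscal c v _ (in_l2_bnd v Hv)).
  apply functional_extensionality; intros s; apply functional_extensionality; intros k.
  unfold vplus, vscal. ring.
Qed.

Lemma step_mat_op (v : vec) : in_l2 v -> step (mat_op A v) = mat_op A (step v).
Proof.
  intros Hv. assert (HL := proj1 mat_op_bounded v Hv). unfold step.
  rewrite (mat_op_vplus _ _ _ _ (bnd_vscal (1 - RtoC rho)%C _ _ (in_l2_bnd v Hv))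
    (bnd_vscal (- RtoC rho)%C _ _ (in_l2_bnd _ HL))).
  rewrite (mat_op_vscal _ v _ (in_l2_bnd v Hv)), (mat_op_vscal _ _ _ (in_l2_bnd _ HL)).
  reflexivity.
Qed.

Lemma neumann_vplus (v w : vec) :
  in_l2 v -> in_l2 w -> neumann (vplus v w) = vplus (neumann v) (neumann w).
Proof.
  intros Hv Hw.
  assert (E : forall n, steps n (vplus v w) = vplus (steps n v) (steps n w)).
  { induction n; simpl; auto. rewrite IHn. apply step_vplus; now apply steps_l2. }
  apply functional_extensionality; intros s; apply functional_extensionality; intros k.
  unfold neumann, vplus at 2.
  rewrite (CSer_ext _ (fun n => steps n v s k + steps n w s k)%C) by (intros n; now rewrite E).
  rewrite (CSer_plus _ _ _ _ _ _ (steps_geom v s k Hv) (steps_geom w s k Hw)). ring.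
Qed.

Lemma neumann_vscal (c : C) (v : vec) : in_l2 v -> neumann (vscal c v) = vscal c (neumann v).
Proof.
  intros Hv.
  assert (E : forall n, steps n (vscal c v) = vscal c (steps n v)).
  { induction n; simpl; auto. rewrite IHn. apply step_vscal; now apply steps_l2. }
  apply functional_extensionality; intros s; apply functional_extensionality; intros k.
  unfold neumann, vscal at 2.
  rewrite (CSer_ext _ (fun n => c * steps n v s k)%C) by (intros n; now rewrite E).
  rewrite (CSer_scal _ _ _ _ (steps_geom v s k Hv)). ring.
Qed.

(** The iteration commutes with A; hence the right inverse provided by [mat_op_neumann] is also a
    left inverse. *)
Lemma neumann_mat_op (v : vec) : in_l2 v -> neumann (mat_op A v) = mat_op A (neumann v).
Proof.
  intros Hv.
  assert (E : forall n, steps n (mat_op A v) = mat_op A (steps n v)).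
  { induction n; simpl; auto. rewrite IHn. apply step_mat_op; now apply steps_l2. }
  apply functional_extensionality; intros s; apply functional_extensionality; intros k.
  rewrite mat_op_neumann_series by auto. unfold neumann. f_equal. apply CSer_ext.
  intros n. now rewrite E.
Qed.

Lemma neumann_bounded : bounded_operator neumann.
Proof.
  assert (Hk := kap_range). assert (Hrho := rho_range). assert (HC2 := C2_pos).
  set (D := 2 + 2 * (C2 * (rho / (1 - kap)) ^ 2)).
  assert (H : forall v, in_l2 v -> in_l2 (neumann v) /\ nsq (neumann v) <= D * nsq v).
  { intros v Hv. destruct (mat_op_l2 _ _ (neumann_bnd v Hv)) as [H1 H2].
    rewrite (neumann_split v Hv).
    assert (H3 := in_l2_vscal (- (1)) _ H1). split; [now apply in_l2_vplus|].
    eapply Rle_trans; [now apply nsq_vplus|]. rewrite nsq_vscal, Cmod_m1.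
    replace (C2 * (rho * (l2_norm v / (1 - kap))) ^ 2)
      with (C2 * (rho / (1 - kap)) ^ 2 * l2_norm v ^ 2) in H2 by (field; lra).
    rewrite norm_sqr in H2 by auto. unfold D. lra. }
  split; [|split; [|split]].
  - intros v Hv. now apply H.
  - apply neumann_vplus.
  - apply neumann_vscal.
  - exists (sqrt D). apply nsq_bound_norm.
    + unfold D. assert (0 <= C2 * (rho / (1 - kap)) ^ 2); [|lra].
      apply Rmult_le_pos; [auto|apply pow2_ge_0].
    + intros v Hv. now apply H.
Qed.

Lemma neumann_inverse : is_inverse (id_plus (mat_op A)) neumann.
Proof.
  split; [apply neumann_bounded|]. intros v Hv.
  assert (HL := proj1 mat_op_bounded v Hv).
  assert (E : vplus (neumann v) (mat_op A (neumann v)) = v).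
  { apply functional_extensionality; intros s; apply functional_extensionality; intros k.
    unfold vplus. rewrite mat_op_neumann by auto. ring. }
  split; [|exact E].
  unfold id_plus. rewrite neumann_vplus, neumann_mat_op by auto. exact E.
Qed.

Lemma mat_op_neumann_bounded : bounded_operator (fun v => mat_op A (neumann v)).
Proof.
  destruct mat_op_bounded as (L1 & L2 & L3 & ML & L4).
  destruct neumann_bounded as (N1 & N2 & N3 & MN & N4).
  split; [|split; [|split]].
  - auto.
  - intros v w Hv Hw. rewrite N2, L2; auto.
  - intros c v Hv. rewrite N3, L3; auto.
  - exists (Rabs ML * Rabs MN). intros v Hv.
    eapply Rle_trans; [apply L4, N1, Hv|].
    apply Rle_trans with (Rabs ML * l2_norm (neumann v)).
    + apply Rmult_le_compat_r; [apply norm_pos|apply Rle_abs].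
    + rewrite Rmult_assoc. apply Rmult_le_compat_l; [apply Rabs_pos|].
      eapply Rle_trans; [apply N4, Hv|].
      apply Rmult_le_compat_r; [apply norm_pos|apply Rle_abs].
Qed.

Lemma basis_vec_l2 (s : sign) (l : nat) : in_l2 (basis_vec s l).
Proof.
  intros s'. apply (ex_series_incr_n _ (S l)).
  apply ex_series_ext with (fun k => 0 * (1 / 2) ^ k).
  - intros k. assert (Hk : Nat.eqb l (S l + k) = false) by (apply PeanoNat.Nat.eqb_neq; lia).
    unfold basis_vec. rewrite Hk, Rmult_0_l.
    destruct s, s'; rewrite Cmod_0; symmetry; apply pow_i; lia.
  - apply ex_series_Rscal, ex_series_geom. rewrite Rabs_pos_eq; lra.
Qed.

Lemma CSer_single (a : nat -> C) (l : nat) : (forall k, k <> l -> a k = 0%C) -> CSer a = a l.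
Proof.
  intros H. apply CSer_unique. apply (Clim_shift _ _ (S l)).
  apply Clim_ext with (fun _ => a l); [|apply Clim_const].
  assert (E0 : forall m, (m <= l)%nat -> csum a m = 0%C).
  { induction m; intros Hm; simpl; auto. rewrite IHm, H by lia. ring. }
  intros n. induction n.
  - simpl. rewrite E0 by lia. ring.
  - simpl. rewrite <- IHn, (H (n + S l)%nat) by lia. ring.
Qed.

Lemma mat_op_basis (s s' : sign) (k l : nat) : mat_op A (basis_vec s' l) s k = A s k s' l.
Proof.
  unfold mat_op. rewrite (CSer_single _ l).
  - unfold basis_vec. rewrite PeanoNat.Nat.eqb_refl. destruct s'; ring.
  - intros m Hm. assert (E : Nat.eqb l m = false) by (apply PeanoNat.Nat.eqb_neq; auto).
    unfold basis_vec. rewrite E. destruct s'; ring.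
Qed.

Lemma pairing_basis (g : vec) (s : sign) (l : nat) : pairing g (basis_vec s l) = g s l.
Proof.
  unfold pairing. rewrite (CSer_single _ l).
  - unfold basis_vec. rewrite PeanoNat.Nat.eqb_refl. destruct s; ring.
  - intros m Hm. assert (E : Nat.eqb l m = false) by (apply PeanoNat.Nat.eqb_neq; auto).
    unfold basis_vec. rewrite E. destruct s; ring.
Qed.

End Operator.

(** * Bookkeeping for the two signs *)

Definition op (s : sign) : sign := match s with plus => minus | minus => plus end.

Definition sgn (s : sign) : R := match s with plus => 1 | minus => - 1 end.

Lemma op_op (s : sign) : op (op s) = s.
Proof. now destruct s. Qed.

Lemma sgn_op (s : sign) : sgn (op s) = - sgn s.
Proof. destruct s; simpl; ring. Qed.

Lemma sgn_sqr (s : sign) : sgn s * sgn s = 1.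
Proof. destruct s; simpl; ring. Qed.

Lemma sign_cases (s s' : sign) : s' = s \/ s' = op s.
Proof. destruct s, s'; auto. Qed.

Lemma Cmod_sgn (s : sign) : Cmod (sgn s) = 1.
Proof.
  rewrite Cmod_R. destruct s; simpl; unfold Rabs; destruct (Rcase_abs _); lra.
Qed.

Lemma sum_signs (g : sign -> C) (s : sign) : (g plus + g minus)%C = (g s + g (op s))%C.
Proof. destruct s; simpl; ring. Qed.

(** * The kernel of L (1 + L)^(-1) for an abstract matrix of Cauchy type *)

Section Kernel.

(** Here f stands for psi^(1/2) on Z_+, and p, q for the values of P and Q divided by psi^(1/2).
    Keeping just the bounds and the relations [Hp], [Hq] separates the linear algebra from the
    special functions. *)
Variables (f : sign -> nat -> R) (p q : sign -> nat -> C) (M r B : R).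
Hypothesis HM : 0 <= M.
Hypothesis Hr : 0 <= r < 1.
Hypothesis Hf : forall s k, 0 <= f s k <= M * r ^ k.
Hypothesis HpB : forall s k, Cmod (p s k) <= B.
Hypothesis HqB : forall s k, Cmod (q s k) <= B.
Hypothesis Hp : forall s k, p s k =
  (1 - CSer (fun m => f (op s) m * f (op s) m * q (op s) m / (INR k + INR m + 1)))%C.
Hypothesis Hq : forall s k, q s k =
  CSer (fun m => f (op s) m * f (op s) m * p (op s) m / (INR k + INR m + 1))%C.

Definition cauchy_block : block_matrix := fun s k s' l =>
  match s, s' with
  | plus, plus | minus, minus => 0%C
  | _, _ => (sgn s * f s k * f s' l / (INR k + INR l + 1))%C
  end.

Lemma cauchy_block_same (s : sign) (k l : nat) : cauchy_block s k s l = 0%C.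
Proof. now destruct s. Qed.

Lemma cauchy_block_op (s : sign) (k l : nat) :
  cauchy_block s k (op s) l = (sgn s * f s k * f (op s) l / (INR k + INR l + 1))%C.
Proof. now destruct s. Qed.

Lemma INR_pos_neq_0 (k l : nat) : (RtoC (INR k) + RtoC (INR l) + 1)%C <> 0%C.
Proof. apply (pf_neq_0 (INR k) l). generalize (pos_INR k); lra. Qed.

Lemma Cmod_inv_INR (k l : nat) : Cmod (/ (INR k + INR l + 1)) <= 1.
Proof.
  eapply Rle_trans; [apply (Cmod_inv_pf (INR k) l); generalize (pos_INR k); lra|].
  rewrite <- Rinv_1 at 2. apply Rinv_le_contravar; generalize (pos_INR k); lra.
Qed.

Lemma cauchy_block_bound (s : sign) (k : nat) (s' : sign) (l : nat) :
  Cmod (cauchy_block s k s' l) <= M * M * r ^ k * r ^ l.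
Proof.
  assert (H0 : 0 <= M * M * r ^ k * r ^ l).
  { repeat apply Rmult_le_pos; auto; apply pow_le; lra. }
  destruct (sign_cases s s') as [-> | ->]; [rewrite cauchy_block_same, Cmod_0; auto|].
  rewrite cauchy_block_op. unfold Cdiv. rewrite !Cmod_mult.
  destruct (Hf s k) as [F1 F2], (Hf (op s) l) as [F3 F4].
  rewrite (Cmod_RtoC_pos (f s k)), (Cmod_RtoC_pos (f (op s) l)) by auto.
  rewrite Cmod_sgn.
  apply Rle_trans with (M * r ^ k * (M * r ^ l) * 1).
  - rewrite Rmult_1_l. apply Rmult_le_compat; try apply Cmod_inv_INR; try apply Cmod_ge_0.
    + now apply Rmult_le_pos.
    + now apply Rmult_le_compat.
  - right; ring.
Qed.

Lemma cauchy_block_anti (s : sign) (k : nat) (s' : sign) (l : nat) : cauchy_block s k s' l = (- cauchy_block s' l s k)%C.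
Proof.
  destruct (sign_cases s s') as [-> | ->]; [rewrite !cauchy_block_same; now rewrite Copp_0|].
  assert (E : cauchy_block (op s) l s k = cauchy_block (op s) l (op (op s)) k) by now rewrite op_op.
  rewrite E, !cauchy_block_op, op_op, sgn_op, RtoC_opp.
  replace (INR l + INR k + 1)%C with (INR k + INR l + 1)%C by ring.
  unfold Cdiv. ring.
Qed.

Lemma cauchy_block_real (s : sign) (k : nat) (s' : sign) (l : nat) : Im (cauchy_block s k s' l) = 0.
Proof.
  destruct (sign_cases s s') as [-> | ->]; [now rewrite cauchy_block_same|].
  rewrite cauchy_block_op.
  replace (sgn s * f s k * f (op s) l / (INR k + INR l + 1))%C
    with (RtoC (sgn s * f s k * f (op s) l / (INR k + INR l + 1))); [reflexivity|].
  rewrite RtoC_div, !RtoC_mult, !RtoC_plus; auto.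
  generalize (pos_INR k) (pos_INR l); lra.
Qed.

Lemma mat_op_cauchy_block (v : vec) (s : sign) (k : nat) :
  mat_op cauchy_block v s k = CSer (fun m => cauchy_block s k (op s) m * v (op s) m)%C.
Proof.
  apply CSer_ext. intros m. rewrite (sum_signs (fun s' => cauchy_block s k s' m * v s' m)%C s).
  rewrite cauchy_block_same. ring.
Qed.

Let HMM : 0 <= M * M.
Proof. now apply Rmult_le_pos. Qed.

Lemma f_bounded_geom (s : sign) (b : nat -> C) (B' : R) :
  (forall m, Cmod (b m) <= B') -> geom (fun m => f s m * b m)%C (B' * M) r.
Proof.
  intros Hb. destruct (geom_bounded_mult b (fun m => RtoC (f s m)) B' M r Hb) as (H1 & H2 & H3).
  - split; auto. split; auto. intros m. rewrite Cmod_RtoC_pos; apply Hf.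
  - split; auto. split; auto. intros m. rewrite Cmult_comm. auto.
Qed.

(** [resolvent s] is [(1 + L)^(-1)] applied to the column [f_s]; [resolvent'] is its analogue
    for [1 - L]. *)
Definition resolvent (s : sign) : vec := fun s1 k =>
  match s, s1 with
  | plus, plus | minus, minus => (f s k * p s k)%C
  | _, _ => (sgn s * (f s1 k * q s1 k))%C
  end.

Definition resolvent' (s : sign) : vec := fun s1 k =>
  match s, s1 with
  | plus, plus | minus, minus => (f s k * p s k)%C
  | _, _ => (- sgn s * (f s1 k * q s1 k))%C
  end.

Lemma resolvent_same (s : sign) (k : nat) : resolvent s s k = (f s k * p s k)%C.
Proof. now destruct s. Qed.

Lemma resolvent_op (s : sign) (k : nat) :
  resolvent s (op s) k = (sgn s * (f (op s) k * q (op s) k))%C.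
Proof. now destruct s. Qed.

Lemma resolvent'_same (s : sign) (k : nat) : resolvent' s s k = (f s k * p s k)%C.
Proof. now destruct s. Qed.

Lemma resolvent'_op (s : sign) (k : nat) :
  resolvent' s (op s) k = (- sgn s * (f (op s) k * q (op s) k))%C.
Proof. now destruct s. Qed.

Lemma sgn_sqr_C (s : sign) : (RtoC (sgn s) * RtoC (sgn s))%C = 1%C.
Proof. rewrite <- RtoC_mult, sgn_sqr. reflexivity. Qed.

Lemma B_pos : 0 <= B.
Proof. eapply Rle_trans; [apply Cmod_ge_0|apply (HpB plus O)]. Qed.

Lemma ff_geom (s : sign) (k : nat) (b : nat -> C) (B' : R) :
  (forall m, Cmod (b m) <= B') ->
  geom (fun m => f s m * f s m * b m / (INR k + INR m + 1))%C (M * B' * M) r.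
Proof.
  intros Hb. assert (HB' : 0 <= B') by (eapply Rle_trans; [apply Cmod_ge_0|apply (Hb O)]).
  destruct (f_bounded_geom s (fun m => f s m * b m / (INR k + INR m + 1))%C (M * B'))
    as (H1 & H2 & H3).
  - intros m. unfold Cdiv. rewrite !Cmod_mult, <- (Rmult_1_r (M * B')).
    destruct (Hf s m) as [F1 F2]. rewrite Cmod_RtoC_pos by auto.
    assert (r ^ m <= 1) by (rewrite <- (pow1 m); apply pow_incr; lra).
    assert (f s m <= M) by nra.
    apply Rmult_le_compat; try apply Cmod_inv_INR; try apply Cmod_ge_0.
    + apply Rmult_le_pos; auto. apply Cmod_ge_0.
    + apply Rmult_le_compat; auto. apply Cmod_ge_0.
  - split; auto. split; auto. intros m. eapply Rle_trans; [|apply (H3 m)].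
    right. f_equal. unfold Cdiv. ring.
Qed.

Lemma mat_op_resolvent (s : sign) :
  (forall k, mat_op cauchy_block (resolvent s) s k = (f s k - f s k * p s k)%C) /\
  (forall k, mat_op cauchy_block (resolvent s) (op s) k = (- (sgn s * (f (op s) k * q (op s) k)))%C).
Proof.
  split; intros k; rewrite mat_op_cauchy_block.
  - rewrite (CSer_ext _ (fun m => f s k * (f (op s) m * f (op s) m * q (op s) m
      / (INR k + INR m + 1)))%C).
    2:{ intros m. rewrite cauchy_block_op, resolvent_op.
        transitivity ((sgn s * sgn s) * (f s k * (f (op s) m * f (op s) m * q (op s) m
          / (INR k + INR m + 1))))%C; [unfold Cdiv; ring|]. rewrite sgn_sqr_C. ring. }
    rewrite (CSer_scal _ _ _ _ (ff_geom (op s) k (q (op s)) B (HqB (op s)))).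
    rewrite (Hp s k). ring.
  - rewrite (CSer_ext _ (fun m => - (sgn s * f (op s) k) * (f s m * f s m * p s m
      / (INR k + INR m + 1)))%C).
    2:{ intros m. rewrite cauchy_block_op, !op_op, resolvent_same, sgn_op, RtoC_opp. unfold Cdiv. ring. }
    rewrite (CSer_scal _ _ _ _ (ff_geom s k (p s) B (HpB s))).
    rewrite (Hq (op s) k), op_op. ring.
Qed.

(** By antisymmetry 1 - L is the transpose of 1 + L. Writing f_s as (1 - L) applied to this vector
    lets 1 + L act on the other argument of a pairing, as [dot_value] does. *)
Lemma mat_op_resolvent' (s : sign) :
  (forall k, mat_op cauchy_block (resolvent' s) s k = (f s k * p s k - f s k)%C) /\
  (forall k, mat_op cauchy_block (resolvent' s) (op s) k = (- (sgn s * (f (op s) k * q (op s) k)))%C).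
Proof.
  destruct (mat_op_resolvent s) as [_ H2]. split; intros k; rewrite mat_op_cauchy_block.
  - rewrite (CSer_ext _ (fun m => - f s k * (f (op s) m * f (op s) m * q (op s) m
      / (INR k + INR m + 1)))%C).
    2:{ intros m. rewrite cauchy_block_op, resolvent'_op.
        transitivity ((sgn s * sgn s) * (- f s k * (f (op s) m * f (op s) m * q (op s) m
          / (INR k + INR m + 1))))%C; [unfold Cdiv; ring|]. rewrite sgn_sqr_C. ring. }
    rewrite (CSer_scal _ _ _ _ (ff_geom (op s) k (q (op s)) B (HqB (op s)))).
    rewrite (Hp s k). ring.
  - rewrite <- H2, mat_op_cauchy_block. apply CSer_ext. intros m.
    now rewrite !op_op, resolvent_same, resolvent'_same.
Qed.

Lemma resolvent_geom (s s1 : sign) (k : nat) :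
  Cmod (resolvent s s1 k) <= M * B * r ^ k /\ Cmod (resolvent' s s1 k) <= M * B * r ^ k.
Proof.
  assert (H : forall s2 b, Cmod b <= B -> Cmod (f s2 k * b) <= M * B * r ^ k).
  { intros s2 b Hb. rewrite Cmod_mult, Cmod_RtoC_pos by apply Hf.
    replace (M * B * r ^ k) with (M * r ^ k * B) by ring.
    apply Rmult_le_compat; auto; try apply Hf. apply Cmod_ge_0. }
  destruct (sign_cases s s1) as [-> | ->].
  - rewrite resolvent_same, resolvent'_same. auto.
  - rewrite resolvent_op, resolvent'_op.
    rewrite !(Cmod_mult _ (f (op s) k * q (op s) k)), Cmod_opp, Cmod_sgn, Rmult_1_l. auto.
Qed.

Definition inv_part : vec -> vec := neumann cauchy_block (M * M) r.

Lemma inv_part_unique (v : vec) : in_l2 v -> inv_part (vplus v (mat_op cauchy_block v)) = v.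
Proof.
  intros Hv.
  apply (neumann_inverse cauchy_block (M * M) r HMM Hr cauchy_block_bound cauchy_block_anti cauchy_block_real). exact Hv.
Qed.

(** On the diagonal this is p' q - q' p with p' and q' replaced by the termwise derivatives of the
    expansions [Hp] and [Hq], so that p and q are needed at integers alone. *)
Definition kernel_block : block_matrix := fun s k s' l =>
  match s, s' with
  | plus, plus | minus, minus =>
    if Nat.eqb k l then
      (f s k * f s k *
        (p s k * CSer (fun m => f (op s) m * f (op s) m * p (op s) m
                               / ((INR k + INR m + 1) * (INR k + INR m + 1)))
         + q s k * CSer (fun m => f (op s) m * f (op s) m * q (op s) m
                               / ((INR k + INR m + 1) * (INR k + INR m + 1)))))%C
    else (f s k * f s l * (p s k * q s l - q s k * p s l) / (INR k - INR l))%C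
  | _, _ => (sgn s * f s k * f s' l * (p s k * p s' l + q s k * q s' l) / (INR k + INR l + 1))%C
  end.

Lemma kernel_block_diag (s : sign) (k : nat) : kernel_block s k s k =
  (f s k * f s k *
        (p s k * CSer (fun m => f (op s) m * f (op s) m * p (op s) m
                               / ((INR k + INR m + 1) * (INR k + INR m + 1)))
         + q s k * CSer (fun m => f (op s) m * f (op s) m * q (op s) m
                               / ((INR k + INR m + 1) * (INR k + INR m + 1)))))%C.
Proof. unfold kernel_block. rewrite PeanoNat.Nat.eqb_refl. now destruct s. Qed.

Lemma kernel_block_same (s : sign) (k l : nat) : k <> l ->
  kernel_block s k s l = (f s k * f s l * (p s k * q s l - q s k * p s l) / (INR k - INR l))%C.
Proof.
  intros H. apply PeanoNat.Nat.eqb_neq in H. unfold kernel_block. rewrite H. now destruct s.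
Qed.

Lemma kernel_block_op (s : sign) (k l : nat) : kernel_block (op s) k s l =
  (sgn (op s) * f (op s) k * f s l * (p (op s) k * p s l + q (op s) k * q s l)
    / (INR k + INR l + 1))%C.
Proof. now destruct s. Qed.

Definition column (s' : sign) (l : nat) : vec := mat_op cauchy_block (inv_part (basis_vec s' l)).

Lemma column_bound (s' : sign) (l : nat) :
  exists C, 0 <= C /\ forall s k, Cmod (column s' l s k) <= C * r ^ k.
Proof.
  assert (Hb := neumann_bnd cauchy_block (M * M) r HMM Hr cauchy_block_bound cauchy_block_anti cauchy_block_real _ (basis_vec_l2 s' l)).
  match type of Hb with bnd _ ?d => set (D := d) in Hb; clearbody D end.
  assert (HD := bnd_pos _ _ Hb).
  exists (2 * (M * M) * D / (1 - r)). split.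
  - apply Rmult_le_pos; [repeat apply Rmult_le_pos; auto; lra|].
    left; apply Rinv_0_lt_compat; lra.
  - intros s k. unfold column. apply (mat_op_entry cauchy_block (M * M) r HMM Hr cauchy_block_bound _ D s k Hb).
Qed.

Lemma column_bnd (s' : sign) (l : nat) : exists C, bnd (column s' l) C.
Proof.
  destruct (column_bound s' l) as (C & HC & H). exists C. intros s k.
  eapply Rle_trans; [apply H|]. rewrite <- (Rmult_1_r C) at 2.
  apply Rmult_le_compat_l; auto. rewrite <- (pow1 k). apply pow_incr; lra.
Qed.

(** L applied to the equation (1 + L) y = e, where y is [inv_part] of the basis vector e and the
    column is L y. *)
Lemma column_eq (s' : sign) (l : nat) (s : sign) (k : nat) :
  (column s' l s k + mat_op cauchy_block (column s' l) s k)%C = cauchy_block s k s' l.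
Proof.
  assert (He := basis_vec_l2 s' l).
  destruct (neumann_inverse cauchy_block (M * M) r HMM Hr cauchy_block_bound cauchy_block_anti cauchy_block_real) as [Hbd Hinv].
  destruct (Hinv _ He) as [_ E]. fold inv_part in *.
  assert (HN : in_l2 (inv_part (basis_vec s' l))) by now apply Hbd.
  assert (HLN : in_l2 (mat_op cauchy_block (inv_part (basis_vec s' l))))
    by now apply (mat_op_bounded cauchy_block (M * M) r HMM Hr cauchy_block_bound).
  transitivity (mat_op cauchy_block (id_plus (mat_op cauchy_block) (inv_part (basis_vec s' l))) s k).
  - unfold id_plus.
    rewrite (mat_op_vplus cauchy_block (M * M) r HMM Hr cauchy_block_bound _ _ _ _ (in_l2_bnd _ HN)
      (in_l2_bnd _ HLN)). reflexivity.
  - rewrite E. apply mat_op_basis.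
Qed.

Definition dot (s' : sign) (l : nat) (s : sign) : C :=
  CSer (fun m => f s m * column s' l s m)%C.

(** f_s is (1 - L) g with g = [resolvent' s]. Moved across the pairing, 1 - L becomes 1 + L acting
    on the column, which by [column_eq] gives L e; moving L back leaves one entry of - L g. *)
Lemma dot_value (s' : sign) (l : nat) (s : sign) :
  dot s' l s = (- mat_op cauchy_block (resolvent' s) s' l)%C.
Proof.
  destruct (column_bound s' l) as (C & HC & Hcol).
  destruct (column_bnd s' l) as [C' Hcol'].
  set (g := resolvent' s).
  assert (Hg : bnd g (M * B)).
  { intros s1 k. eapply Rle_trans; [apply resolvent_geom|]. rewrite <- (Rmult_1_r (M * B)) at 2.
    apply Rmult_le_compat_l; [apply Rmult_le_pos; [auto|apply B_pos]|].
    rewrite <- (pow1 k). apply pow_incr; lra. }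
  assert (HLg := mat_op_bnd cauchy_block (M * M) r HMM Hr cauchy_block_bound g (M * B) Hg).
  assert (HLc : forall s k, Cmod (mat_op cauchy_block (column s' l) s k)
    <= 2 * (M * M) * C' / (1 - r) * r ^ k).
  { intros. now apply (mat_op_entry cauchy_block (M * M) r HMM Hr cauchy_block_bound). }
  assert (HC' := bnd_pos _ _ Hcol').
  assert (HD : 0 <= 2 * (M * M) * C' / (1 - r)).
  { apply Rmult_le_pos; [repeat apply Rmult_le_pos; auto; lra|].
    left; apply Rinv_0_lt_compat; lra. }
  assert (G1 := pairing_geom g (column s' l) (M * B) C r HC Hr Hg Hcol).
  assert (G2 := pairing_geom g (mat_op cauchy_block (column s' l)) (M * B) _ r HD Hr Hg HLc).
  assert (G3 := pairing_geom (mat_op cauchy_block g) (column s' l) _ C r HC Hr HLg Hcol).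
  assert (E1 : dot s' l s = (pairing g (column s' l) + - pairing (mat_op cauchy_block g) (column s' l))%C).
  { unfold pairing.
    replace (- CSer (fun k => mat_op cauchy_block g plus k * column s' l plus k
      + mat_op cauchy_block g minus k * column s' l minus k))%C
      with (CSer (fun k => - (1) * (mat_op cauchy_block g plus k * column s' l plus k
      + mat_op cauchy_block g minus k * column s' l minus k))%C)
      by (rewrite (CSer_scal _ _ _ _ G3); ring).
    rewrite <- (CSer_plus _ _ _ _ _ _ G1 (geom_scal (- (1)) _ _ _ G3)).
    apply CSer_ext. intros k.
    rewrite (sum_signs (fun s1 => g s1 k * column s' l s1 k)%C s),
      (sum_signs (fun s1 => mat_op cauchy_block g s1 k * column s' l s1 k)%C s).
    destruct (mat_op_resolvent' s) as [R1 R2]. unfold g. rewrite R1, R2.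
    rewrite resolvent'_same, resolvent'_op. ring. }
  rewrite E1, <- (pairing_antisym cauchy_block (M * M) r HMM Hr cauchy_block_bound cauchy_block_anti g (column s' l) _ _ Hg Hcol').
  transitivity (pairing g (mat_op cauchy_block (basis_vec s' l))).
  - unfold pairing. rewrite <- (CSer_plus _ _ _ _ _ _ G1 G2). apply CSer_ext. intros k.
    rewrite !mat_op_basis, <- !column_eq. ring.
  - rewrite (pairing_antisym cauchy_block (M * M) r HMM Hr cauchy_block_bound cauchy_block_anti g (basis_vec s' l) _ _ Hg
      (in_l2_bnd _ (basis_vec_l2 s' l))).
    now rewrite pairing_basis.
Qed.

(** The eigenvalue [+-(k + 1/2)] of the operator whose commutator with [L] has rank two. *)
Definition eigval (s : sign) (k : nat) : R := sgn s * (INR k + / 2).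

(** The factor of f_s that remains when 1 + L is applied to the commutator of the column, in closed
    form; [coef_dot] relates it to the pairing from which it arises. *)
Definition coef (s' : sign) (l : nat) (s : sign) : C :=
  match s, s' with
  | plus, plus | minus, minus => (sgn s' * (f s' l * q s' l))%C
  | _, _ => (f s' l * p s' l)%C
  end.

Lemma coef_dot (s' : sign) (l : nat) (s : sign) :
  coef s' l s = ((match s, s' with plus, plus | minus, minus => 0 | _, _ => f s' l end)
    - dot s' l (op s))%C.
Proof.
  destruct (mat_op_resolvent' (op s)) as [R1 R2]. rewrite op_op in R2.
  rewrite dot_value. destruct (sign_cases s s') as [-> | ->].
  - rewrite R2, sgn_op, RtoC_opp. destruct s; simpl; ring.
  - rewrite R1. destruct s; simpl; ring.
Qed.

(** Let D be the diagonal operator of the eigenvalues, d its value at (s', l), e the basis vector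
    and X the column. Then (1 + L) (D - d) X = (D - d) (X + L X) - [D, L] X, where X + L X = L e and
    (D - d) L e = [D, L] e. As [D, L] has the entries f f between opposite signs, the right side
    combines f_+ and f_- with factors [coef]; inverting 1 + L replaces them by the two [resolvent]
    vectors. *)
Lemma commutator_solution (s' : sign) (l : nat) (s : sign) (k : nat) :
  (RtoC (eigval s k - eigval s' l) * column s' l s k)%C
  = (coef s' l plus * resolvent plus s k + coef s' l minus * resolvent minus s k)%C.
Proof.
  destruct (column_bound s' l) as (C & HC & Hcol).
  destruct (column_bnd s' l) as [C' Hcol'].
  set (kappa := fun s k => (RtoC (eigval s k - eigval s' l) * column s' l s k)%C).
  assert (Hr1 : Cmod r < 1) by (rewrite Cmod_RtoC_pos; lra).
  (* [rf 2 k] equals k + 1, so the linear growth of the eigenvalues is absorbed into the larger rate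
     r'. *)
  destruct (subexp_geom _ r (rf_subexp 2) Hr1) as [M' (HM' & Hr' & HG)].
  set (r' := 2 * Cmod r / (1 + Cmod r)) in *.
  assert (Hpos : forall s k, Rabs (eigval s k - eigval s' l) <= (INR l + 1) * (INR k + 1)).
  { intros s1 k1. unfold eigval. generalize (pos_INR k1) (pos_INR l). intros.
    apply Rabs_le. destruct s1, s'; simpl; split; nra. }
  assert (Hkap : forall s k, Cmod (kappa s k) <= (INR l + 1) * C * M' * r' ^ k).
  { intros s1 k1. unfold kappa. rewrite Cmod_mult, Cmod_R.
    assert (Hk := HG k1). rewrite rf_2, Cmod_mult, Cmod_pow in Hk.
    rewrite <- RtoC_plus, !Cmod_RtoC_pos in Hk by (generalize (pos_INR k1); lra).
    apply Rle_trans with ((INR l + 1) * (INR k1 + 1) * (C * r ^ k1)).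
    - apply Rmult_le_compat; auto; try apply Cmod_ge_0. apply Rabs_pos.
    - replace ((INR l + 1) * (INR k1 + 1) * (C * r ^ k1))
        with ((INR l + 1) * C * ((INR k1 + 1) * r ^ k1)) by ring.
      rewrite (Rmult_assoc ((INR l + 1) * C)).
      apply Rmult_le_compat_l; auto.
      apply Rmult_le_pos; auto. generalize (pos_INR l); lra. }
  assert (HK0 : 0 <= (INR l + 1) * C * M').
  { repeat apply Rmult_le_pos; auto. generalize (pos_INR l); lra. }
  destruct (geom_in_l2 kappa _ r' HK0 Hr' Hkap) as [Hkl2 _].
  assert (Hkb := in_l2_bnd _ Hkl2).
  set (sol := vplus (vscal (coef s' l plus) (resolvent plus))
    (vscal (coef s' l minus) (resolvent minus))).
  assert (HMB : 0 <= M * B) by (apply Rmult_le_pos; [auto|apply B_pos]).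
  assert (Hres : forall s1, in_l2 (resolvent s1)).
  { intros s1. apply (geom_in_l2 _ (M * B) r); auto. intros; apply resolvent_geom. }
  assert (Hsol : in_l2 sol) by (apply in_l2_vplus; apply in_l2_vscal; auto).
  assert (E : vplus kappa (mat_op cauchy_block kappa) = vplus sol (mat_op cauchy_block sol)).
  { unfold sol.
    rewrite (mat_op_vplus cauchy_block (M * M) r HMM Hr cauchy_block_bound _ _ _ _
      (bnd_vscal _ _ _ (in_l2_bnd _ (Hres plus))) (bnd_vscal _ _ _ (in_l2_bnd _ (Hres minus)))).
    rewrite !(mat_op_vscal cauchy_block (M * M) r HMM Hr cauchy_block_bound _ _ _ (in_l2_bnd _ (Hres _))).
    apply functional_extensionality; intros s1; apply functional_extensionality; intros k1.
    unfold vplus, vscal.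
    transitivity (f s1 k1 * coef s' l s1)%C.
    - rewrite mat_op_cauchy_block.
      (* The eigenvalue at (op s1, m) is the one at (s1, k1) minus sgn s1 (k1 + m + 1). This factor
         cancels the Cauchy denominator and leaves the separated product of values of f. *)
      rewrite (CSer_ext _ (fun m => RtoC (eigval s1 k1 - eigval s' l)
        * (cauchy_block s1 k1 (op s1) m * column s' l (op s1) m)
        + (- f s1 k1) * (f (op s1) m * column s' l (op s1) m))%C).
      2:{ intros m. unfold kappa. rewrite cauchy_block_op.
          replace (RtoC (eigval (op s1) m - eigval s' l)) with
            (RtoC (eigval s1 k1 - eigval s' l) - sgn s1 * (INR k1 + INR m + 1))%C.
          - transitivity (RtoC (eigval s1 k1 - eigval s' l)
              * (sgn s1 * f s1 k1 * f (op s1) m / (INR k1 + INR m + 1) * column s' l (op s1) m)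
              + (- f s1 k1) * (f (op s1) m * column s' l (op s1) m) * (sgn s1 * sgn s1))%C.
            + field. apply INR_pos_neq_0.
            + rewrite sgn_sqr_C. ring.
          - unfold eigval. rewrite sgn_op, <- !RtoC_plus, <- RtoC_mult, <- RtoC_minus.
            f_equal. field. }
      assert (G1 : geom (fun m => cauchy_block s1 k1 (op s1) m * column s' l (op s1) m)%C
        (C' * (M * M * r ^ k1)) r).
      { destruct (geom_bounded_mult (fun m => column s' l (op s1) m)
          (fun m => cauchy_block s1 k1 (op s1) m) C' (M * M * r ^ k1) r) as (X1 & X2 & X3).
        - intros m; apply Hcol'.
        - split; [apply Rmult_le_pos; auto; apply pow_le; lra|]. split; auto.
          intros m. apply cauchy_block_bound.
        - split; auto. split; auto. intros m. rewrite Cmult_comm. auto. }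
      assert (G2 := f_bounded_geom (op s1) (column s' l (op s1)) C' (Hcol' (op s1))).
      rewrite (CSer_plus _ _ _ _ _ _ (geom_scal _ _ _ _ G1) (geom_scal _ _ _ _ G2)).
      rewrite (CSer_scal _ _ _ _ G1), (CSer_scal _ _ _ _ G2).
      rewrite <- mat_op_cauchy_block. fold (dot s' l (op s1)).
      transitivity (RtoC (eigval s1 k1 - eigval s' l) * cauchy_block s1 k1 s' l - f s1 k1 * dot s' l (op s1))%C.
      { unfold kappa. rewrite <- column_eq. ring. }
      rewrite coef_dot. destruct (sign_cases s1 s') as [-> | ->].
      + rewrite cauchy_block_same. destruct s1; ring.
      + rewrite cauchy_block_op.
        replace (RtoC (eigval s1 k1 - eigval (op s1) l)) with (sgn s1 * (INR k1 + INR l + 1))%C.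
        * transitivity ((sgn s1 * sgn s1) * f s1 k1 * f (op s1) l - f s1 k1 * dot (op s1) l (op s1))%C.
          -- field. apply INR_pos_neq_0.
          -- rewrite sgn_sqr_C. destruct s1; simpl; ring.
        * unfold eigval. rewrite sgn_op, <- !RtoC_plus, <- RtoC_mult. f_equal. field.
    - destruct (mat_op_resolvent s1) as [R1 R2].
      destruct (mat_op_resolvent (op s1)) as [R3 R4]. rewrite op_op in R4.
      assert (E4 : resolvent (op s1) s1 k1 = (sgn (op s1) * (f s1 k1 * q s1 k1))%C).
      { generalize (resolvent_op (op s1) k1). now rewrite op_op. }
      transitivity (coef s' l s1 * (resolvent s1 s1 k1 + mat_op cauchy_block (resolvent s1) s1 k1)
        + coef s' l (op s1) * (resolvent (op s1) s1 k1 + mat_op cauchy_block (resolvent (op s1)) s1 k1))%C.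
      + rewrite R1, R4, E4, resolvent_same. ring.
      + destruct s1; simpl op; ring. }
  (* [inv_part] undoes 1 + L on square-summable vectors, so equal images force equal vectors. *)
  assert (E2 : kappa = sol).
  { rewrite <- (inv_part_unique kappa Hkl2), <- (inv_part_unique sol Hsol). now rewrite E. }
  change (kappa s k = sol s k). now rewrite E2.
Qed.

Lemma column_op (s' : sign) (l k : nat) : column s' l (op s') k = kernel_block (op s') k s' l.
Proof.
  assert (H := commutator_solution s' l (op s') k).
  rewrite (sum_signs (fun s => coef s' l s * resolvent s (op s') k)%C s') in H.
  rewrite resolvent_same, resolvent_op in H.
  replace (RtoC (eigval (op s') k - eigval s' l)) with (sgn (op s') * (INR k + INR l + 1))%C in H.
  2:{ unfold eigval. rewrite sgn_op, <- !RtoC_plus, <- RtoC_mult. f_equal. field. }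
  rewrite kernel_block_op.
  transitivity (sgn (op s') * (sgn (op s') * (INR k + INR l + 1) * column s' l (op s') k)
    / (INR k + INR l + 1))%C.
  - transitivity ((sgn (op s') * sgn (op s')) * column s' l (op s') k)%C.
    + rewrite sgn_sqr_C. ring.
    + field. apply INR_pos_neq_0.
  - rewrite H. replace (coef s' l s') with (sgn s' * (f s' l * q s' l))%C by (now destruct s').
    replace (coef s' l (op s')) with (f s' l * p s' l)%C by (now destruct s').
    transitivity (sgn (op s') * (f (op s') k * f s' l * (p (op s') k * p s' l
      + (sgn s' * sgn s') * (q (op s') k * q s' l))) / (INR k + INR l + 1))%C.
    + unfold Cdiv. ring.
    + rewrite sgn_sqr_C. unfold Cdiv. ring.
Qed.

Lemma column_same (s' : sign) (l k : nat) : k <> l -> column s' l s' k = kernel_block s' k s' l.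
Proof.
  intros Hkl.
  assert (Hd : (RtoC (INR k) - RtoC (INR l))%C <> 0%C).
  { rewrite <- RtoC_minus. intros E. apply RtoC_inj in E. apply Hkl, INR_eq. lra. }
  assert (H := commutator_solution s' l s' k).
  rewrite (sum_signs (fun s => coef s' l s * resolvent s s' k)%C s') in H.
  assert (E4 : resolvent (op s') s' k = (sgn (op s') * (f s' k * q s' k))%C).
  { generalize (resolvent_op (op s') k). now rewrite op_op. }
  rewrite resolvent_same, E4 in H.
  replace (RtoC (eigval s' k - eigval s' l)) with (sgn s' * (INR k - INR l))%C in H.
  2:{ unfold eigval. rewrite <- !RtoC_minus, <- RtoC_mult. f_equal. ring. }
  rewrite kernel_block_same by auto.
  transitivity (sgn s' * (sgn s' * (INR k - INR l) * column s' l s' k) / (INR k - INR l))%C.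
  - transitivity ((sgn s' * sgn s') * column s' l s' k)%C.
    + rewrite sgn_sqr_C. ring.
    + field. auto.
  - rewrite H. replace (coef s' l s') with (sgn s' * (f s' l * q s' l))%C by (now destruct s').
    replace (coef s' l (op s')) with (f s' l * p s' l)%C by (now destruct s').
    rewrite sgn_op, RtoC_opp.
    transitivity ((sgn s' * sgn s') * (f s' k * f s' l * (p s' k * q s' l - q s' k * p s' l))
      / (INR k - INR l))%C.
    + unfold Cdiv. ring.
    + rewrite sgn_sqr_C. unfold Cdiv. ring.
Qed.

(** Here the difference of eigenvalues is zero and the commutator gives no information. But L
    vanishes between equal signs, so [column_eq] expresses the entry through the entries of opposite
    sign, which [column_op] provides. *)
Lemma column_diag (s' : sign) (l : nat) : column s' l s' l = kernel_block s' l s' l.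
Proof.
  assert (H := column_eq s' l s' l). rewrite cauchy_block_same in H.
  assert (G : forall b : nat -> C, (forall m, Cmod (b m) <= B) ->
    geom (fun m => f (op s') m * f (op s') m * b m
      / ((INR l + INR m + 1) * (INR l + INR m + 1)))%C (1 * (M * B * M)) r).
  { intros b Hb.
    destruct (geom_bounded_mult (fun m => / (INR l + INR m + 1))%C _ 1 _ r
      (Cmod_inv_INR l) (ff_geom (op s') l b B Hb)) as (X1 & X2 & X3).
    split; auto. split; auto. intros m. eapply Rle_trans; [|apply (X3 m)].
    right. f_equal. field. apply INR_pos_neq_0. }
  rewrite kernel_block_diag.
  replace (column s' l s' l) with (- mat_op cauchy_block (column s' l) s' l)%C.
  2:{ replace (column s' l s' l) with (column s' l s' l + mat_op cauchy_block (column s' l) s' l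
      - mat_op cauchy_block (column s' l) s' l)%C by ring. rewrite H. ring. }
  rewrite mat_op_cauchy_block.
  rewrite (CSer_ext _ (fun m => (- (f s' l * f s' l * p s' l))
    * (f (op s') m * f (op s') m * p (op s') m / ((INR l + INR m + 1) * (INR l + INR m + 1)))
    + (- (f s' l * f s' l * q s' l))
    * (f (op s') m * f (op s') m * q (op s') m / ((INR l + INR m + 1) * (INR l + INR m + 1))))%C).
  - rewrite (CSer_plus _ _ _ _ _ _ (geom_scal _ _ _ _ (G _ (HpB (op s'))))
      (geom_scal _ _ _ _ (G _ (HqB (op s'))))).
    rewrite (CSer_scal _ _ _ _ (G _ (HpB (op s')))), (CSer_scal _ _ _ _ (G _ (HqB (op s')))).
    ring.
  - intros m. rewrite column_op, cauchy_block_op, kernel_block_op, sgn_op, RtoC_opp.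
    replace (INR m + INR l + 1)%C with (INR l + INR m + 1)%C by ring.
    transitivity ((sgn s' * sgn s') * ((- (f s' l * f s' l * p s' l))
    * (f (op s') m * f (op s') m * p (op s') m / ((INR l + INR m + 1) * (INR l + INR m + 1)))
    + (- (f s' l * f s' l * q s' l))
    * (f (op s') m * f (op s') m * q (op s') m / ((INR l + INR m + 1) * (INR l + INR m + 1)))))%C.
    + field. apply INR_pos_neq_0.
    + rewrite sgn_sqr_C. ring.
Qed.

Lemma column_entry (s' : sign) (l : nat) (s : sign) (k : nat) : column s' l s k = kernel_block s k s' l.
Proof.
  destruct (sign_cases s' s) as [-> | ->]; [|apply column_op].
  destruct (PeanoNat.Nat.eq_dec k l) as [-> | H]; [apply column_diag|now apply column_same].
Qed.

Theorem resolvent_kernel : exists K L N : vec -> vec,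
  is_operator_of kernel_block K /\ is_operator_of cauchy_block L /\ is_inverse (id_plus L) N /\
  (forall v, in_l2 v -> K v = L (N v)).
Proof.
  exists (fun v => mat_op cauchy_block (inv_part v)), (mat_op cauchy_block), inv_part.
  split; [|split; [|split]].
  - split.
    + apply (mat_op_neumann_bounded cauchy_block (M * M) r HMM Hr cauchy_block_bound cauchy_block_anti cauchy_block_real).
    + intros s k s' l. apply column_entry.
  - split.
    + apply (mat_op_bounded cauchy_block (M * M) r HMM Hr cauchy_block_bound).
    + intros s k s' l. apply mat_op_basis.
  - apply (neumann_inverse cauchy_block (M * M) r HMM Hr cauchy_block_bound cauchy_block_anti cauchy_block_real).
  - reflexivity.
Qed.

End Kernel.

(** * Consequences of the standing assumption on z and z' *)

Lemma sg_op (s : sign) (x : C) : sg (op s) x = (- sg s x)%C.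
Proof. destruct s; simpl; ring. Qed.

Lemma sg_sgn (s : sign) (x : C) : sg s x = (sgn s * x)%C.
Proof. destruct s; simpl; ring. Qed.

Lemma Cpositive_cancel (a b : C) : Cpositive a -> Cpositive (a * b) -> Cpositive b.
Proof.
  intros [H1 H2] [H3 H4]. destruct a as [x y], b as [u v].
  unfold Cpositive, Re, Im in *. simpl in *. subst y.
  assert (v = 0) by nra. subst v. split; auto. nra.
Qed.

(** Consecutive products of Pochhammer symbols are positive and differ by this factor. *)
Lemma admissible_shift (z z' : C) (s : sign) (k : nat) :
  admissible z z' -> Cpositive ((sg s z + INR k) * (sg s z' + INR k)).
Proof.
  intros H.
  assert (Hk : forall j, (1 <= j)%nat -> Cpositive (poch (sg s z) j * poch (sg s z') j)).
  { intros j Hj. destruct s; apply (H j Hj). }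
  destruct k as [|k].
  - generalize (Hk 1%nat ltac:(lia)). simpl. now rewrite !Cmult_1_l.
  - apply Cpositive_cancel with (poch (sg s z) (S k) * poch (sg s z') (S k))%C.
    + apply Hk. lia.
    + replace (poch (sg s z) (S k) * poch (sg s z') (S k)
        * ((sg s z + INR (S k)) * (sg s z' + INR (S k))))%C
        with (poch (sg s z) (S (S k)) * poch (sg s z') (S (S k)))%C.
      * apply Hk. lia.
      * change (poch (sg s z) (S (S k))) with (poch (sg s z) (S k) * (sg s z + INR (S k)))%C.
        change (poch (sg s z') (S (S k))) with (poch (sg s z') (S k) * (sg s z' + INR (S k)))%C.
        ring.
Qed.

(** The factors for k = 0 and k = 1 are z z' and z z' + (z + z') + 1; both being real, so is z +
    z'. *)
Lemma admissible_real (z z' : C) :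
  admissible z z' -> exists si t : R, (z + z')%C = si /\ (z * z')%C = t /\ 0 < t /\
    forall s m, 0 < qd (sgn s * si) t (INR m).
Proof.
  intros H.
  assert (H0 := admissible_shift z z' plus 0 H). assert (H1 := admissible_shift z z' plus 1 H).
  simpl in H0, H1. rewrite !Cplus_0_r in H0.
  replace ((z + 1) * (z' + 1))%C with (z * z' + (z + z') + 1)%C in H1 by ring.
  destruct H0 as [I0 R0], H1 as [I1 R1].
  assert (Ht : (z * z')%C = RtoC (Re (z * z')%C)) by (apply C_ext; auto).
  assert (Hs : (z + z')%C = RtoC (Re (z + z')%C)).
  { apply C_ext; auto.
    change (Im (z * z' + (z + z') + 1)%C) with (Im (z * z')%C + Im (z + z')%C + 0) in I1.
    change (Im (Re (z + z'))) with 0. lra. }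
  exists (Re (z + z')%C), (Re (z * z')%C). split; auto. split; auto. split; auto.
  intros s m. set (si := Re (z + z')%C) in *. set (t := Re (z * z')%C) in *.
  destruct (admissible_shift z z' s m H) as [_ Rm].
  replace ((sg s z + INR m) * (sg s z' + INR m))%C with (RtoC (qd (sgn s * si) t (INR m))) in Rm.
  - exact Rm.
  - rewrite !sg_sgn. unfold qd. rewrite !RtoC_plus, !RtoC_mult, RtoC_pow, <- Hs, <- Ht.
    transitivity ((INR m) ^ 2 + sgn s * (z + z') * INR m + (sgn s * sgn s) * (z * z'))%C.
    + rewrite sgn_sqr_C. ring.
    + ring.
Qed.

(** * Derivatives of partial fraction series and of P and Q *)

Definition is_deriveC (F : R -> C) (x : R) (d : C) : Prop :=
  is_derive (fun u => Re (F u)) x (Re d) /\ is_derive (fun u => Im (F u)) x (Im d).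

(** The second-order remainder of 1 / x under a shift h is h^2 / (x^2 (x + h)), at most 2 h^2 for x
    >= 1 and |h| < 1/2. This is uniform in the pole, so it can be summed against c. *)
Lemma pf_deriveC (c : nat -> C) (M r : R) (k : nat) :
  geom c M r ->
  is_deriveC (fun u => CSer (fun m => c m / (u + INR m + 1))%C) (INR k)
    (- CSer (fun m => c m / ((INR k + INR m + 1) * (INR k + INR m + 1))))%C.
Proof.
  intros Hc. set (F := fun u : R => CSer (fun m => c m / (u + INR m + 1))%C).
  set (D := CSer (fun m => c m / ((INR k + INR m + 1) * (INR k + INR m + 1)))%C).
  assert (Hr : 0 <= r < 1) by apply Hc.
  assert (Hk := pos_INR k).
  assert (HD : geom (fun m => c m / ((INR k + INR m + 1) * (INR k + INR m + 1)))%C (1 * (1 * M)) r).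
  { assert (G1 := geom_bounded_mult (fun m => / (INR k + INR m + 1))%C c 1 M r (Cmod_inv_INR k) Hc).
    destruct (geom_bounded_mult (fun m => / (INR k + INR m + 1))%C _ 1 _ r (Cmod_inv_INR k) G1)
      as (X1 & X2 & X3).
    split; auto. split; auto. intros m. eapply Rle_trans; [|apply (X3 m)].
    right. f_equal. field. apply INR_pos_neq_0. }
  assert (Hest : forall h, Rabs h < 1 / 2 ->
    Cmod (F (INR k + h)%R - F (INR k) - h * - D) <= 2 * (M / (1 - r)) * h ^ 2).
  { intros h Hh. apply Rabs_lt_between in Hh.
    assert (Hg1 := geom_div_pf c M r (INR k + h) ltac:(lra) Hc).
    assert (Hg0 := geom_div_pf c M r (INR k) ltac:(lra) Hc).
    set (e := fun m => (/ (RtoC (INR k + h) + INR m + 1) - / (INR k + INR m + 1)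
      + h / ((INR k + INR m + 1) * (INR k + INR m + 1)))%C).
    assert (He : forall m, Cmod (e m) <= 2 * h ^ 2).
    { intros m. assert (Hm := pos_INR m).
      set (x := INR k + INR m + 1). assert (Hx : 1 <= x) by (unfold x; lra).
      replace (e m) with (RtoC (h ^ 2 / (x * x * (x + h)))).
      - rewrite Cmod_R. unfold Rdiv. rewrite Rabs_mult, (Rabs_pos_eq (h ^ 2)) by apply pow2_ge_0.
        rewrite Rmult_comm. apply Rmult_le_compat_r; [apply pow2_ge_0|].
        rewrite Rabs_pos_eq.
        + replace 2 with (/ / 2) by field. apply Rinv_le_contravar; [lra|]. nra.
        + left; apply Rinv_0_lt_compat. nra.
      - unfold e. rewrite <- !RtoC_plus, <- RtoC_mult.
        replace (INR k + h + INR m + 1) with (x + h) by (unfold x; ring). fold x.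
        rewrite <- !RtoC_inv by lra. rewrite <- RtoC_div by nra.
        rewrite <- RtoC_minus, <- RtoC_plus. f_equal. field. lra. }
    assert (Hge : geom (fun m => e m * c m)%C (2 * h ^ 2 * M) r) by now apply geom_bounded_mult.
    replace (F (INR k + h)%R - F (INR k) - h * - D)%C with (CSer (fun m => e m * c m)%C).
    - eapply Rle_trans; [apply (CSer_bound _ _ _ Hge)|]. right. field. lra.
    - unfold F, D.
      rewrite (CSer_ext _ (fun m => c m / (RtoC (INR k + h) + INR m + 1)
        + (- (1) * (c m / (INR k + INR m + 1))
        + h * (c m / ((INR k + INR m + 1) * (INR k + INR m + 1)))))%C)
        by (intros m; unfold e, Cdiv; ring).
      rewrite (CSer_plus _ _ _ _ _ _ Hg1 (geom_plus _ _ _ _ _ (geom_scal _ _ _ _ Hg0)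
        (geom_scal _ _ _ _ HD))).
      rewrite (CSer_plus _ _ _ _ _ _ (geom_scal _ _ _ _ Hg0) (geom_scal _ _ _ _ HD)).
      rewrite (CSer_scal _ _ _ _ Hg0), (CSer_scal _ _ _ _ HD). ring. }
  split; apply is_derive_quadratic with (1 / 2) (2 * (M / (1 - r))); try lra; intros h Hh.
  - eapply Rle_trans; [|apply (Hest h Hh)]. eapply Rle_trans; [|apply re_le_Cmod].
    right. f_equal. unfold Cminus. rewrite !re_plus, !re_opp, re_scal_l, ?re_opp. ring.
  - eapply Rle_trans; [|apply (Hest h Hh)]. eapply Rle_trans; [|apply Cmod_im_le].
    right. f_equal. unfold Cminus. rewrite !im_plus, !im_opp, im_scal_l, ?im_opp. ring.
Qed.

(** Near x the function is sqrt(rho) F. The derivative of sqrt(rho) is left unevaluated because it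
    drops out of P' Q - Q' P. *)
Lemma DeriveC_scaled (psi' F : R -> C) (rho : R -> R) (x del : R) (d : C) :
  0 < del -> (forall u, Rabs (u - x) < del -> psi' u = RtoC (rho u) /\ 0 < rho u) ->
  ex_derive rho x -> is_deriveC F x d ->
  DeriveC (fun u => psi' u * F u / Csqrt_pos (psi' u))%C x
  = (RtoC (Derive (fun u => sqrt (rho u)) x) * F x + RtoC (sqrt (rho x)) * d)%C.
Proof.
  intros Hdel Hloc Hrho [HRe HIm].
  assert (Hx : 0 < rho x) by (apply Hloc; rewrite Rminus_diag, Rabs_R0; auto).
  assert (Hs : ex_derive (fun u => sqrt (rho u)) x).
  { apply (ex_derive_comp sqrt rho); auto. auto_derive. auto. }
  assert (E : forall u, Rabs (u - x) < del ->
    (psi' u * F u / Csqrt_pos (psi' u))%C = (sqrt (rho u) * F u)%C).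
  { intros u Hu. destruct (Hloc u Hu) as [E Hp]. rewrite E. unfold Csqrt_pos. simpl Re.
    assert (Hq : RtoC (sqrt (rho u)) <> 0%C).
    { intros E0. apply RtoC_inj in E0. generalize (sqrt_lt_R0 _ Hp). lra. }
    replace (RtoC (rho u)) with (RtoC (sqrt (rho u)) * RtoC (sqrt (rho u)))%C
      by (apply RtoC_sqrt_sqr; lra).
    field. auto. }
  assert (Hm : forall (g : R -> R) (g' : R), is_derive g x g' ->
    is_derive (fun u => sqrt (rho u) * g u) x
      (Derive (fun u => sqrt (rho u)) x * g x + sqrt (rho x) * g')).
  { intros g g' Hg. apply (is_derive_mult (fun u => sqrt (rho u)) g x); auto.
    - now apply Derive_correct.
    - intros; apply Rmult_comm. }
  apply C_ext.
  - rewrite re_plus, !re_scal_l.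
    change (Derive (fun u => Re (psi' u * F u / Csqrt_pos (psi' u))%C) x
      = Derive (fun u => sqrt (rho u)) x * Re (F x) + sqrt (rho x) * Re d).
    apply is_derive_unique.
    apply is_derive_ext_loc with (2 := Hm _ _ HRe).
    exists (mkposreal _ Hdel). intros u Hu. cbv beta. rewrite (E u Hu), re_scal_l. reflexivity.
  - rewrite im_plus, !im_scal_l.
    change (Derive (fun u => Im (psi' u * F u / Csqrt_pos (psi' u))%C) x
      = Derive (fun u => sqrt (rho u)) x * Im (F x) + sqrt (rho x) * Im d).
    apply is_derive_unique.
    apply is_derive_ext_loc with (2 := Hm _ _ HIm).
    exists (mkposreal _ Hdel). intros u Hu. cbv beta. rewrite (E u Hu), im_scal_l. reflexivity.
Qed.

(** * Identification of the matrices K and L with the abstract blocks *)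

Section Psi.

Variables (z z' : C) (xi si t : R).
Hypothesis hxi : 0 < xi < 1.
Hypothesis Hsi : (z + z')%C = si.
Hypothesis Ht : (z * z')%C = t.
Hypothesis Htpos : 0 < t.
Hypothesis Hqd : forall s m, 0 < qd (sgn s * si) t (INR m).

Let tau : C := Csqrt_pos (z * z').

Lemma tau_sqr (s : sign) : (tau * tau)%C = (sg s z * sg s z')%C.
Proof.
  unfold tau, Csqrt_pos. rewrite !sg_sgn.
  replace (sgn s * z * (sgn s * z'))%C with ((sgn s * sgn s) * (z * z'))%C by ring.
  rewrite sgn_sqr_C, Ht. simpl Re. rewrite RtoC_sqrt_sqr by lra. ring.
Qed.

Lemma sg_sum (s : sign) : (sg s z + sg s z')%C = RtoC (sgn s * si).
Proof. rewrite !sg_sgn, RtoC_mult, <- Hsi. ring. Qed.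

Lemma sg_prod (s : sign) : (sg s z * sg s z')%C = RtoC t.
Proof.
  rewrite !sg_sgn, <- Ht.
  replace (sgn s * z * (sgn s * z'))%C with ((sgn s * sgn s) * (z * z'))%C by ring.
  rewrite sgn_sqr_C. ring.
Qed.

Lemma sg_plus (s : sign) : sg s (z + z') = RtoC (sgn s * si).
Proof. rewrite sg_sgn, Hsi, RtoC_mult. reflexivity. Qed.

Lemma gamma_base (s : sign) : exists v : R, 0 < v /\
  (Gamma (1 + sg s z) * Gamma (1 + sg s z'))%C = RtoC v.
Proof.
  destruct (gamma_quot_limit (sg s z) (sg s z') (sgn s * si) t 0 (sg_sum s) (sg_prod s))
    as (v & E & Hv & _); [lra| |].
  - intros j. rewrite Rplus_0_l. rewrite Rplus_comm, <- S_INR. apply Hqd.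
  - exists v. split; auto. rewrite <- E. unfold gamma_quot.
    rewrite !Cplus_0_l, Gamma_1. field.
Qed.

(** Apart from the Gamma quotient, [psi] consists of constants and a real exponential in u, so
    positivity and differentiability reduce to [gamma_quot_local]. *)
Lemma psi_local (s : sign) (k : nat) : exists (del : R) (rho : R -> R), 0 < del /\
  (forall u, Rabs (u - INR k) < del -> psi z z' xi s u = RtoC (rho u) /\ 0 < rho u) /\
  ex_derive rho (INR k).
Proof.
  destruct (gamma_quot_local (sg s z) (sg s z') (sgn s * si) t k (sg_sum s) (sg_prod s))
    as (del & Lam & Hdel & Hloc & Hder); [intros; apply Hqd|].
  destruct (gamma_base s) as (v & Hv & Ev).
  set (c := sqrt t * exp (sgn s * si * ln (1 - xi)) / v).
  assert (Hc : 0 < c).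
  { unfold c. apply Rdiv_lt_0_compat; auto. apply Rmult_lt_0_compat; [now apply sqrt_lt_R0|].
    apply exp_pos. }
  exists del, (fun u => c * exp ((u + / 2) * ln xi) * Lam u). split; auto. split.
  - intros u Hu. destruct (Hloc u Hu) as (Hu1 & E & HL & _). split.
    + unfold psi. rewrite sg_plus, Cpower_RtoC.
      replace (RtoC u + / 2)%C with (RtoC (u + / 2)) by (rewrite RtoC_plus, RtoC_inv by lra; auto).
      rewrite Cpower_RtoC. unfold Csqrt_pos. rewrite Ht. simpl Re.
      unfold c. rewrite !RtoC_mult, RtoC_div, RtoC_mult, <- E, <- Ev by lra. unfold gamma_quot.
      assert (N1 : Gamma (1 + sg s z) <> 0%C).
      { intros E0. rewrite E0, Cmult_0_l in Ev. apply RtoC_inj in Ev. lra. }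
      assert (N2 : Gamma (1 + sg s z') <> 0%C).
      { intros E0. rewrite E0, Cmult_0_r in Ev. apply RtoC_inj in Ev. lra. }
      assert (N3 : Gamma (u + 1) <> 0%C).
      { apply Gamma_correct. intros j. rewrite <- RtoC_plus.
        apply RtoC_pos_plus_INR_neq_0. lra. }
      field. auto.
    + apply Rmult_lt_0_compat; auto. apply Rmult_lt_0_compat; auto. apply exp_pos.
  - apply (ex_derive_mult (fun u => c * exp ((u + / 2) * ln xi)) Lam); auto.
    auto_derive. auto.
Qed.

(** At integers the functional equation turns the Gamma quotients into Pochhammer symbols; the power
    of 1 - xi is a binomial series because its exponent is real. *)
Lemma psi_INR (s : sign) (k : nat) :
  psi z z' xi s (INR k) = psi_int tau (sg s z) (sg s z') xi k.
Proof.
  assert (Hq0 : forall j, 0 < qd (sgn s * si) t (0 + 1 + INR j)).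
  { intros j. rewrite Rplus_0_l. rewrite Rplus_comm, <- S_INR. apply Hqd. }
  assert (P1 : forall j, (1 + sg s z + INR j)%C <> 0%C).
  { intros j. generalize (qd_nonpole _ _ _ _ 0 (sg_sum s) (sg_prod s) Hq0 j).
    now rewrite Cplus_0_l. }
  assert (P2 : forall j, (1 + sg s z' + INR j)%C <> 0%C).
  { intros j. generalize (qd_nonpole (sg s z') (sg s z) _ _ 0
      ltac:(rewrite Cplus_comm; apply sg_sum) ltac:(rewrite Cmult_comm; apply sg_prod) Hq0 j).
    now rewrite Cplus_0_l. }
  assert (P3 : forall j, (1 + INR j)%C <> 0%C).
  { intros j. rewrite Cplus_comm, <- RtoC_INR_S. apply RtoC_INR_S_neq_0. }
  unfold psi, psi_int. rewrite sg_plus, Cpower_bs by auto.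
  replace (INR k + 1 + sg s z)%C with (1 + sg s z + INR k)%C by ring.
  replace (INR k + 1 + sg s z')%C with (1 + sg s z' + INR k)%C by ring.
  replace (INR k + 1)%C with (1 + INR k)%C by ring.
  rewrite (Gamma_plus_INR _ k P1), (Gamma_plus_INR _ k P2), (Gamma_plus_INR _ k P3).
  rewrite Gamma_1, poch_1, sg_sum.
  replace (Cpower xi (INR k + / 2)) with (RtoC (sqrt xi) * xi ^ k)%C.
  - fold tau. unfold rf. destruct (Gamma_correct _ P1) as [_ N1], (Gamma_correct _ P2) as [_ N2].
    field. repeat split; auto. apply RtoC_INR_fact_neq_0.
  - replace (RtoC (INR k) + / 2)%C with (RtoC (INR k + / 2))
      by (rewrite RtoC_plus, RtoC_inv by lra; auto).
    rewrite Cpower_RtoC, <- RtoC_pow, <- RtoC_mult. f_equal.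
    rewrite Rmult_plus_distr_r, exp_plus.
    assert (E1 : exp (/ 2 * ln xi) = sqrt xi).
    { rewrite <- Rpower_sqrt by lra. reflexivity. }
    assert (E2 : exp (INR k * ln xi) = xi ^ k).
    { rewrite <- Rpower_pow by lra. reflexivity. }
    rewrite E1, E2. ring.
Qed.

Definition sqrt_psi (s : sign) (k : nat) : R := sqrt (Re (psi z z' xi s (INR k))).
Definition P_int (s : sign) (k : nat) : C := hypP (sg s z) (sg s z') xi (INR k).
Definition Q_int (s : sign) (k : nat) : C := hypQ tau (sg s z) (sg s z') xi (INR k).

Lemma psi_sqrt_psi (s : sign) (k : nat) :
  psi z z' xi s (INR k) = (sqrt_psi s k * sqrt_psi s k)%C /\ 0 < sqrt_psi s k.
Proof.
  destruct (psi_local s k) as (del & rho & Hdel & Hloc & _).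
  destruct (Hloc (INR k)) as [E Hp]; [rewrite Rminus_diag, Rabs_R0; auto|].
  unfold sqrt_psi. rewrite E. simpl Re. split; [|now apply sqrt_lt_R0].
  rewrite RtoC_sqrt_sqr by lra. reflexivity.
Qed.

(** The square root halves the exponent of the decay given by [psi_int_geom], and the larger of the
    two rates serves both signs. *)
Lemma sqrt_psi_bound : exists M r, 0 <= M /\ 0 <= r < 1 /\ forall s k, 0 <= sqrt_psi s k <= M * r ^ k.
Proof.
  assert (H : forall s, exists M r, 0 <= M /\ 0 <= r < 1 /\ forall k, 0 <= sqrt_psi s k <= M * r ^ k).
  { intros s. destruct (psi_int_geom tau (sg s z) (sg s z') xi hxi) as (M & r & HM & Hr & H).
    exists (sqrt M), (sqrt r). split; [apply sqrt_pos|]. split.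
    - split; [apply sqrt_pos|]. rewrite <- sqrt_1. apply sqrt_lt_1; lra.
    - intros k. split; [apply sqrt_pos|].
      assert (E : sqrt M * sqrt r ^ k = sqrt (M * r ^ k)).
      { rewrite sqrt_mult by (auto; apply pow_le; lra). f_equal.
        clear - Hr. induction k; simpl; [now rewrite sqrt_1|].
        rewrite IHk, sqrt_mult by (try lra; apply pow_le; lra). reflexivity. }
      rewrite E. apply sqrt_le_1_alt. rewrite psi_INR.
      eapply Rle_trans; [apply Rle_abs|]. eapply Rle_trans; [apply re_le_Cmod|apply H]. }
  destruct (H plus) as (M1 & r1 & HM1 & Hr1 & H1), (H minus) as (M2 & r2 & HM2 & Hr2 & H2).
  exists (M1 + M2), (Rmax r1 r2). split; [lra|]. split.
  { split; [eapply Rle_trans; [apply Hr1|apply Rmax_l]|apply Rmax_lub_lt; lra]. }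
  intros s k.
  assert (L1 : r1 ^ k <= Rmax r1 r2 ^ k) by (apply pow_incr; split; [lra|apply Rmax_l]).
  assert (L2 : r2 ^ k <= Rmax r1 r2 ^ k) by (apply pow_incr; split; [lra|apply Rmax_r]).
  assert (0 <= r1 ^ k) by (apply pow_le; lra).
  assert (0 <= r2 ^ k) by (apply pow_le; lra).
  destruct s; [destruct (H1 k)|destruct (H2 k)]; split; auto; nra.
Qed.

Lemma psi_int_op (s : sign) (m : nat) :
  psi_int tau (- sg s z) (- sg s z') xi m = (sqrt_psi (op s) m * sqrt_psi (op s) m)%C.
Proof. rewrite <- !sg_op, <- psi_INR. apply psi_sqrt_psi. Qed.

Lemma P_int_expansion (s : sign) : exists M r,
  geom (fun m => sqrt_psi (op s) m * sqrt_psi (op s) m * Q_int (op s) m)%C M r /\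
  forall u, -1 < u -> hypP (sg s z) (sg s z') xi u
    = (1 - CSer (fun m => sqrt_psi (op s) m * sqrt_psi (op s) m * Q_int (op s) m / (u + INR m + 1)))%C.
Proof.
  destruct (hypP_expansion tau (sg s z) (sg s z') xi hxi (tau_sqr s)) as (M & r & Hg & H).
  assert (E : forall m, (psi_int tau (- sg s z) (- sg s z') xi m
    * hypQ tau (- sg s z) (- sg s z') xi (INR m))%C
    = (sqrt_psi (op s) m * sqrt_psi (op s) m * Q_int (op s) m)%C).
  { intros m. rewrite psi_int_op. unfold Q_int. now rewrite !sg_op. }
  exists M, r. split.
  - destruct Hg as (H1 & H2 & H3). split; auto. split; auto. intros m. rewrite <- E. auto.
  - intros u Hu. rewrite (H u Hu). f_equal. apply CSer_ext. intros m. now rewrite E.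
Qed.

Lemma Q_int_expansion (s : sign) : exists M r,
  geom (fun m => sqrt_psi (op s) m * sqrt_psi (op s) m * P_int (op s) m)%C M r /\
  forall u, -1 < u -> hypQ tau (sg s z) (sg s z') xi u
    = CSer (fun m => sqrt_psi (op s) m * sqrt_psi (op s) m * P_int (op s) m / (u + INR m + 1))%C.
Proof.
  destruct (hypQ_expansion tau (sg s z) (sg s z') xi hxi) as (M & r & Hg & H).
  assert (E : forall m, (psi_int tau (- sg s z) (- sg s z') xi m
    * hypP (- sg s z) (- sg s z') xi (INR m))%C
    = (sqrt_psi (op s) m * sqrt_psi (op s) m * P_int (op s) m)%C).
  { intros m. rewrite psi_int_op. unfold P_int. now rewrite !sg_op. }
  exists M, r. split.
  - destruct Hg as (H1 & H2 & H3). split; auto. split; auto. intros m. rewrite <- E. auto.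
  - intros u Hu. rewrite (H u Hu). apply CSer_ext. intros m. now rewrite E.
Qed.

Lemma INR_gt_m1 (k : nat) : -1 < INR k.
Proof. generalize (pos_INR k); lra. Qed.

Lemma CSer_div_bound (a : nat -> C) (M r : R) (k : nat) :
  geom a M r -> Cmod (CSer (fun m => a m / (INR k + INR m + 1))%C) <= M / (1 - r).
Proof.
  intros Ha.
  destruct (geom_bounded_mult (fun m => / (INR k + INR m + 1))%C a 1 M r (Cmod_inv_INR k) Ha)
    as (X1 & X2 & X3).
  rewrite <- (Rmult_1_l M). apply CSer_bound. split; auto. split; auto.
  intros m. unfold Cdiv. rewrite Cmult_comm. auto.
Qed.

(** The partial fraction expansions themselves give the bound, since every denominator is at least 1
    at an integer. *)
Lemma P_Q_int_bound : exists B, forall s k, Cmod (P_int s k) <= B /\ Cmod (Q_int s k) <= B.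
Proof.
  assert (H : forall s, exists B, 0 <= B /\ forall k, Cmod (P_int s k) <= B /\ Cmod (Q_int s k) <= B).
  { intros s. destruct (P_int_expansion s) as (M1 & r1 & G1 & H1).
    destruct (Q_int_expansion s) as (M2 & r2 & G2 & H2).
    assert (P1 : 0 <= M1 / (1 - r1)).
    { destruct G1 as (? & ? & _). apply Rmult_le_pos; auto. left; apply Rinv_0_lt_compat; lra. }
    assert (P2 : 0 <= M2 / (1 - r2)).
    { destruct G2 as (? & ? & _). apply Rmult_le_pos; auto. left; apply Rinv_0_lt_compat; lra. }
    exists (1 + M1 / (1 - r1) + M2 / (1 - r2)). split; [lra|].
    intros k. split.
    - unfold P_int. rewrite (H1 _ (INR_gt_m1 k)). eapply Rle_trans; [apply Cmod_minus_le|].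
      rewrite Cmod_1. generalize (CSer_div_bound _ _ _ k G1). lra.
    - unfold Q_int. rewrite (H2 _ (INR_gt_m1 k)). generalize (CSer_div_bound _ _ _ k G2). lra. }
  destruct (H plus) as (B1 & HB1 & H1), (H minus) as (B2 & HB2 & H2).
  exists (B1 + B2). intros s k. destruct (H1 k), (H2 k). destruct s; split; lra.
Qed.

Lemma Rfun_hypP (s : sign) (u : R) :
  Rfun z z' xi s u = (psi z z' xi s u * hypP (sg s z) (sg s z') xi u)%C.
Proof. reflexivity. Qed.

Lemma Sfun_hypQ (s : sign) (u : R) :
  Sfun z z' xi s u = (psi z z' xi s u * hypQ tau (sg s z) (sg s z') xi u)%C.
Proof. unfold Sfun, hypQ, tau. unfold Cdiv. ring. Qed.

Lemma scaled_INR (s : sign) (k : nat) (F : C) :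
  (psi z z' xi s (INR k) * F / Csqrt_pos (psi z z' xi s (INR k)))%C = (sqrt_psi s k * F)%C.
Proof.
  destruct (psi_sqrt_psi s k) as [E Hp]. unfold Csqrt_pos. fold (sqrt_psi s k). rewrite E.
  field. intros E0. apply RtoC_inj in E0. lra.
Qed.

Lemma Pfun_INR (s : sign) (k : nat) : Pfun z z' xi s (INR k) = (sqrt_psi s k * P_int s k)%C.
Proof. unfold Pfun. rewrite Rfun_hypP. apply scaled_INR. Qed.

Lemma Qfun_INR (s : sign) (k : nat) : Qfun z z' xi s (INR k) = (sqrt_psi s k * Q_int s k)%C.
Proof. unfold Qfun. rewrite Sfun_hypQ. apply scaled_INR. Qed.

Lemma is_deriveC_ext_loc (F G : R -> C) (k : nat) (d : C) :
  (forall u, -1 < u -> F u = G u) -> is_deriveC F (INR k) d -> is_deriveC G (INR k) d.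
Proof.
  intros E [H1 H2].
  assert (Hloc : locally (INR k) (fun u => F u = G u)).
  { exists (mkposreal _ Rlt_0_1). intros u Hu. apply E.
    change (Rabs (u - INR k) < 1) in Hu. apply Rabs_lt_between in Hu.
    generalize (pos_INR k). lra. }
  split; (eapply is_derive_ext_loc; [|eassumption]);
    apply (filter_imp _ _ (fun u (H : F u = G u) => f_equal _ H) Hloc).
Qed.

(** The derivatives of the two expansions are [D1] and [- D2]; the second minus sign cancels that of
    P' Q - Q' P, so both series enter [kernel_block] with a plus. *)
Lemma diag_block_INR (s : sign) (k : nat) :
  diag_block z z' xi s k k = kernel_block sqrt_psi P_int Q_int s k s k.
Proof.
  rewrite kernel_block_diag. unfold diag_block. rewrite PeanoNat.Nat.eqb_refl, Pfun_INR, Qfun_INR.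
  destruct (psi_local s k) as (del & rho & Hdel & Hloc & Hder).
  destruct (P_int_expansion s) as (M1 & r1 & G1 & H1).
  destruct (Q_int_expansion s) as (M2 & r2 & G2 & H2).
  set (D1 := CSer (fun m => sqrt_psi (op s) m * sqrt_psi (op s) m * Q_int (op s) m
    / ((INR k + INR m + 1) * (INR k + INR m + 1)))%C).
  set (D2 := CSer (fun m => sqrt_psi (op s) m * sqrt_psi (op s) m * P_int (op s) m
    / ((INR k + INR m + 1) * (INR k + INR m + 1)))%C).
  assert (dP : is_deriveC (hypP (sg s z) (sg s z') xi) (INR k) D1).
  { apply is_deriveC_ext_loc with (1 := fun u Hu => eq_sym (H1 u Hu)).
    destruct (pf_deriveC _ _ _ k G1) as [X1 X2]. fold D1 in X1, X2. split.
    - apply is_derive_ext with (fun u : R => 1 - Re (CSer (fun m => sqrt_psi (op s) m * sqrt_psi (op s) m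
        * Q_int (op s) m / (u + INR m + 1))%C)); [reflexivity|].
      replace (Re D1) with (0 - Re (- D1)%C) by (rewrite re_opp; ring).
      apply (is_derive_minus (V := R_NormedModule) (fun _ => 1) _ _ 0);
        [exact (is_derive_const (V := R_NormedModule) 1 (INR k))|exact X1].
    - apply is_derive_ext with (fun u : R => 0 - Im (CSer (fun m => sqrt_psi (op s) m * sqrt_psi (op s) m
        * Q_int (op s) m / (u + INR m + 1))%C)); [reflexivity|].
      replace (Im D1) with (0 - Im (- D1)%C) by (rewrite im_opp; ring).
      apply (is_derive_minus (V := R_NormedModule) (fun _ => 0) _ _ 0);
        [exact (is_derive_const (V := R_NormedModule) 0 (INR k))|exact X2]. }
  assert (dQ : is_deriveC (hypQ tau (sg s z) (sg s z') xi) (INR k) (- D2)).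
  { apply is_deriveC_ext_loc with (1 := fun u Hu => eq_sym (H2 u Hu)).
    apply (pf_deriveC _ _ _ k G2). }
  assert (EP : DeriveC (Pfun z z' xi s) (INR k)
    = (RtoC (Derive (fun u => sqrt (rho u)) (INR k)) * P_int s k + RtoC (sqrt (rho (INR k))) * D1)%C).
  { apply (DeriveC_scaled (fun u => psi z z' xi s u) _ rho _ del _ Hdel Hloc Hder dP). }
  assert (EQ : DeriveC (Qfun z z' xi s) (INR k)
    = (RtoC (Derive (fun u => sqrt (rho u)) (INR k)) * Q_int s k
       + RtoC (sqrt (rho (INR k))) * - D2)%C).
  { transitivity (DeriveC (fun u => psi z z' xi s u * hypQ tau (sg s z) (sg s z') xi u
      / Csqrt_pos (psi z z' xi s u))%C (INR k)).
    - unfold DeriveC. f_equal; apply Derive_ext; intros u; unfold Qfun; now rewrite Sfun_hypQ.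
    - apply (DeriveC_scaled (fun u => psi z z' xi s u) _ rho _ del _ Hdel Hloc Hder dQ). }
  assert (Ef : sqrt (rho (INR k)) = sqrt_psi s k).
  { unfold sqrt_psi. destruct (Hloc (INR k)) as [E _]; [rewrite Rminus_diag, Rabs_R0; auto|].
    now rewrite E. }
  rewrite EP, EQ, Ef. ring.
Qed.

Lemma K_matrix_kernel_block (s : sign) (k : nat) (s' : sign) (l : nat) :
  K_matrix z z' xi s k s' l = kernel_block sqrt_psi P_int Q_int s k s' l.
Proof.
  assert (Hsame : diag_block z z' xi s k l = kernel_block sqrt_psi P_int Q_int s k s l).
  { destruct (PeanoNat.Nat.eq_dec k l) as [<- | Hkl]; [apply diag_block_INR|].
    rewrite kernel_block_same by auto. unfold diag_block.
    assert (E := Hkl). apply PeanoNat.Nat.eqb_neq in E. rewrite E.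
    rewrite !Pfun_INR, !Qfun_INR. unfold Cdiv. ring. }
  assert (Hop : forall s1 s2, offdiag_block z z' xi s1 s2 k l
    = (sqrt_psi s1 k * sqrt_psi s2 l * (P_int s1 k * P_int s2 l + Q_int s1 k * Q_int s2 l) / (INR k + INR l + 1))%C).
  { intros s1 s2. unfold offdiag_block. rewrite !Pfun_INR, !Qfun_INR. unfold Cdiv. ring. }
  destruct s, s'; simpl K_matrix; auto; rewrite Hop; unfold kernel_block; simpl sgn.
  - unfold Cdiv. ring.
  - unfold Cdiv. ring.
Qed.

Lemma L_matrix_cauchy_block (s : sign) (k : nat) (s' : sign) (l : nat) :
  L_matrix z z' xi s k s' l = cauchy_block sqrt_psi s k s' l.
Proof.
  destruct s, s'; simpl; auto; unfold PsiWPsi, Csqrt_pos, W; fold (sqrt_psi plus k) (sqrt_psi minus l)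
    (sqrt_psi minus k) (sqrt_psi plus l); unfold Cdiv; ring.
Qed.

Lemma kernel_resolvent : exists K L N : vec -> vec,
    is_operator_of (K_matrix z z' xi) K /\
    is_operator_of (L_matrix z z' xi) L /\
    is_inverse (id_plus L) N /\
    (forall v : vec, in_l2 v -> K v = L (N v)).
Proof.
  destruct sqrt_psi_bound as (M & r & HM & Hr & Hf).
  destruct P_Q_int_bound as [B HB].
  destruct (resolvent_kernel sqrt_psi P_int Q_int M r B HM Hr Hf (fun s k => proj1 (HB s k))
    (fun s k => proj2 (HB s k))) as (K & L & N & [HK1 HK2] & [HL1 HL2] & HN & HKL).
  - intros s k. destruct (P_int_expansion s) as (M1 & r1 & _ & H). apply (H _ (INR_gt_m1 k)).
  - intros s k. destruct (Q_int_expansion s) as (M1 & r1 & _ & H). apply (H _ (INR_gt_m1 k)).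
  - exists K, L, N. split; [|split; [|split]]; auto.
    + split; auto. intros s k s' l. now rewrite HK2, K_matrix_kernel_block.
    + split; auto. intros s k s' l. now rewrite HL2, L_matrix_cauchy_block.
Qed.

End Psi.

Theorem theorem3p3 (z z' : C) (xi : R)
  (hz : admissible z z') (hxi : 0 < xi < 1) :
  exists K L N : vec -> vec,
    is_operator_of (K_matrix z z' xi) K /\
    is_operator_of (L_matrix z z' xi) L /\
    is_inverse (id_plus L) N /\
    (forall v : vec, in_l2 v -> K v = L (N v)).
Proof.
  destruct (admissible_real z z' hz) as (si & t & Hsi & Ht & Htpos & Hqd).
  now apply (kernel_resolvent z z' xi si t).
Qed.
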